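(* There exists an absolute constant $c_5>0$ such that the following holds. Let $n\geq 2$, let $K$ be a convex body in $\mathbb{R}^n$ with $0\in \mathrm{int}(K)$, let $g$ be a bounded locally integrable non-negative function on $\mathbb{R}^n$, and let $\mu$ be the measure on $\mathbb{R}^n$ with density $g$. Then for every $1\leq k\leq n-1$, $$\mu(K)\leq \left(c_5\sqrt{n-k}\right)^k\max_{F\in G_{n,n-k}}\mu(K\cap F)\cdot |K|^{\frac{k}{n}}.$$ In particular, $\alpha_{n,k}(\mu)\leq c_5\sqrt{n-k}$.
   Context: A convex body in $\mathbb{R}^n$ is a compact convex subset with nonempty interior; it is centered if its center of mass is at the origin. $|\cdot|$ denotes volume (Lebesgue measure of the appropriate dimension). $G_{n,s}$ is the Grassmannian of $s$-dimensional linear subspaces of $\mathbb{R}^n$. For a Borel set $B\subseteq\mathbb{R}^n$, $\mu(B)=\int_B g(x)\,dx$; if $B\subseteq F$ for some subspace $F\in G_{n,s}$ with $1\leq s\leq n-1$, integration is understood with respect to the $s$-dimensional Lebesgue measure on $F$. The maximum over $F$ is understood as the supremum if it is not attained. For a measure $\mu$ with density $g$ and $1\leq k\leq n-1$, $\alpha_{n,k}(\mu)$ is the smallest constant $\alpha>0$ such that for every centered convex body $K$ in $\mathbb{R}^n$ one has $\mu(K)\leq \alpha^k\max_{F\in G_{n,n-k}}\mu(K\cap F)\,|K|^{\frac{k}{n}}$. ''Absolute constant'' means a constant independent of all other parameters ($n,k,K,g$). *)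

(* Defs.v *)
From HB Require Import structures.
From mathcomp Require Import all_boot all_order all_algebra.
From mathcomp Require Import all_classical all_reals all_analysis.
From mathcomp Require Import measurable_realfun.

Set Implicit Arguments.
Unset Strict Implicit.
Unset Printing Implicit Defensive.

Import Order.TTheory GRing.Theory Num.Theory.
Import numFieldNormedType.Exports.

Local Open Scope classical_set_scope.
Local Open Scope ring_scope.

Section borel_rV.
Context {R : realType} {n : nat}.

Let borel := @open 'rV[R]_n.

HB.instance Definition _ :=
  @isMeasurable.Build (sigma_display borel) 'rV[R]_n <<s borel >>
    (@sigma_algebra0 _ setT borel) (@sigma_algebraC _ borel)
    (@sigma_algebra_bigcup _ setT borel).

Lemma open_measurable_rV (U : set 'rV[R]_n) : open U -> measurable U.
Proof. exact: sub_sigma_algebra. Qed.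

Lemma measurable_coord (i : 'I_n) :
  measurable_fun [set: 'rV[R]_n] (fun x : 'rV[R]_n => x ord0 i).
Proof.
apply: (measurability _ (RGenOpens.measurableE R)) => _ [_ [a [b ->] <-]].
rewrite setTI; apply: open_measurable_rV.
by apply: open_comp; [move=> x _; exact: coord_continuous|exact: interval_open].
Qed.

Lemma measurable_fun_rVP d (T : measurableType d) (f : T -> 'rV[R]_n) :
  measurable_fun setT f <->
  forall i, measurable_fun setT (fun x => f x ord0 i).
Proof.
split=> [mf i|mf]; first exact: (measurableT_comp (measurable_coord i)).
apply: (@measurability _ _ _ _ setT f borel) => // _ [U oU <-]; rewrite setTI.
pose box (qr : 'rV[rat]_n * rat) : set 'rV[R]_n :=
  [set x | forall i, `|x ord0 i - ratr (qr.1 ord0 i)| < ratr qr.2].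
have -> : f @^-1` U =
    \bigcup_(qr in [set qr | box qr `<=` U]) (f @^-1` box qr).
  apply/seteqP; split => [t Uft|t [qr qrU]]; last by move/qrU.
  have /nbhs_ballP[e /= e0 eU] : nbhs (f t) U by exact: open_nbhs_nbhs.
  have [r] : exists r : rat, ratr r \in `]0, (e / 2)[.
    by apply: rat_in_itvoo; rewrite divr_gt0.
  rewrite in_itv/= => /andP[r0 re].
  have exq i : {q : rat | `|f t ord0 i - ratr q| < ratr r}.
    apply: cid.
    have [q] : exists q : rat, ratr q \in `](f t ord0 i - ratr r),
                                            (f t ord0 i + ratr r)[.
      by apply: rat_in_itvoo; rewrite ltrD2l gtrN.
    rewrite in_itv/= => /andP[q1 q2]; exists q.
    by rewrite ltr_distl ltrBlDr q2 -ltrBlDr.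
  exists (\row_i sval (exq i), r) => /=; last first.
    by move=> i; rewrite mxE; exact: (svalP (exq i)).
  move=> x xb; apply: eU; rewrite /ball/=; split => // i j.
  rewrite (ord1 i) /ball/=.
  have := xb j; rewrite /= mxE => h1; have h2 := svalP (exq j).
  rewrite -(subrKA (ratr (sval (exq j)))) (le_lt_trans (ler_normD _ _))//.
  by rewrite [ltRHS]splitr ltrD// (lt_trans _ re)// distrC.
rewrite bigcup_mkcond; apply: countable_bigcupT_measurable => // qr.
case: ifPn => // _.
rewrite [X in measurable X](_ : _ = \big[setI/setT]_(i < n)
  [set t | `|f t ord0 i - ratr (qr.1 ord0 i)| < ratr qr.2]); last first.
  rewrite -bigcap_seq; apply/seteqP; split => t /= h i.
    by move=> _; exact: h.
  by apply: h; rewrite /= mem_index_enum.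
apply: bigsetI_measurable => i _.
have -> : [set t | `|f t ord0 i - ratr (qr.1 ord0 i)| < ratr qr.2] =
  (fun t => f t ord0 i) @^-1` ball (ratr (qr.1 ord0 i) : R) (ratr qr.2).
  by apply/seteqP; split => t; rewrite /ball/= distrC.
rewrite -[X in measurable X]setTI; apply: mf => //; exact: measurable_ball.
Qed.

End borel_rV.

Lemma measurable_mulmxr (R : realType) m n (B : 'M[R]_(m, n)) :
  measurable_fun setT (fun x : 'rV[R]_m => x *m B).
Proof.
apply/measurable_fun_rVP => i; under eq_fun do rewrite mxE.
apply: measurable_sum => j; apply: measurable_funM => //.
exact: measurable_coord.
Qed.

(* (x_0, ..., x_(n-1)), t |-> (x_0, ..., x_(n-1), t) *)
Definition rV_snoc {R : realType} {n} (p : 'rV[R]_n * measurableTypeR R) :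
    'rV[R]_n.+1 :=
  \row_j oapp (fun i => p.1 ord0 i) (p.2 : R) (unlift ord_max j).

Lemma measurable_rV_snoc (R : realType) n : measurable_fun setT (@rV_snoc R n).
Proof.
apply/measurable_fun_rVP => j; under eq_fun do rewrite mxE.
case: unliftP => [i _|_] /=; last exact: measurable_snd.
by apply: (measurableT_comp (measurable_coord i)); exact: measurable_fst.
Qed.

Local Open Scope ereal_scope.

(* Lebesgue measure on the Borel sets of R^n, as iterated product of the
   one-dimensional Lebesgue measure. *)
Fixpoint lebesgue_rV {R : realType} (n : nat) : set 'rV[R]_n -> \bar R :=
  if n is m.+1
  then pushforward (lebesgue_rV (n := m) \x lebesgue_measure) (@rV_snoc R m)
  else \d_(0%R : 'rV[R]_0).
Lemma lebesgue_rV_isMeasure (R : realType) n :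
  exists m : {measure set 'rV[R]_n -> \bar R}, m = lebesgue_rV (n := n) :> (_ -> _).
Proof.
elim: n => [|n [m mE]] /=; first by exists [the measure _ _ of \d_(0%R : 'rV[R]_0)].
rewrite -mE.
pose pm : {measure set ('rV[R]_n * measurableTypeR R) -> \bar R} :=
  [the measure _ _ of m \x lebesgue_measure].
by exists (measure_function_pushforward__canonical__measure_function_Measure
  pm (measurable_rV_snoc (R := R) (n := n))).
Qed.

Section lebesgue_rV_measure.
Context {R : realType} {n : nat}.
Local Notation lam := (@lebesgue_rV R n).

Let lam0 : lam set0 = 0.
Proof. by have [m <-] := lebesgue_rV_isMeasure R n; exact: measure0. Qed.

Let lam_ge0 A : 0 <= lam A.
Proof. by have [m <-] := lebesgue_rV_isMeasure R n; exact: measure_ge0. Qed.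

Let lam_sigma_additive : semi_sigma_additive lam.
Proof.
by have [m <-] := lebesgue_rV_isMeasure R n; exact: measure_semi_sigma_additive.
Qed.

HB.instance Definition _ :=
  isMeasure.Build _ _ _ lam lam0 lam_ge0 lam_sigma_additive.

End lebesgue_rV_measure.

Lemma lebesgue_rV_box (R : realType) n (A : 'I_n -> set (measurableTypeR R)) :
  (forall i, measurable (A i)) ->
  lebesgue_rV [set x : 'rV[R]_n | forall i, A i (x ord0 i)] =
  \prod_(i < n) lebesgue_measure (A i).
Proof.
elim: n A => [|n ih] A mA.
  by rewrite big_ord0 /= diracE mem_set//=; case.
rewrite big_ord_recr/= -(ih (fun i => A (widen_ord (leqnSn n) i)))//.
have mB : measurable
    [set x : 'rV[R]_n | forall i, A (widen_ord (leqnSn n) i) (x ord0 i)].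
  rewrite [X in measurable X](_ : _ = \big[setI/setT]_(i < n)
    ((fun x : 'rV[R]_n => x ord0 i) @^-1` A (widen_ord (leqnSn n) i))).
    apply: bigsetI_measurable => i _.
    rewrite -[X in measurable X]setTI; apply: (measurable_coord i) => //.
    exact: mA.
  rewrite -bigcap_seq; apply/seteqP; split => t /= h i.
    by move=> _; exact: h.
  by apply: h; rewrite /= mem_index_enum.
rewrite -product_measure1E// /pushforward; congr (_ _).
have wE i : widen_ord (leqnSn n) i = lift ord_max i.
  by apply/val_inj => /=; rewrite /bump leqNgt ltn_ord.
apply/seteqP; split => -[x t] /= h.
  split => [i|].
    by have := h (widen_ord (leqnSn n) i); rewrite mxE wE liftK.
  by have := h ord_max; rewrite mxE unlift_none.
move=> j; rewrite mxE; case: unliftP => [i ->|->] /=; last by case: h.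
by rewrite -wE; case: h.
Qed.

Local Close Scope ereal_scope.

Section subspace.
Context {R : realType} {n : nat}.
Implicit Types F : {vspace 'rV[R]_n}.

(* The rows of an orthonormal frame of F are an orthonormal basis of F. *)
Definition orthonormal_frame F (B : 'M[R]_(\dim F, n)) :=
  B *m B^T = 1%:M /\ forall i, row i B \in F.

Lemma orthonormal_frame_exists F : exists B, orthonormal_frame (F := F) B.
Proof.
suff H k : (k <= \dim F)%N ->
    exists B : 'M[R]_(k, n), B *m B^T = 1%:M /\ forall i, row i B \in F.
  exact: H.
elim: k => [_|k ih kF].
  by exists 0%R; split => [|[]//]; apply/matrixP => -[].
have [B [BB BF]] := ih (ltnW kF).
pose f : 'Hom('rV[R]_n, 'rV[R]_k) := linfun (mulmxr B^T).
have : (F :&: lker f)%VS != 0%VS.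
  apply/eqP => F0; have := limg_ker_dim f F; rewrite F0 dimv0 add0n => fF.
  have := dimvS (subvf (f @: F)%VS).
  by rewrite fF dimvf /dim/= mul1n leqNgt kF.
rewrite -vpick0; set v := vpick _ => v0.
have /andP[vF vf] : (v \in F) && (v \in lker f) by rewrite -memv_cap memv_pick.
have {vf}vB : v *m B^T = 0 by move: vf; rewrite memv_ker lfunE/= => /eqP.
pose s := \sum_j v ord0 j ^+ 2.
have vv : v *m v^T = s%:M.
  apply/matrixP => i j; rewrite !ord1 !mxE eqxx mulr1n.
  by apply: eq_bigr => l _; rewrite mxE expr2.
have s0 : (0 < s)%R.
  rewrite lt_neqAle sumr_ge0 ?andbT => [|j _]; last exact: sqr_ge0.
  apply: contra v0; rewrite eq_sym psumr_eq0 => [/allP vj|j _]; last exact: sqr_ge0.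
  apply/eqP/rowP => j; rewrite mxE; apply/eqP.
  by rewrite -sqrf_eq0; apply: vj; rewrite mem_index_enum.
pose u := (Num.sqrt s)^-1 *: v.
have uu : u *m u^T = 1%:M.
  rewrite /u linearZ/= -scalemxAl -scalemxAr scalerA vv -scalemx1 scalerA.
  by rewrite -invfM -expr2 sqr_sqrtr ?(ltW s0)// mulVf ?gt_eqF// scale1r.
have uB : u *m B^T = 0 by rewrite /u -scalemxAl vB scaler0.
have Bu : B *m u^T = 0 by rewrite -[B]trmxK -trmx_mul uB trmx0.
rewrite -addn1; exists (col_mx B u); split.
  by rewrite tr_col_mx mul_col_row BB uu uB Bu -scalar_mx_block.
move=> i; case: (split_ordP i) => j ->; first by rewrite rowKu.
rewrite rowKd (_ : row j u = u) ?memvZ//.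
by apply/rowP => l; rewrite mxE ord1.
Qed.

Definition frame F : 'M[R]_(\dim F, n) := get (orthonormal_frame (F := F)).

Lemma frameP F : orthonormal_frame (frame F).
Proof. exact: getPex (orthonormal_frame_exists F). Qed.

(* Lebesgue measure of the subspace F of R^n: the image of Lebesgue measure on
   R^(dim F) under the linear isometry onto F given by an orthonormal basis. *)
Definition lebesgue_on F : set 'rV[R]_n -> \bar R :=
  pushforward (@lebesgue_rV R (\dim F)) (fun x => x *m frame F).

HB.instance Definition _ F := Measure.copy (lebesgue_on F)
  (measure_function_pushforward__canonical__measure_function_Measure
    (@lebesgue_rV R (\dim F)) (measurable_mulmxr (frame F))).

End subspace.

Local Open Scope ereal_scope.

Section sections.
Context {R : realType} {n : nat}.
Implicit Types (g : 'rV[R]_n -> R) (K : set 'rV[R]_n) (F : {vspace 'rV[R]_n}).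

(* Measurability for the completed measure. For the nonnegative functions g
   considered here, the integrals below are suprema of integrals of Borel simple
   functions below g; over a subspace on which the restriction of g fails to be
   measurable this is the lower integral. *)
Definition lebesgue_measurable_fun g :=
  exists2 h : 'rV[R]_n -> R, measurable_fun setT h &
    {ae (@lebesgue_rV R n), forall x, g x = h x}.

Definition locally_integrable_rV g := lebesgue_measurable_fun g /\
  forall C, compact C -> \int[@lebesgue_rV R n]_(x in C) `|g x|%:E < +oo.

Definition mu_density g K : \bar R := \int[@lebesgue_rV R n]_(x in K) (g x)%:E.

Definition mu_section g F K : \bar R :=
  \int[lebesgue_on F]_(x in K `&` [set` F]) (g x)%:E.

Definition max_section g (s : nat) K : \bar R :=
  ereal_sup [set mu_section g F K | F in [set F | \dim F = s]].

Definition convex_body K :=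
  [/\ convex_set K, compact K & interior K !=set0].

Definition centroid K : 'rV[R]_n :=
  (\row_i ((\int[@lebesgue_rV R n]_(x in K) (x ord0 i))
           / fine (lebesgue_rV K)))%R.

Definition centered K := centroid K = 0%R.

(* "Smallest constant" is read as an infimum, +oo if no constant works. *)
Definition alpha g (k : nat) : \bar R :=
  ereal_inf [set a%:E | a in [set a : R | (0 < a)%R /\
    forall K, convex_body K -> centered K ->
      mu_density g K <=
        (a ^+ k)%:E * max_section g (n - k) K
          * lebesgue_rV K `^ (k%:R / n%:R)]].

End sections.

(* Main.v *)
(* Write n = s + k. Up to a null set, the s-dimensional subspaces of R^n are the
   graphs F_B of y |-> y B^T, with B a k x s matrix. Take s points of R^n, with
   first s coordinates the rows of Y : 'M_s. For det Y <> 0 they lie on a unique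
   graph F_B, and the Blaschke-Petkantschin change of variables gives
     (int_K g)^s = int_B int_Y (prod_i (g 1_K)(y_i, y_i B^T)) |det Y|^k.
   Let v(B) be the volume of the projection of K \cap F_B to R^s and J(B) the
   factor between the Lebesgue measures of R^s and F_B. When 0 is in K, |det Y|
   is at most s^s v(B), and int_Y prod_i (g 1_K)(y_i, y_i B^T) is
   (mu(K \cap F_B) / J(B))^s; so with M the maximal measure of a section
     mu(K)^s <= M^s s^(s k) int_B v^k J^-s.
   Young's splitting v^k J^-s <= T^k J^-n + T^-s v^n, with T = |K|^(s/n) sqrt s,
   leaves two integrals. Both are bounded by the change of variables itself, read
   backwards for g = 1_K and for a Gaussian, together with a lower bound on
   int |det Y|^k (over points of a convex set, or for a truncated Gaussian). That
   lower bound reduces to int |det Y|^2 = s! det Sigma, with Sigma the matrix of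
   second moments, and to the fact that among densities with values in [0, 1] the
   ball-like ones minimize det Sigma up to a factor c^s.
   A centered body of positive volume contains 0, so the bound applies to it. *)

From HB Require Import structures.
Require Import Defs.
From mathcomp Require Import all_boot all_order all_algebra perm.
From mathcomp Require Import all_classical all_reals all_analysis.
From mathcomp Require Import measurable_realfun gauss_integral.
From mathcomp Require Import zify ring lra.

Set Implicit Arguments.
Unset Strict Implicit.
Unset Printing Implicit Defensive.

Import Order.TTheory GRing.Theory Num.Theory.
Import numFieldNormedType.Exports.

Local Open Scope classical_set_scope.
Local Open Scope ring_scope.

(** * Affine substitutions on the line *)

Section affine.
Context {R : realType}.
Local Notation mu := (@lebesgue_measure R).

(** The sqrt s of the bound compares the largest with the typical size of |det Y| over s points of a
    section: at most s^s v against at least (c sqrt s)^s v. The largest value enters the estimate of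
    the kernel k times, the typical one sits in the denominator of both remaining integrals, and the
    s-th root leaves k factors sqrt s. The typical size is accessible only through the second
    moment, where the determinant can be expanded. Passing from exponent 2 to exponent k costs one
    ratio of largest to typical size; for a body this is of order (sqrt s)^s whatever k is, which
    explains the sqrt s in T. The invariant measure of the Grassmannian is never constructed: in the
    chart B its density is a multiple of J^-n, and only an upper bound on the integral of J^-n is
    needed. A separate obstacle is that subspaces are null sets, so a change of g almost everywhere
    may change its sections. The integrals are therefore carried out for a Borel function that is
    below g at every point and equal to g almost everywhere. *)

Definition affine1 (d a : R) : measurableTypeR R -> measurableTypeR R :=
  fun t => d * t + a.

Lemma measurable_affine1 d a : measurable_fun setT (affine1 d a).
Proof.
apply: measurable_funD => //; exact: measurable_funM.
Qed.

Lemma lebesgue_affine1 (d a : R) A : d != 0 -> measurable A ->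
  (`|d|%:E * pushforward mu (affine1 d a) A = mu A)%E.
Proof.
move=> d0 mA; apply/esym.
pose m := measure_function_pushforward__canonical__measure_function_Measure
   (mu : {measure set _ -> \bar R}) (measurable_affine1 d a).
pose nu : {measure set (measurableTypeR R) -> \bar R} :=
  mscale (NngNum (normr_ge0 d)) m.
rewrite -[RHS]/(nu A).
apply: (@lebesgue_measure_unique _ nu) mA => _ [[x y]] _ <-.
rewrite -[RHS]/(`|d|%:E * mu (affine1 d a @^-1` `]x, y]%classic))%E.
case: (ltgtP d 0) d0 => // dd _.
(* A negative slope exchanges the ends, so the half-open preimage is closed on the left; its length
   is the same. *)
- have -> : affine1 d a @^-1` `]x, y] = `[(y - a) / d, (x - a) / d[%classic.
    apply/seteqP; split => t; rewrite /affine1 /= !in_itv/=;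
    by rewrite ler_ndivrMr// ltr_ndivlMr// [d * t]mulrC; lra.
  rewrite !lebesgue_measure_itv/= !lte_fin ltr_nM2r ?invr_lt0//.
  rewrite ltrD2r ltr0_norm//; case: ifP; rewrite ?mule0 // => _.
  by rewrite -!EFinD -EFinM; congr EFin; field; rewrite lt_eqF.
- have -> : affine1 d a @^-1` `]x, y] = `](x - a) / d, (y - a) / d]%classic.
    apply/seteqP; split => t; rewrite /affine1 /= !in_itv/=;
    by rewrite ler_pdivlMr// ltr_pdivrMr// [d * t]mulrC; lra.
  rewrite !lebesgue_measure_itv/= !lte_fin ltr_pM2r ?invr_gt0//.
  rewrite ltrD2r gtr0_norm//; case: ifP; rewrite ?mule0 // => _.
  by rewrite -!EFinD -EFinM; congr EFin; field; rewrite gt_eqF.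
Qed.

Local Open Scope ereal_scope.

Lemma integral_affine1 (d a : R) (f : measurableTypeR R -> \bar R) :
  d != 0%R -> measurable_fun setT f -> (forall x, 0 <= f x) ->
  `|d|%:E * \int[mu]_t f (affine1 d a t) = \int[mu]_t f t.
Proof.
move=> d0 mf f0.
pose m := measure_function_pushforward__canonical__measure_function_Measure
   (mu : {measure set _ -> \bar R}) (measurable_affine1 d a).
have := @ge0_integral_pushforward _ _ _ _ _ _ (measurable_affine1 d a) mu setT f
  measurableT mf (fun y _ => f0 y).
rewrite preimage_setT => <-.
rewrite -(@ge0_integral_mscale _ _ _ m _ measurableT (NngNum (normr_ge0 d)))//.
apply: eq_measure_integral => A mA _.
exact: (@lebesgue_affine1 d a A).
Qed.

End affine.

(** * Lebesgue measure of R^n: sigma-finiteness and splitting of coordinates *)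

Section sigma_finite.
Context {R : realType} {n : nat}.

Lemma lebesgue_rV_sigma_finite : sigma_finite setT (@lebesgue_rV R n).
Proof.
pose I (N : nat) : set (measurableTypeR R) := `[- (N%:R), N%:R]%classic.
exists (fun N => [set x : 'rV[R]_n | forall i, I N (x ord0 i)]).
  apply/esym; rewrite -subTset => x _.
  pose M := \big[Num.max/0]_i `|x ord0 i|.
  exists (Num.truncn M).+1 => // i; rewrite /I /= in_itv/= -ler_norml.
  apply: le_trans (ltW (truncnS_gt _)).
  exact: (le_bigmax_cond 0 (fun i => `|x ord0 i|)).
move=> N; have mI : measurable (I N) by exact: measurable_itv.
split; last first.
  rewrite (lebesgue_rV_box (A := fun=> I N))//.
  have [r rE] : exists r, @lebesgue_measure R (I N) = r%:E.
    by rewrite /I lebesgue_measure_itv/=; case: ifP; eexists.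
  by under eq_bigr do rewrite rE; rewrite prodEFin ltry.
rewrite [X in measurable X](_ : _ = \big[setI/setT]_(i < n)
  ((fun x : 'rV[R]_n => x ord0 i) @^-1` I N)).
  apply: bigsetI_measurable => i _.
  rewrite -[X in measurable X]setTI; exact: (measurable_coord i).
rewrite -bigcap_seq; apply/seteqP; split => t /= h i.
  by move=> _; exact: h.
by apply: h; rewrite /= mem_index_enum.
Qed.

HB.instance Definition _ := @Measure_isSigmaFinite.Build _ _ _ (@lebesgue_rV R n)
  lebesgue_rV_sigma_finite.

End sigma_finite.

Section cons.
Context {R : realType}.
Local Open Scope ereal_scope.
Local Notation lam n := (@lebesgue_rV R n).
Local Notation mu := (@lebesgue_measure R).

Lemma measurable_row_mx d (T : measurableType d) m n
    (f : T -> 'rV[R]_m) (g : T -> 'rV[R]_n) :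
  measurable_fun setT f -> measurable_fun setT g ->
  measurable_fun setT (fun x => row_mx (f x) (g x)).
Proof.
move=> mf mg; apply/measurable_fun_rVP => i.
case: (split_ordP i) => j ->.
  under eq_fun do rewrite row_mxEl.
  exact: (measurableT_comp (measurable_coord j)).
under eq_fun do rewrite row_mxEr.
exact: (measurableT_comp (measurable_coord j)).
Qed.

Lemma measurable_scalar_rV1 (d : measure_display) (T : measurableType d) (f : T -> R) :
  measurable_fun setT f -> measurable_fun setT (fun x => (f x)%:M : 'rV[R]_1).
Proof.
move=> mf; apply/measurable_fun_rVP => i.
by under eq_fun do rewrite (ord1 i) mxE eqxx mulr1n.
Qed.

Lemma integral_snoc n (f : 'rV[R]_n.+1 -> \bar R) :
  measurable_fun setT f -> (forall x, 0 <= f x) ->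
  \int[lam n.+1]_x f x = \int[lam n]_x \int[mu]_t f (rV_snoc (x, t)).
Proof.
move=> mf f0.
rewrite -[LHS]/(\int[pushforward (lam n \x mu) (@rV_snoc R n)]_x f x).
rewrite (@ge0_integral_pushforward _ _ _ _ _ _ (@measurable_rV_snoc R n))//.
have mfs : measurable_fun setT (f \o @rV_snoc R n).
  by apply: measurableT_comp => //; exact: measurable_rV_snoc.
by rewrite preimage_setT fubini_tonelli1// => x; exact: f0.
Qed.

Lemma integral_rV0 (f : 'rV[R]_0 -> \bar R) :
  measurable_fun setT f -> \int[lam 0]_x f x = f 0%R.
Proof.
move=> mf; rewrite -[LHS]/(\int[\d_(0%R : 'rV[R]_0)]_x f x).
by rewrite integral_dirac// diracT mul1e.
Qed.

Definition rV_cons {n} (t : R) (x : 'rV[R]_n) : 'rV[R]_n.+1 :=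
  row_mx (t%:M : 'rV_1) x.

Lemma measurable_rV_cons d (T : measurableType d) n (f : T -> R) (g : T -> 'rV[R]_n) :
  measurable_fun setT f -> measurable_fun setT g ->
  measurable_fun setT (fun x => rV_cons (f x) (g x)).
Proof.
by move=> mf mg; exact: (measurable_row_mx (measurable_scalar_rV1 mf) mg).
Qed.

Lemma rV_cons0 n (t : R) (x : 'rV[R]_n) : rV_cons t x ord0 ord0 = t.
Proof.
have <- : lshift n (ord0 : 'I_1) = (ord0 : 'I_n.+1) by exact/val_inj.
by apply: etrans (row_mxEl (t%:M : 'rV_1) x ord0 ord0) _; rewrite mxE eqxx.
Qed.

Lemma rV_consS n (t : R) (x : 'rV[R]_n) i :
  rV_cons t x ord0 (lift ord0 i) = x ord0 i.
Proof.
have <- : rshift 1 i = lift ord0 i :> 'I_n.+1 by exact/val_inj.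
exact: (row_mxEr (t%:M : 'rV_1) x ord0 i).
Qed.

Lemma rV_snoc_max n (t : R) (x : 'rV[R]_n) : rV_snoc (x, t) ord0 ord_max = t.
Proof. by rewrite mxE unlift_none. Qed.

Lemma rV_snoc_lift n (t : R) (x : 'rV[R]_n) i :
  rV_snoc (x, t) ord0 (lift ord_max i) = x ord0 i.
Proof. by rewrite mxE liftK. Qed.

Lemma rV_cons_snoc n (t u : R) (x : 'rV[R]_n) :
  rV_snoc (rV_cons t x, u) = rV_cons t (rV_snoc (x, u)).
Proof.
apply/rowP => j; case: (unliftP ord0 j) => [i|] ->.
  rewrite rV_consS; case: (unliftP ord_max i) => [k|] ->.
    rewrite rV_snoc_lift (_ : lift ord0 _ = lift ord_max (lift ord0 k)).
      by rewrite rV_snoc_lift rV_consS.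
    have kn := ltn_ord k; apply/val_inj.
    by rewrite /= /bump /= !add1n ltnS leqNgt kn.
  rewrite rV_snoc_max (_ : lift ord0 _ = ord_max) ?rV_snoc_max//.
  exact/val_inj.
rewrite rV_cons0 (_ : ord0 = lift ord_max ord0) ?rV_snoc_lift ?rV_cons0//.
exact/val_inj.
Qed.

(** [lebesgue_rV] is built by appending a last coordinate, while block matrices split off the first
    ones. The induction takes the last coordinate out, applies the hypothesis to the rest and puts
    the last coordinate back. *)
Lemma integral_cons n (f : 'rV[R]_n.+1 -> \bar R) :
  measurable_fun setT f -> (forall x, 0 <= f x) ->
  \int[lam n.+1]_x f x = \int[mu]_t \int[lam n]_x f (rV_cons t x).
Proof.
elim: n f => [|n IH] f mf f0.
  have mfs : measurable_fun setT (fun p => f (rV_snoc p)).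
    by apply: measurableT_comp => //; exact: measurable_rV_snoc.
  rewrite integral_snoc// integral_rV0; last first.
    exact: (measurable_fun_fubini_tonelli_F (m2 := mu) _ mfs).
  apply: eq_integral => t _.
  rewrite integral_rV0; last first.
    by apply: measurableT_comp => //; exact: measurable_rV_cons.
  congr f; apply/rowP => j.
  rewrite (ord1 j) rV_cons0 -[RHS](rV_snoc_max t (0%R : 'rV[R]_0)).
  by congr (rV_snoc _ _ _); exact/val_inj.
have mfs : measurable_fun setT (fun p => f (rV_snoc p)).
  by apply: measurableT_comp => //; exact: measurable_rV_snoc.
rewrite integral_snoc// IH; last 2 first.
- exact: (measurable_fun_fubini_tonelli_F (m2 := mu) _ mfs).
- by move=> x; exact: integral_ge0.
apply: eq_integral => t _.
have mft : measurable_fun setT (fun x => f (rV_cons t x)).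
  by apply: measurableT_comp => //; exact: measurable_rV_cons.
apply: esym; apply: etrans (integral_snoc mft (fun x => f0 _)) _.
by apply: eq_integral => x _; apply: eq_integral => u _; rewrite rV_cons_snoc.
Qed.

Lemma row_mx_cons m n t (u : 'rV[R]_m) (v : 'rV[R]_n) :
  row_mx (rV_cons t u) v = rV_cons t (row_mx u v) :> 'rV[R]_(m + n).+1.
Proof.
apply/rowP => j.
case: (split_ordP (j : 'I_(m.+1 + n))) => i ->.
  apply: etrans (row_mxEl (rV_cons t u) v ord0 i) _.
  case: (unliftP ord0 i) => [k|] ->.
    rewrite rV_consS.
    have -> : lshift n (lift ord0 k) = lift ord0 (lshift n k) :> 'I_(m + n).+1.
      exact/val_inj.
    by rewrite rV_consS row_mxEl.
  rewrite rV_cons0.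
  have -> : lshift n ord0 = ord0 :> 'I_(m + n).+1 by exact/val_inj.
  by rewrite rV_cons0.
apply: etrans (row_mxEr (rV_cons t u) v ord0 i) _.
have -> : rshift m.+1 i = lift ord0 (rshift m i) :> 'I_(m + n).+1.
  exact/val_inj.
by rewrite rV_consS row_mxEr.
Qed.

Lemma integral_row_mx m n (f : 'rV[R]_(m + n) -> \bar R) :
  measurable_fun setT f -> (forall x, 0 <= f x) ->
  \int[lam (m + n)]_x f x = \int[lam m]_x \int[lam n]_y f (row_mx x y).
Proof.
elim: m f => [|m IH] f mf f0.
  have mfr : measurable_fun setT (fun p : 'rV_0 * 'rV_n => f (row_mx p.1 p.2)).
    by apply: measurableT_comp => //; exact: measurable_row_mx.
  rewrite integral_rV0; last first.
    exact: (measurable_fun_fubini_tonelli_F (m2 := lam n) _ mfr).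
  by apply: eq_integral => x _; congr f; apply/rowP => j;
     rewrite -[j in RHS](_ : rshift 0 j = j) ?row_mxEr//; exact/val_inj.
have mfr : measurable_fun setT (fun p : 'rV_m.+1 * 'rV_n => f (row_mx p.1 p.2)).
  by apply: measurableT_comp => //; exact: measurable_row_mx.
apply: etrans (integral_cons (n := m + n) mf f0) _.
have mF := measurable_fun_fubini_tonelli_F (m2 := lam n) _ mfr.
rewrite (integral_cons (mF _))/=; last 2 first.
- by move=> x; exact: f0.
- by move=> x; exact: integral_ge0.
apply: eq_integral => t _.
have mft : measurable_fun setT (fun x : 'rV_(m + n) => f (rV_cons t x)).
  by apply: measurableT_comp => //; exact: measurable_rV_cons.
apply: etrans (IH _ mft (fun=> f0 _)) _.
by apply: eq_integral => x _; apply: eq_integral => y _; rewrite row_mx_cons.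
Qed.

End cons.

(** * Linear change of variables in R^n *)

Section change_of_variables.
Context {R : realType}.
Local Open Scope ereal_scope.
Local Notation lam n := (@lebesgue_rV R n).
Local Notation mu := (@lebesgue_measure R).

Lemma fubini_cons n (f : 'rV[R]_n.+1 -> \bar R) :
  measurable_fun setT f -> (forall x, 0 <= f x) ->
  \int[mu]_t \int[lam n]_x f (rV_cons t x) =
  \int[lam n]_x \int[mu]_t f (rV_cons t x).
Proof.
move=> mf f0; apply: (@fubini_tonelli _ _ _ _ _ mu (lam n)
  (fun p : measurableTypeR R * 'rV[R]_n => f (rV_cons p.1 p.2))) => [|p].
  by apply: measurableT_comp => //; exact: measurable_rV_cons.
exact: f0.
Qed.

Lemma measurable_fun_comp_cons n (f : 'rV[R]_n.+1 -> \bar R) t :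
  measurable_fun setT f -> measurable_fun setT (fun x : 'rV[R]_n => f (rV_cons t x)).
Proof.
by move=> mf; apply: measurableT_comp => //; exact: measurable_rV_cons.
Qed.

Lemma measurable_fun_comp_cons2 n (f : 'rV[R]_n.+1 -> \bar R) x :
  measurable_fun setT f ->
  measurable_fun setT (fun t : measurableTypeR R => f (rV_cons t x)).
Proof.
by move=> mf; apply: measurableT_comp => //; exact: measurable_rV_cons.
Qed.

Lemma measurable_rV_add n (w : 'rV[R]_n) :
  measurable_fun setT (fun x : 'rV[R]_n => (x + w)%R).
Proof.
apply/measurable_fun_rVP => i; under eq_fun do rewrite mxE.
by apply: measurable_funD => //; exact: measurable_coord.
Qed.

Lemma integral_affine1T a (f : measurableTypeR R -> \bar R) :
  measurable_fun setT f -> (forall x, 0 <= f x) ->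
  \int[mu]_t f (t + a)%R = \int[mu]_t f t.
Proof.
move=> mf f0; rewrite -(@integral_affine1 _ 1 a f)// ?oner_eq0// normr1 mul1e.
by apply: eq_integral => t _; rewrite /affine1 mul1r.
Qed.

Lemma rV_cons_add n t (a : R) (x w : 'rV[R]_n) :
  (rV_cons t x + rV_cons a w)%R = rV_cons (t + a)%R (x + w)%R.
Proof.
apply/rowP => j; rewrite mxE; case: (unliftP ord0 j) => [i|] ->.
  by rewrite !rV_consS mxE.
by rewrite !rV_cons0.
Qed.

Lemma rV_cons_sub n (x : 'rV[R]_n.+1) :
  x = rV_cons (x ord0 ord0) (\row_i x ord0 (lift ord0 i)).
Proof.
apply/rowP => j; case: (unliftP ord0 j) => [i|] ->.
  by rewrite rV_consS mxE.
by rewrite rV_cons0.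
Qed.

Lemma integral_translate n (w : 'rV[R]_n) (f : 'rV[R]_n -> \bar R) :
  measurable_fun setT f -> (forall x, 0 <= f x) ->
  \int[lam n]_x f (x + w)%R = \int[lam n]_x f x.
Proof.
elim: n w f => [|n IH] w f mf f0.
  by apply: eq_integral => x _; congr f; apply/rowP => -[].
have mfw : measurable_fun setT (fun x : 'rV[R]_n.+1 => f (x + w)%R).
  by apply: measurableT_comp => //; exact: measurable_rV_add.
rewrite (integral_cons mfw (fun=> f0 _)) (integral_cons mf f0).
rewrite (rV_cons_sub w); set a := w ord0 ord0; set w' := (\row__ _)%R.
transitivity (\int[mu]_t \int[lam n]_x f (rV_cons (t + a)%R x)).
  apply: eq_integral => t _.
  under eq_integral do rewrite rV_cons_add.
  exact: (IH w' (fun x => f (rV_cons (t + a)%R x))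
    (measurable_fun_comp_cons _ mf) (fun=> f0 _)).
rewrite (fubini_cons mf f0).
have mfa : measurable_fun setT (fun x : 'rV[R]_n.+1 => f (x + rV_cons a 0)%R).
  by apply: measurableT_comp => //; exact: measurable_rV_add.
have := fubini_cons mfa (fun=> f0 _).
under eq_integral do under eq_integral do rewrite rV_cons_add addr0.
move=> ->; apply: eq_integral => x _.
under eq_integral do rewrite rV_cons_add addr0.
exact: (integral_affine1T a (measurable_fun_comp_cons2 x mf) (fun=> f0 _)).
Qed.

(** With P acting inside and its determinant in front, the property passes to products, so it has to
    be checked on elementary factors only. *)
Definition dilates n (P : 'M[R]_n) := forall f : 'rV[R]_n -> \bar R,
  measurable_fun setT f -> (forall x, 0 <= f x) ->
  `|\det P|%:E * \int[lam n]_x f (x *m P)%R = \int[lam n]_x f x.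

Lemma measurable_fun_comp_mulmx m n (P : 'M[R]_(m, n)) (f : 'rV[R]_n -> \bar R) :
  measurable_fun setT f -> measurable_fun setT (fun x : 'rV[R]_m => f (x *m P)%R).
Proof.
by move=> mf; apply: measurableT_comp => //; exact: measurable_mulmxr.
Qed.

Lemma dilates_mul n (P Q : 'M[R]_n) : dilates P -> dilates Q -> dilates (P *m Q).
Proof.
move=> hP hQ f mf f0; rewrite det_mulmx normrM mulrC EFinM -muleA.
under eq_integral do rewrite mulmxA.
by rewrite (hP (fun x => f (x *m Q)%R) (measurable_fun_comp_mulmx Q mf) (fun=> f0 _)) hQ.
Qed.

Definition corner_mx n (a : R) (b : 'rV[R]_n) (c : 'cV[R]_n) (D : 'M[R]_n) :
  'M[R]_n.+1 := block_mx (a%:M : 'M[R]_1) b c D.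

Lemma rV_cons_corner n t (x : 'rV[R]_n) a b c D :
  (rV_cons t x *m corner_mx a b c D =
   rV_cons (t * a + (x *m c) ord0 ord0) (t *: b + x *m D))%R.
Proof.
apply: etrans (mul_row_block (t%:M : 'M[R]_1) x (a%:M : 'M[R]_1) b c D) _.
rewrite -scalar_mxM mul_scalar_mx /rV_cons [(x *m c)%R]mx11_scalar !mxE.
by rewrite -raddfD.
Qed.

Lemma det_corner_lower n a c (D : 'M[R]_n) :
  \det (corner_mx a 0 c D) = (a * \det D)%R.
Proof. by apply: etrans (det_lblock (a%:M : 'M[R]_1) c D) _; rewrite det_scalar1. Qed.

Lemma det_corner_upper n a b (D : 'M[R]_n) :
  \det (corner_mx a b 0 D) = (a * \det D)%R.
Proof. by apply: etrans (det_ublock (a%:M : 'M[R]_1) b D) _; rewrite det_scalar1. Qed.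

Lemma mul_corner n a b c (D : 'M[R]_n) a' b' c' D' :
  (corner_mx a b c D *m corner_mx a' b' c' D' =
   corner_mx (a * a' + (b *m c') ord0 ord0) (a *: b' + b *m D')
     (a' *: c + D *m c') (c *m b' + D *m D'))%R.
Proof.
apply: etrans (mulmx_block (a%:M : 'M[R]_1) b c D a'%:M b' c' D') _.
rewrite -scalar_mxM !mul_scalar_mx !mul_mx_scalar /corner_mx.
by rewrite [(b *m c')%R]mx11_scalar !mxE -raddfD.
Qed.

Lemma corner_mx00 n a b c (D : 'M[R]_n) : corner_mx a b c D ord0 ord0 = a.
Proof.
have -> : (ord0 : 'I_n.+1) = lshift n (ord0 : 'I_1) by exact/val_inj.
apply: etrans (block_mxEul (a%:M : 'M[R]_1) b c D _ _) _.
by rewrite mxE eqxx.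
Qed.

(** For fixed x the matrix only shifts the first coordinate, by x w; Tonelli and translation
    invariance on the line conclude. *)
Lemma dilates_lower n (w : 'cV[R]_n) : dilates (corner_mx 1 0 w 1%:M).
Proof.
move=> f mf f0; rewrite det_corner_lower det1 mulr1 normr1 mul1e.
have mP := measurable_fun_comp_mulmx (corner_mx 1 0 w 1%:M) mf.
rewrite (integral_cons mP (fun=> f0 _)) (integral_cons mf f0).
rewrite (fubini_cons mP (fun=> f0 _)) (fubini_cons mf f0).
apply: eq_integral => x _.
rewrite -(integral_affine1T ((x *m w)%R ord0 ord0)
  (measurable_fun_comp_cons2 x mf) (fun=> f0 _)).
apply: eq_integral => t _; congr f.
by rewrite rV_cons_corner mulr1 scaler0 add0r mulmx1.
Qed.

Lemma measurable_integral_cons n (f : 'rV[R]_n.+1 -> \bar R) :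
  measurable_fun setT f -> (forall x, 0 <= f x) ->
  measurable_fun setT
    (fun t : measurableTypeR R => \int[lam n]_x f (rV_cons t x)).
Proof.
move=> mf f0; apply: (@measurable_fun_fubini_tonelli_F _ _ _ _ _ (lam n)
  (fun p : measurableTypeR R * 'rV[R]_n => f (rV_cons p.1 p.2))) => [|p].
  by apply: measurableT_comp => //; exact: measurable_rV_cons.
exact: f0.
Qed.

(** The point (t, x) goes to (d t, t v + x): a translation of x for fixed t, and a scaling of t. *)
Lemma dilates_upper n (d : R) (v : 'rV[R]_n) : d != 0%R ->
  dilates (corner_mx d v 0 1%:M).
Proof.
move=> d0 f mf f0; rewrite det_corner_upper det1 mulr1.
have mP := measurable_fun_comp_mulmx (corner_mx d v 0 1%:M) mf.
rewrite (integral_cons mP (fun=> f0 _)) (integral_cons mf f0).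
rewrite -(integral_affine1 0 d0 (measurable_integral_cons mf f0)); last first.
  by move=> t; exact: integral_ge0.
congr (_ * _); apply: eq_integral => t _.
rewrite -(integral_translate (t *: v)%R (measurable_fun_comp_cons _ mf) (fun=> f0 _)).
apply: eq_integral => x _; congr f.
by rewrite rV_cons_corner mulmx0 mxE mulmx1 /affine1 mulrC addrC [(x + _)%R]addrC.
Qed.

Lemma dilates_diag n (S : 'M[R]_n) : dilates S -> dilates (corner_mx 1 0 0 S).
Proof.
move=> hS f mf f0; rewrite det_corner_upper mul1r.
have mP := measurable_fun_comp_mulmx (corner_mx 1 0 0 S) mf.
rewrite (integral_cons mP (fun=> f0 _)) (integral_cons mf f0).
rewrite -ge0_integralZl//; last 2 first.
- exact: (measurable_integral_cons mP).
- by move=> t _; apply: integral_ge0.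
apply: eq_integral => t _.
rewrite -(hS _ (measurable_fun_comp_cons _ mf) (fun=> f0 _)); congr (_ * _).
apply: eq_integral => x _; congr f.
by rewrite rV_cons_corner mulmx0 mxE mulr1 addr0 scaler0 add0r.
Qed.

Lemma corner_mx_sub n (P : 'M[R]_n.+1) : P =
  corner_mx (P ord0 ord0) (\row_i P ord0 (lift ord0 i))
    (\col_i P (lift ord0 i) ord0) (\matrix_(i, j) P (lift ord0 i) (lift ord0 j)).
Proof.
pose Q : 'M[R]_(1 + n) := P.
have E1 : ulsubmx Q = (P ord0 ord0)%:M.
  apply/matrixP => i j; rewrite !ord1 !mxE eqxx mulr1n.
  by congr (P _ _); exact/val_inj.
have E2 : ursubmx Q = \row_i P ord0 (lift ord0 i).
  apply/matrixP => i j; rewrite !ord1 !mxE.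
  by congr (P _ _); exact/val_inj.
have E3 : dlsubmx Q = \col_i P (lift ord0 i) ord0.
  apply/matrixP => i j; rewrite !ord1 !mxE.
  by congr (P _ _); exact/val_inj.
have E4 : drsubmx Q = \matrix_(i, j) P (lift ord0 i) (lift ord0 j).
  by apply/matrixP => i j; rewrite !mxE; congr (P _ _); exact/val_inj.
by have := submxK Q; rewrite E1 E2 E3 E4 => h; exact: (esym h).
Qed.

(** A nonzero corner permits one step of Gaussian elimination: P is a lower shear, times the Schur
    complement S acting on the last n coordinates, times a factor that carries the first row of
    P. *)
Lemma dilates_corner n (P : 'M[R]_(n.+1)) :
  (forall S : 'M[R]_n, \det S != 0%R -> dilates S) ->
  \det P != 0%R -> P ord0 ord0 != 0%R -> dilates P.
Proof.
move=> IH detP; rewrite [P in dilates P]corner_mx_sub.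
move: (corner_mx_sub P); set a := P _ _; set b := (\row__ _)%R.
set c := (\col__ _)%R; set D := (\matrix_(_, _) _)%R => PE a0.
pose S := (D - a^-1 *: (c *m b))%R.
have SE : corner_mx a b c D = (corner_mx 1 0 (a^-1 *: c) 1%:M
    *m (corner_mx 1 0 0 S *m corner_mx a b 0 1%:M))%R.
  rewrite !mul_corner !(mul0mx, mul1mx, mulmx0, mulmx1, scaler0, addr0, add0r).
  rewrite !mxE !(mulr1, mul1r, addr0) !scale1r scalerA mulfV// scale1r; congr corner_mx.
  by rewrite -scalemxAl addrC subrK.
have detS : \det S != 0%R.
  apply: contra detP => /eqP detS.
  by rewrite PE SE !det_mulmx !det_corner_upper detS !(mulr0, mul0r).
rewrite SE; apply: dilates_mul; first exact: dilates_lower.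
apply: dilates_mul; first exact/dilates_diag/IH.
exact: dilates_upper.
Qed.

Lemma dilatesP n (P : 'M[R]_n) : \det P != 0%R -> dilates P.
Proof.
elim: n P => [|n IH] P detP.
  move=> f mf f0; rewrite [P]flatmx0 det_mx00 normr1 mul1e.
  by apply: eq_integral => x _; congr f; apply/rowP => -[].
have [a0|a0] := eqVneq (P ord0 ord0) 0%R; last exact: dilates_corner.
(* The corner is zero, but the first column is not. Adding a row with a nonzero first entry to the
   first row, by [T 1], produces a nonzero corner, and [T (-1)] undoes this. *)
have [i ci] : exists i : 'I_n, P (lift ord0 i) ord0 != 0%R.
  apply/existsP; apply: contraR detP; rewrite negb_exists => /forallP h.
  rewrite (expand_det_col _ ord0) big1// => i _.
  case: (unliftP ord0 i) => [k|] ->; last by rewrite a0 mul0r.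
  by have := h k; rewrite negbK => /eqP ->; rewrite mul0r.
pose T (s : R) := corner_mx 1 (s *: delta_mx ord0 i) 0 (1%:M : 'M[R]_n).
have TT : (T (-1) *m T 1 = corner_mx 1 0 0 1%:M)%R.
  rewrite /T mul_corner !(mul0mx, mul1mx, mulmx0, mulmx1, scaler0, addr0, add0r).
  by rewrite !mxE mulr1 addr0 !scale1r scaleN1r subrr.
have -> : P = (T (-1) *m (T 1 *m P))%R.
  rewrite mulmxA TT [P]corner_mx_sub mul_corner.
  rewrite !(mul0mx, mul1mx, mulmx0, mulmx1, scaler0, addr0, add0r).
  by rewrite !mxE mul1r addr0 !scale1r.
apply: dilates_mul.
  by apply: dilates_upper; rewrite oner_eq0.
apply: dilates_corner => //.
  by rewrite det_mulmx /T det_corner_upper det1 !mul1r.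
rewrite [P]corner_mx_sub /T mul_corner a0 mulr0 add0r corner_mx00.
by rewrite scale1r -rowE !mxE.
Qed.

End change_of_variables.

(** * Integration over matrices *)

Section matrix_integrals.
Context {R : realType}.
Local Open Scope ereal_scope.
Local Notation lam n := (@lebesgue_rV R n).
Local Notation mu := (@lebesgue_measure R).

Lemma emeasurable_prod d (T : measurableType d) (I : Type) (s : seq I)
    (h : I -> T -> \bar R) :
  (forall i, measurable_fun setT (h i)) ->
  measurable_fun setT (fun x => \prod_(i <- s) h i x).
Proof.
move=> mh; elim: s => [|i s IH].
  by under eq_fun do rewrite big_nil; exact: measurable_cst.
under eq_fun do rewrite big_cons.
exact: emeasurable_funM.
Qed.

Definition mx_cons m n (y : 'rV[R]_n) (Y : 'M[R]_(m, n)) : 'M[R]_(m.+1, n) :=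
  \matrix_(i, j) oapp (fun k => Y k j) (y ord0 j) (unlift ord0 i).

Lemma mx_cons0 m n y (Y : 'M[R]_(m, n)) : row ord0 (mx_cons y Y) = y.
Proof. by apply/rowP => j; rewrite !mxE unlift_none. Qed.

Lemma mx_consS m n y (Y : 'M[R]_(m, n)) i :
  row (lift ord0 i) (mx_cons y Y) = row i Y.
Proof. by apply/rowP => j; rewrite !mxE liftK. Qed.

Lemma mx_cons_mul m n p y (Y : 'M[R]_(m, n)) (P : 'M[R]_(n, p)) :
  (mx_cons y Y *m P = mx_cons (y *m P) (Y *m P))%R.
Proof.
apply/row_matrixP => i; rewrite row_mul.
by case: (unliftP ord0 i) => [k|] ->; rewrite ?mx_consS ?mx_cons0 ?row_mul.
Qed.

Lemma row_tr_mx_cons m n y (Y : 'M[R]_(m, n)) i :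
  row i (mx_cons y Y)^T%R = rV_cons (y ord0 i) (row i Y^T%R).
Proof.
apply/rowP => j; rewrite [LHS]mxE [LHS]mxE [LHS]mxE.
case: (unliftP ord0 j) => [k|] ->; first by rewrite rV_consS !mxE.
by rewrite rV_cons0.
Qed.

(* The first [n] coordinates of a vector of R^(m n) form the first row. *)
Fixpoint mx_of_rV m n : 'rV[R]_(m * n) -> 'M[R]_(m, n) :=
  if m is m'.+1 then fun v =>
    mx_cons (lsubmx (v : 'rV[R]_(n + m' * n))) (mx_of_rV (rsubmx (v : 'rV[R]_(n + m' * n))))
  else fun=> 0%R.

Fixpoint rV_of_mx m n : 'M[R]_(m, n) -> 'rV[R]_(m * n) :=
  if m is m'.+1 then fun Y =>
    row_mx (row ord0 Y) (rV_of_mx (\matrix_(i < m') row (lift ord0 i) Y)%R)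
  else fun=> 0%R.

Lemma rV_of_mxK m n : cancel (@rV_of_mx m n) (@mx_of_rV m n).
Proof.
elim: m => [|m IH] Y /=; first by rewrite [RHS]flatmx0.
rewrite row_mxKl row_mxKr IH; apply/row_matrixP => i.
case: (unliftP ord0 i) => [k|] ->; rewrite ?mx_consS ?mx_cons0//.
by apply/rowP => j; rewrite !mxE.
Qed.

(** Only row vectors carry a sigma-algebra. Maps into matrices are therefore tested entrywise, and
    functions of a matrix ([measurable_fun_mx]) through its encoding as a vector. *)
Definition measurable_mx d (T : measurableType d) m n (h : T -> 'M[R]_(m, n)) :=
  forall i j, measurable_fun setT (fun t => h t i j).

Lemma measurable_rV_of_mx d (T : measurableType d) m n (h : T -> 'M[R]_(m, n)) :
  measurable_mx h -> measurable_fun setT (fun t => rV_of_mx (h t)).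
Proof.
elim: m h => [|m IH] h mh /=; first exact: measurable_cst.
apply: (@measurable_row_mx R _ _ n (m * n)).
  by apply/measurable_fun_rVP => j; under eq_fun do rewrite mxE; exact: mh.
apply: IH => i j; under eq_fun do rewrite !mxE; exact: mh.
Qed.

Lemma measurable_mx_cons d (T : measurableType d) m n (y : T -> 'rV[R]_n)
    (Y : T -> 'M[R]_(m, n)) :
  measurable_fun setT y -> measurable_mx Y ->
  measurable_mx (fun t => mx_cons (y t) (Y t)).
Proof.
move=> my mY i j; case: (unliftP ord0 i) => [k|] ->.
  by under eq_fun do rewrite mxE liftK /=; exact: mY.
under eq_fun do rewrite mxE unlift_none /=.
exact: (measurableT_comp (measurable_coord j)).
Qed.

Lemma measurable_mx_of_rV m n : measurable_mx (@mx_of_rV m n).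
Proof.
elim: m => [[]//|m IH].
apply: (@measurable_mx_cons _ _ m n
  (fun v : 'rV[R]_(n + m * n) => lsubmx v) (fun v => mx_of_rV (rsubmx v))).
  apply/measurable_fun_rVP => i; under eq_fun do rewrite mxE.
  exact: measurable_coord.
move=> i j.
have mr : measurable_fun setT (fun v : 'rV[R]_(n + m * n) => rsubmx v).
  apply/measurable_fun_rVP => k; under eq_fun do rewrite mxE.
  exact: measurable_coord.
exact: (measurableT_comp (IH i j) mr).
Qed.

Lemma measurable_mx_row d (T : measurableType d) m n (h : T -> 'M[R]_(m, n)) i :
  measurable_mx h -> measurable_fun setT (fun t => row i (h t)).
Proof.
move=> mh; apply/measurable_fun_rVP => j; under eq_fun do rewrite mxE.
exact: mh.
Qed.

Lemma measurable_mx_tr d (T : measurableType d) m n (h : T -> 'M[R]_(m, n)) :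
  measurable_mx h -> measurable_mx (fun t => (h t)^T%R).
Proof. by move=> mh i j; under eq_fun do rewrite mxE; exact: mh. Qed.

Lemma measurable_mx_mul d (T : measurableType d) m n p
    (f : T -> 'M[R]_(m, n)) (g : T -> 'M[R]_(n, p)) :
  measurable_mx f -> measurable_mx g -> measurable_mx (fun t => f t *m g t)%R.
Proof.
move=> mf mg i j; under eq_fun do rewrite mxE.
by apply: measurable_sum => k; apply: measurable_funM; [exact: mf|exact: mg].
Qed.

Lemma measurable_mx_det d (T : measurableType d) n (h : T -> 'M[R]_n) :
  measurable_mx h -> measurable_fun setT (fun t => \det (h t)).
Proof.
move=> mh; apply: measurable_sum => s; apply: measurable_funM => //.
by apply: measurable_prod => i _; exact: mh.
Qed.

Lemma measurable_mx_cst d (T : measurableType d) m n (A : 'M[R]_(m, n)) :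
  measurable_mx (fun _ : T => A).
Proof. by move=> i j; exact: measurable_cst. Qed.

Lemma measurable_mx_rV d (T : measurableType d) n (h : T -> 'rV[R]_n) :
  measurable_fun setT h -> measurable_mx h.
Proof.
move=> /measurable_fun_rVP mh i j; rewrite (ord1 i); exact: mh.
Qed.

Definition measurable_fun_mx m n (F : 'M[R]_(m, n) -> \bar R) :=
  measurable_fun setT (fun v => F (mx_of_rV v)).

Lemma measurable_fun_mx_comp d (T : measurableType d) m n
    (F : 'M[R]_(m, n) -> \bar R) (h : T -> 'M[R]_(m, n)) :
  measurable_fun_mx F -> measurable_mx h -> measurable_fun setT (fun t => F (h t)).
Proof.
move=> mF mh; rewrite (_ : (fun t => _) =
    (fun v => F (mx_of_rV v)) \o (fun t => rV_of_mx (h t))); last first.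
  by apply/funext => t /=; rewrite rV_of_mxK.
by apply: measurableT_comp => //; exact: measurable_rV_of_mx.
Qed.

Lemma measurable_fun_mxT m n m' n' (F : 'M[R]_(m, n) -> \bar R)
    (H : 'M[R]_(m', n') -> 'M[R]_(m, n)) :
  measurable_fun_mx F -> measurable_mx (fun v => H (mx_of_rV v)) ->
  measurable_fun_mx (fun Y => F (H Y)).
Proof. exact: measurable_fun_mx_comp. Qed.

Definition integral_mx m n (F : 'M[R]_(m, n) -> \bar R) : \bar R :=
  \int[lam (m * n)]_v F (mx_of_rV v).

Lemma eq_integral_mx m n (F G : 'M[R]_(m, n) -> \bar R) :
  F =1 G -> integral_mx F = integral_mx G.
Proof. by move=> FG; apply: eq_integral => v _; exact: FG. Qed.

Lemma integral_mx_ge0 m n (F : 'M[R]_(m, n) -> \bar R) :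
  (forall Y, 0 <= F Y) -> 0 <= integral_mx F.
Proof. by move=> F0; apply: integral_ge0 => v _; exact: F0. Qed.

Lemma le_integral_mx m n (F G : 'M[R]_(m, n) -> \bar R) :
  measurable_fun_mx F -> measurable_fun_mx G -> (forall Y, 0 <= F Y) ->
  (forall Y, F Y <= G Y) -> integral_mx F <= integral_mx G.
Proof.
by move=> mF mG F0 FG; exact: ge0_le_integral.
Qed.

Lemma integral_mx0 n (F : 'M[R]_(0, n) -> \bar R) :
  measurable_fun_mx F -> integral_mx F = F 0%R.
Proof. by move=> mF; rewrite /integral_mx integral_rV0. Qed.

Lemma integral_mx_cons m n (F : 'M[R]_(m.+1, n) -> \bar R) :
  measurable_fun_mx F -> (forall Y, 0 <= F Y) ->
  integral_mx F = \int[lam n]_y integral_mx (fun Y => F (mx_cons y Y)).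
Proof.
move=> mF F0.
apply: etrans (integral_row_mx (m := n) (n := m * n) mF (fun=> F0 _)) _.
apply: eq_integral => y _; apply: eq_integral => w _.
by rewrite /= row_mxKl row_mxKr.
Qed.

Lemma measurable_integral_mx d (T : measurableType d) m n
    (F : T -> 'M[R]_(m, n) -> \bar R) :
  measurable_fun setT (fun p : T * 'rV[R]_(m * n) => F p.1 (mx_of_rV p.2)) ->
  (forall t Y, 0 <= F t Y) ->
  measurable_fun setT (fun t => integral_mx (F t)).
Proof.
move=> mF F0; apply: (@measurable_fun_fubini_tonelli_F _ _ _ _ _ (lam (m * n))
  (fun p : T * 'rV[R]_(m * n) => F p.1 (mx_of_rV p.2))).
- exact: mF.
- by move=> p; exact: F0.
Qed.

Lemma measurable_fun_mx_cons m n (F : 'M[R]_(m.+1, n) -> \bar R) y :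
  measurable_fun_mx F -> measurable_fun_mx (fun Y => F (mx_cons y Y)).
Proof.
move=> mF; apply: (measurable_fun_mxT mF).
by apply: measurable_mx_cons; [exact: measurable_cst|exact: measurable_mx_of_rV].
Qed.

Lemma prod_integral1 s (psi : 'I_s -> measurableTypeR R -> \bar R) :
  (forall i, measurable_fun setT (psi i)) -> (forall i t, 0 <= psi i t) ->
  \prod_(i < s) \int[mu]_t psi i t = \int[lam s]_x \prod_(i < s) psi i (x ord0 i).
Proof.
elim: s psi => [|s IH] psi mpsi psi0.
  rewrite big_ord0 integral_rV0 ?big_ord0//.
  by under eq_fun do rewrite big_ord0; exact: measurable_cst.
have mp k (phi : 'I_k -> measurableTypeR R -> \bar R) :
    (forall i, measurable_fun setT (phi i)) ->
    measurable_fun setT (fun x : 'rV[R]_k => \prod_(i < k) phi i (x ord0 i)).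
  move=> mphi; apply: emeasurable_prod => i.
  exact: (measurableT_comp (mphi i) (measurable_coord i)).
rewrite (integral_cons (mp _ _ mpsi)); last first.
  by move=> x; apply: prode_ge0 => i _; exact: psi0.
rewrite big_ord_recl (IH (fun i => psi (lift ord0 i)))//.
rewrite -ge0_integralZr//; last first.
  by apply: integral_ge0 => x _; apply: prode_ge0 => i _; exact: psi0.
apply: eq_integral => t _; rewrite -ge0_integralZl//; last 2 first.
- exact: (mp _ (fun i => psi (lift ord0 i))).
- by move=> x _; apply: prode_ge0 => i _; exact: psi0.
apply: eq_integral => x _; rewrite big_ord_recl rV_cons0; congr (_ * _).
by apply: eq_bigr => i _; rewrite rV_consS.
Qed.

Lemma measurable_prod_row m n (phi : 'I_m -> 'rV[R]_n -> \bar R)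
    d (T : measurableType d) (h : T -> 'M[R]_(m, n)) :
  (forall i, measurable_fun setT (phi i)) -> measurable_mx h ->
  measurable_fun setT (fun t => \prod_(i < m) phi i (row i (h t))).
Proof.
move=> mphi mh; apply: emeasurable_prod => i.
exact: (measurableT_comp (mphi i) (measurable_mx_row i mh)).
Qed.

Lemma measurable_fun_mx_prod_row m n (phi : 'I_m -> 'rV[R]_n -> \bar R) :
  (forall i, measurable_fun setT (phi i)) ->
  measurable_fun_mx (fun Y => \prod_(i < m) phi i (row i Y)).
Proof.
by move=> mphi; exact: (measurable_prod_row mphi (@measurable_mx_of_rV m n)).
Qed.

Lemma measurable_fun_mx_prod_col m n (phi : 'I_n -> 'rV[R]_m -> \bar R) :
  (forall i, measurable_fun setT (phi i)) ->
  measurable_fun_mx (fun Y : 'M[R]_(m, n) => \prod_(i < n) phi i (row i Y^T%R)).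
Proof.
move=> mphi.
exact: (measurable_prod_row mphi (measurable_mx_tr (@measurable_mx_of_rV m n))).
Qed.

Lemma prod_integral_row m n (phi : 'I_m -> 'rV[R]_n -> \bar R) :
  (forall i, measurable_fun setT (phi i)) -> (forall i x, 0 <= phi i x) ->
  \prod_(i < m) \int[lam n]_x phi i x =
  integral_mx (fun Y => \prod_(i < m) phi i (row i Y)).
Proof.
elim: m phi => [|m IH] phi mphi phi0.
  rewrite big_ord0 integral_mx0 ?big_ord0//.
  exact: (measurable_fun_mx_prod_row mphi).
rewrite integral_mx_cons; last 2 first.
- exact: (measurable_fun_mx_prod_row mphi).
- by move=> Y; exact: prode_ge0.
rewrite big_ord_recl (IH (fun i => phi (lift ord0 i)))//.
rewrite -ge0_integralZr//; last by apply: integral_mx_ge0 => Y; exact: prode_ge0.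
apply: eq_integral => y _; rewrite -ge0_integralZl//; last 2 first.
- exact: (measurable_fun_mx_prod_row (fun i => mphi (lift ord0 i))).
- by move=> x _; exact: prode_ge0.
apply: eq_integral => x _; rewrite big_ord_recl mx_cons0; congr (_ * _).
by apply: eq_bigr => i _; rewrite mx_consS.
Qed.

(** The points are the columns of U, whereas matrices are integrated row by row. A row of U holds
    one coordinate of all s points, which is the situation of [prod_integral1]. *)
Lemma prod_integral_col k s (phi : 'I_s -> 'rV[R]_k -> \bar R) :
  (forall i, measurable_fun setT (phi i)) -> (forall i x, 0 <= phi i x) ->
  \prod_(i < s) \int[lam k]_x phi i x =
  integral_mx (fun U : 'M[R]_(k, s) => \prod_(i < s) phi i (row i U^T%R)).
Proof.
elim: k phi => [|k IH] phi mphi phi0.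
  rewrite integral_mx0; last first.
    exact: (measurable_fun_mx_prod_col mphi).
  apply: eq_bigr => i _; rewrite integral_rV0//.
  by congr phi; apply/rowP => -[].
have mc i : measurable_fun setT
    (fun t : measurableTypeR R => \int[lam k]_x phi i (rV_cons t x)).
  exact: measurable_integral_cons.
transitivity (\prod_(i < s) \int[mu]_t \int[lam k]_x phi i (rV_cons t x)).
  by apply: eq_bigr => i _; rewrite integral_cons.
rewrite prod_integral1//; last by move=> i t; exact: integral_ge0.
rewrite integral_mx_cons; last 2 first.
- exact: (measurable_fun_mx_prod_col mphi).
- by move=> Y; exact: prode_ge0.
apply: eq_integral => y _.
rewrite (IH (fun i x => phi i (rV_cons (y ord0 i) x)))//; last first.
  by move=> i; exact: measurable_fun_comp_cons.
by apply: eq_integral_mx => U; apply: eq_bigr => i _; rewrite row_tr_mx_cons.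
Qed.

(** P acts on each of the m rows separately, so [dilatesP] is used once per row. *)
Lemma integral_mx_mulr m n (P : 'M[R]_n) (F : 'M[R]_(m, n) -> \bar R) :
  \det P != 0%R -> measurable_fun_mx F -> (forall Y, 0 <= F Y) ->
  (`|\det P| ^+ m)%:E * integral_mx (fun Y => F (Y *m P)%R) = integral_mx F.
Proof.
move=> detP; elim: m F => [|m IH] F mF F0.
  rewrite expr0 mul1e !integral_mx0// ?mul0mx//.
  apply: (measurable_fun_mxT mF); apply: measurable_mx_mul.
    exact: measurable_mx_of_rV.
  exact: measurable_mx_cst.
have mFP : measurable_fun_mx (fun Y => F (Y *m P)%R).
  apply: (measurable_fun_mxT mF); apply: measurable_mx_mul.
    exact: measurable_mx_of_rV.
  exact: measurable_mx_cst.
have mI : measurable_fun setT (fun y => integral_mx (fun Y => F (mx_cons y Y))).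
  apply: measurable_integral_mx => //; apply: (measurable_fun_mx_comp mF).
  apply: measurable_mx_cons => // i j.
  exact: (measurableT_comp (measurable_mx_of_rV i j)).
rewrite !integral_mx_cons// exprS EFinM -muleA.
rewrite -(dilatesP detP mI); last by move=> y; exact: integral_mx_ge0.
congr (_ * _); rewrite -ge0_integralZl//; last 2 first.
- apply: measurable_integral_mx => //; apply: (measurable_fun_mx_comp mF).
  apply: measurable_mx_mul; last exact: measurable_mx_cst.
  apply: measurable_mx_cons => // i j.
  exact: (measurableT_comp (measurable_mx_of_rV i j)).
- by move=> y _; exact: integral_mx_ge0.
apply: eq_integral => y _.
rewrite -(IH (fun Y => F (mx_cons (y *m P)%R Y)))//; last exact: measurable_fun_mx_cons.
by congr (_ * _); apply: eq_integral_mx => Y; rewrite mx_cons_mul.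
Qed.

End matrix_integrals.

(** * Singular matrices form a null set *)

Section singular_matrices.
Context {R : realType}.
Local Open Scope ereal_scope.
Local Notation lam n := (@lebesgue_rV R n).
Local Notation mu := (@lebesgue_measure R).

Lemma finite_set_root (p : {poly R}) : p != 0%R -> finite_set [set t | root p t].
Proof.
have [m] := ubnP (size p); elim: m p => // m IH p; rewrite ltnS => pm p0.
have [[a pa]|np] := pselect (exists a, root p a); last first.
  rewrite (_ : [set _ | _] = set0) //; apply/seteqP; split => // t /= pt.
  by apply: np; exists t.
have [q pE] := factor_theorem p a pa.
have q0 : q != 0%R by apply: contra p0 => /eqP q0; rewrite pE q0 mul0r.
apply: (@sub_finite_set _ _ ([set t | root q t] `|` [set a])).
  move=> t /=; rewrite pE rootM root_XsubC => /orP[qt|/eqP ->]; by [left|right].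
rewrite finite_setU; split => //; apply: IH => //.
by apply: leq_trans pm; rewrite pE size_Mmonic ?monicXsubC// size_XsubC addn2 ltnS.
Qed.

Lemma mx_of_rVD m n (v w : 'rV[R]_(m * n)) :
  mx_of_rV (v + w)%R = (mx_of_rV v + mx_of_rV w)%R.
Proof.
elim: m v w => [|m IH] v w /=; first by rewrite addr0.
have -> : rsubmx (v + w : 'rV[R]_(n + m * n))%R = (rsubmx (v : 'rV[R]_(n + m * n)) + rsubmx (w : 'rV[R]_(n + m * n)))%R.
  by apply/rowP => i; rewrite !mxE.
rewrite IH; apply/row_matrixP => i; rewrite [RHS]raddfD /=.
case: (unliftP ord0 i) => [k|] ->; rewrite !(mx_consS, mx_cons0).
  by rewrite raddfD.
by apply/rowP => j; rewrite !mxE.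
Qed.

Lemma integral_mx_translate m n (W : 'M[R]_(m, n)) (F : 'M[R]_(m, n) -> \bar R) :
  measurable_fun_mx F -> (forall Y, 0 <= F Y) ->
  integral_mx (fun Y => F (Y + W)%R) = integral_mx F.
Proof.
move=> mF F0; rewrite -[RHS](integral_translate (rV_of_mx W) mF (fun=> F0 _)).
by apply: eq_integral => v _; rewrite mx_of_rVD rV_of_mxK.
Qed.

Lemma measurable_eq0_det d (T : measurableType d) n (h : T -> 'M[R]_n) :
  measurable_mx h -> measurable_fun setT (fun t => \det (h t) == 0%R).
Proof.
by move=> mh; apply: measurable_fun_eqr => //; exact: measurable_mx_det.
Qed.

(* The translates of the singular matrices by the multiples of the identity
   cover each matrix only finitely often. *)
Lemma integral_mx_singular n : (0 < n)%N ->
  integral_mx (fun Y : 'M[R]_n => (if \det Y == 0%R then 1 else 0)) = 0 :> \bar R.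
Proof.
move=> n0; set e := (fun Y : 'M[R]_n => (if \det Y == 0%R then 1 else 0) : \bar R).
have e0 Y : 0 <= e Y by rewrite /e; case: ifP.
have me : measurable_fun_mx e.
  apply: measurable_fun_ifT => //.
  exact: (measurable_eq0_det (@measurable_mx_of_rV R n n)).
have mt : measurable_fun setT (fun p : measurableTypeR R * 'rV[R]_(n * n) =>
    e (mx_of_rV p.2 + p.1%:M)%R).
  apply: (measurable_fun_mx_comp me) => i j; under eq_fun do rewrite !mxE.
  apply: measurable_funD.
    exact: (measurableT_comp (measurable_mx_of_rV i j)).
  case: (i == j); last by under eq_fun do rewrite mulr0n; exact: measurable_cst.
  by under eq_fun do rewrite mulr1n; exact: measurable_fst.
have := @fubini_tonelli _ _ _ _ _ mu (lam (n * n)) _ mt (fun=> e0 _).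
under eq_integral => t _ /=.
  rewrite -/(integral_mx (fun Y => e (Y + t%:M)%R)) integral_mx_translate//.
  over.
under [in RHS]eq_integral => v _.
  have -> : \int[mu]_t e (mx_of_rV v + t%:M)%R = 0.
    pose A := [set t | root (char_poly (- mx_of_rV v)%R) t].
    have A0 : mu A = 0.
      apply/countable_lebesgue_measure0/finite_set_countable/finite_set_root.
      exact/monic_neq0/char_poly_monic.
    have mA : measurable A.
      by apply: countable_measurable => //; apply: finite_set_countable;
         apply: finite_set_root; exact/monic_neq0/char_poly_monic.
    rewrite -[RHS]A0 -[A]setIT -integral_indic//; apply: eq_integral => t _.
    rewrite /e indicE (_ : (t \in A) = (\det (mx_of_rV v + t%:M)%R == 0%R)).
      by case: ifP.
    apply/esym; rewrite (_ : (t \in A) = eigenvalue (- mx_of_rV v)%R t); last first.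
      by rewrite eigenvalue_root_char; apply/idP/idP; rewrite inE.
    apply/idP/eigenvalueP => [/det0P[u u0 uE]|[u uE u0]].
      exists u => //; move/eqP: uE.
      by rewrite mulmxDr mul_mx_scalar mulmxN addr_eq0 -eqr_oppLR => /eqP.
    apply/det0P; exists u => //.
    by rewrite mulmxDr mul_mx_scalar -uE mulmxN subrr.
  over.
(* By translation invariance one side is the wanted integral times the length of the line, which is
   infinite; the other side is 0. *)
rewrite integral0 integral_cst// => /eqP.
rewrite mule_eq0 => /orP[/eqP//|].
have muT : mu setT = +oo.
  by have := lebesgue_measure_itv (`]-oo, +oo[ : interval R); rewrite set_itvE.
by move=> /eqP h; have := etrans (esym muT) h.
Qed.

Lemma integral_mx_nonsingular n (F G : 'M[R]_n -> \bar R) : (0 < n)%N ->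
  measurable_fun_mx F -> measurable_fun_mx G ->
  (forall Y, 0 <= F Y) -> (forall Y, 0 <= G Y) ->
  (forall Y, \det Y != 0%R -> F Y = G Y) ->
  integral_mx F = integral_mx G.
Proof.
move=> n0 mF mG F0 G0 FG; apply: ge0_ae_eq_integral => //.
have := integral_mx_singular n0.
pose h := fun v : 'rV[R]_(n * n) => if \det (mx_of_rV v) == 0%R then 1 else 0 : \bar R.
have mh : measurable_fun setT h.
  apply: measurable_fun_ifT => //.
  exact: (measurable_eq0_det (@measurable_mx_of_rV R n n)).
rewrite /integral_mx -/h => h0.
have : \int[lam (n * n)]_x `|h x| = 0.
  by rewrite -[RHS]h0; apply: eq_integral => v _; rewrite gee0_abs// /h; case: ifP.
move=> /(ae_eq_integral_abs _ measurableT mh); apply: filterS => v /= /(_ I).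
rewrite /h => hv _; apply: FG; apply: contra_eqN hv => ->.
by rewrite eqe oner_eq0.
Qed.

End singular_matrices.

(** * The Blaschke-Petkantschin formula in the chart of graphs *)

Section graph_formula.
Context {R : realType}.
Local Open Scope ereal_scope.
Local Notation lam n := (@lebesgue_rV R n).
Local Notation mu := (@lebesgue_measure R).

(* The rows of [graph_mx B] span the graph of y |-> y B^T over R^s. *)
Definition graph_mx s k (B : 'M[R]_(k, s)) : 'M[R]_(s, s + k) :=
  row_mx 1%:M B^T.

Lemma measurable_graph_mx d (T : measurableType d) s k (B : T -> 'M[R]_(k, s)) :
  measurable_mx B -> measurable_mx (fun t => graph_mx (B t)).
Proof.
move=> mB i j; case: (split_ordP j) => l ->.
  by under eq_fun do rewrite row_mxEl; exact: measurable_cst.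
by under eq_fun do rewrite row_mxEr mxE; exact: mB.
Qed.

Section kernel.
Variables (s k : nat) (phi : 'rV[R]_(s + k) -> \bar R).
Hypotheses (mphi : measurable_fun setT phi) (phi0 : forall x, 0 <= phi x).

(** The rows of [Y *m graph_mx B] are the points (y_i, y_i B^T), and |det Y|^k is the Jacobian of
    the map from B to B Y^T. *)
Definition graph_kernel (Y : 'M[R]_s) (B : 'M[R]_(k, s)) : \bar R :=
  \prod_(i < s) phi (row i (Y *m graph_mx B)%R) * (`|\det Y| ^+ k)%:E.

Lemma graph_kernel_ge0 Y B : 0 <= graph_kernel Y B.
Proof. by apply: mule_ge0; [exact: prode_ge0|rewrite lee_fin exprn_ge0]. Qed.

Lemma measurable_graph_kernel d (T : measurableType d) (Y : T -> 'M[R]_s)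
    (B : T -> 'M[R]_(k, s)) : measurable_mx Y -> measurable_mx B ->
  measurable_fun setT (fun t => graph_kernel (Y t) (B t)).
Proof.
move=> mY mB; apply: emeasurable_funM.
  apply: (measurable_prod_row (fun=> mphi)).
  exact/measurable_mx_mul/measurable_graph_mx.
apply/measurable_EFinP; apply: measurable_funX.
by apply: measurableT_comp => //; exact: measurable_mx_det.
Qed.

Lemma measurable_mx_fst d (T : measurableType d) m n :
  measurable_mx (fun p : 'rV[R]_(m * n) * T => mx_of_rV p.1).
Proof. by move=> i j; exact: (measurableT_comp (measurable_mx_of_rV i j)). Qed.

Lemma measurable_mx_snd d (T : measurableType d) m n :
  measurable_mx (fun p : T * 'rV[R]_(m * n) => mx_of_rV p.2).
Proof. by move=> i j; exact: (measurableT_comp (measurable_mx_of_rV i j)). Qed.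

(* For a fixed invertible Y the last k coordinates of the points are written
   as the rows of Y B^T, which is a change of variables in each column. *)
Lemma prod_integral_graph : (0 < s)%N -> (0 < k)%N ->
  \prod_(i < s) \int[lam (s + k)]_x phi x =
  integral_mx (fun B => integral_mx (fun Y => graph_kernel Y B)).
Proof.
move=> s0 k0.
pose psi (y : 'rV[R]_s) := \int[lam k]_z phi (row_mx y z).
have mphi2 : measurable_fun setT
    (fun p : 'rV[R]_s * 'rV[R]_k => phi (row_mx p.1 p.2)).
  by apply: measurableT_comp => //; exact: measurable_row_mx.
have mpsi : measurable_fun setT psi.
  apply: (@measurable_fun_fubini_tonelli_F _ _ _ _ _ (lam k)
    (fun p : 'rV[R]_s * 'rV[R]_k => phi (row_mx p.1 p.2))) => // p; exact: phi0.
have psi0 y : 0 <= psi y by exact: integral_ge0.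
under eq_bigr do rewrite integral_row_mx// -/(psi _).
rewrite (prod_integral_row (fun=> mpsi) (fun=> psi0)).
(* With Y outside, the singular Y can be discarded as a null set before any inverse is used. *)
transitivity (integral_mx (fun Y => integral_mx (graph_kernel Y))); last first.
  apply: (@fubini_tonelli _ _ _ _ _ (lam (s * s)) (lam (k * s))
    (fun p => graph_kernel (mx_of_rV p.1) (mx_of_rV p.2))).
    by apply: measurable_graph_kernel; [exact: measurable_mx_fst|exact: measurable_mx_snd].
  by move=> p; exact: graph_kernel_ge0.
apply: integral_mx_nonsingular => //.
- exact: (measurable_fun_mx_prod_row (fun=> mpsi)).
- apply: (@measurable_integral_mx _ _ _ k s (fun v => graph_kernel (mx_of_rV v))).
    by apply: measurable_graph_kernel; [exact: measurable_mx_fst|exact: measurable_mx_snd].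
  by move=> v; exact: graph_kernel_ge0.
- by move=> Y; exact: prode_ge0.
- by move=> Y; apply: integral_mx_ge0; exact: graph_kernel_ge0.
move=> Y detY.
have mrow i : measurable_fun setT (fun z : 'rV[R]_k => phi (row_mx (row i Y) z)).
  apply: measurableT_comp => //; apply: measurable_row_mx => //.
rewrite (prod_integral_col mrow); last by move=> i x; exact: phi0.
have detYT : \det (Y^T)%R != 0%R by rewrite det_tr.
have mF := measurable_fun_mx_prod_col mrow.
rewrite -(integral_mx_mulr detYT mF); last by move=> U; exact: prode_ge0.
have mG : measurable_fun setT (fun v : 'rV[R]_(k * s) =>
    \prod_(i < s) phi (row i (Y *m graph_mx (mx_of_rV v))%R)).
  apply: (measurable_prod_row
    (h := fun v => (Y *m graph_mx (mx_of_rV v))%R) (fun=> mphi)).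
  apply: measurable_mx_mul; first exact: measurable_mx_cst.
  by apply: measurable_graph_mx; exact: measurable_mx_of_rV.
rewrite det_tr muleC /graph_kernel /integral_mx (ge0_integralZr _ measurableT mG); last 2 first.
- by move=> v _; exact: prode_ge0.
- by rewrite lee_fin exprn_ge0.
congr (_ * _); apply: eq_integral => v _; apply: eq_bigr => i _.
rewrite trmx_mul trmxK /graph_mx mul_mx_row mulmx1.
by congr phi; apply/rowP => j; rewrite !mxE; case: split_ordP => l _; rewrite !mxE.
Qed.

End kernel.
End graph_formula.

(** * Products of integrals of signed functions *)

Section signed_product.
Context {R : realType}.
Local Open Scope ereal_scope.
Local Notation lam n := (@lebesgue_rV R n).

Lemma integrable_prod_row m n (h : 'I_m -> 'rV[R]_n -> R) :
  (forall i, (lam n).-integrable setT (EFin \o h i)) ->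
  (lam (m * n)).-integrable setT
    (fun v => (\prod_(i < m) h i (row i (mx_of_rV v)))%R%:E).
Proof.
move=> ih.
have mh i : measurable_fun setT (fun x => (h i x)%:E : \bar R).
  by have /integrableP[] := ih i.
apply/integrableP; split.
  under eq_fun do rewrite -prodEFin.
  exact: (measurable_fun_mx_prod_row mh).
have mh' i : measurable_fun setT (fun x => `|(h i x)%:E| : \bar R).
  exact: measurableT_comp.
have := prod_integral_row mh' (fun _ _ => abse_ge0 _).
rewrite /integral_mx.
rewrite (_ : \int[_]_v \prod_(i < m) _ = \int[lam (m * n)]_v
    `|(\prod_(i < m) h i (row i (mx_of_rV v)))%R%:E|); last first.
  apply: eq_integral => v _; rewrite -prodEFin.
  by rewrite (big_morph _ (@abseM R) abse1).
move=> <-; rewrite ltey_eq prode_fin_num// => i _.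
rewrite ge0_fin_numE ?integral_ge0//.
by have /integrableP[] := ih i.
Qed.

(** Tonelli covers nonnegative factors, but the expansion of det^2 has monomials of both signs. Each
    factor is split into its positive and negative parts, and the product is expanded over the
    functions c that choose a part for every row. *)
Lemma prod_integral_row_signed m n (h : 'I_m -> 'rV[R]_n -> R) :
  (forall i, (lam n).-integrable setT (EFin \o h i)) ->
  \int[lam (m * n)]_v (\prod_(i < m) h i (row i (mx_of_rV v)))%R%:E =
  \prod_(i < m) \int[lam n]_x (h i x)%:E.
Proof.
move=> ih.
pose H i (b : bool) : 'rV[R]_n -> R := if b then (h i)^\-%R else (h i)^\+%R.
have H0 i b x : (0 <= H i b x)%R.
  by rewrite /H; case: b; [exact: funrneg_ge0|exact: funrpos_ge0].
have iH i b : (lam n).-integrable setT (EFin \o H i b).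
  by rewrite /H; case: b; [exact: integrable_funrneg|exact: integrable_funrpos].
have mH i b : measurable_fun setT (fun x => (H i b x)%:E : \bar R).
  by have /integrableP[] := iH i b.
have hE i x : h i x = (\sum_(b : bool) (-1) ^+ b * H i b x)%R.
  rewrite big_bool expr1 expr0 mulN1r mul1r /H -[in LHS](funrposBneg (h i)).
  exact: addrC.
pose P i b := fine (\int[lam n]_x (H i b x)%:E).
have PE i b : \int[lam n]_x (H i b x)%:E = (P i b)%:E.
  by rewrite fineK//; exact: (integrable_fin_num measurableT (iH i b)).
have hP i : \int[lam n]_x (h i x)%:E = (\sum_(b : bool) (-1) ^+ b * P i b)%R%:E.
  have -> : (\sum_(b : bool) (-1) ^+ b * P i b = P i false - P i true)%R.
    by rewrite big_bool expr1 expr0 mulN1r mul1r; exact: addrC.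
  rewrite EFinB -!PE.
  rewrite -integralB_EFin//; try exact: iH.
  apply: eq_integral => x _; rewrite -EFinB; congr (_%:E).
  by rewrite /H -[in LHS](funrposBneg (h i)).
under [RHS]eq_bigr do rewrite hP.
rewrite prodEFin bigA_distr_bigA/= -sumEFin.
have cE (c : {ffun 'I_m -> bool}) (v : 'rV[R]_(m * n)) :
    (\prod_(i < m) ((-1) ^+ c i * H i (c i) (row i (mx_of_rV v))) =
     (\prod_(i < m) (-1) ^+ c i) * \prod_(i < m) H i (c i) (row i (mx_of_rV v)))%R.
  by rewrite big_split.
transitivity (\int[lam (m * n)]_v \sum_(c : {ffun 'I_m -> bool})
  (\prod_(i < m) (-1) ^+ c i)%R%:E *
  (\prod_(i < m) H i (c i) (row i (mx_of_rV v)))%R%:E).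
  apply: eq_integral => v _; under eq_bigr do rewrite hE.
  by rewrite bigA_distr_bigA/= -sumEFin; apply: eq_bigr => c _; rewrite cE EFinM.
have ic (c : {ffun 'I_m -> bool}) : (lam (m * n)).-integrable setT
    (fun v => (\prod_(i < m) H i (c i) (row i (mx_of_rV v)))%R%:E).
  by apply: (integrable_prod_row (h := fun i => H i (c i))) => i; exact: iH.
rewrite integral_sum//; last by move=> c; exact: integrableZl.
apply: eq_bigr => c _; rewrite integralZl// big_split EFinM; congr (_ * _).
rewrite -prodEFin; under [RHS]eq_bigr do rewrite -PE.
rewrite (prod_integral_row (fun i => mH i (c i))) => [|i x]; last by rewrite lee_fin.
by apply: eq_integral => v _; rewrite prodEFin.
Qed.

End signed_product.

(** * Positive definite matrices and the Hadamard inequality *)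

Section positive_definite.
Context {R : realType}.

Definition sqn n (x : 'rV[R]_n) : R := (x *m x^T) ord0 ord0.

Lemma sqnE n (x : 'rV[R]_n) : sqn x = \sum_i x ord0 i ^+ 2.
Proof. by rewrite /sqn mxE; apply: eq_bigr => i _; rewrite mxE expr2. Qed.

Lemma sqn_ge0 n (x : 'rV[R]_n) : 0 <= sqn x.
Proof. by rewrite sqnE sumr_ge0// => i _; exact: sqr_ge0. Qed.

Lemma sqn_eq0 n (x : 'rV[R]_n) : (sqn x == 0) = (x == 0).
Proof.
apply/idP/eqP => [|->]; last by rewrite /sqn mul0mx mxE.
rewrite sqnE psumr_eq0 => [/allP h|i _]; last exact: sqr_ge0.
apply/rowP => i; rewrite mxE; apply/eqP; rewrite -sqrf_eq0.
by apply: h; rewrite mem_index_enum.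
Qed.

Lemma sqn_gt0 n (x : 'rV[R]_n) : (0 < sqn x) = (x != 0).
Proof. by rewrite lt_def sqn_eq0 sqn_ge0 andbT. Qed.

Definition posdef n (S : 'M[R]_n) := S^T = S /\
  forall u : 'rV[R]_n, u != 0 -> 0 < (u *m S *m u^T) ord0 ord0.

Lemma rV_cons_dot n (t u : R) (x y : 'rV[R]_n) :
  (rV_cons t x *m (rV_cons u y)^T) ord0 ord0 = t * u + (x *m y^T) ord0 ord0.
Proof.
rewrite !mxE; under eq_bigr do rewrite [X in _ * X]mxE.
rewrite big_ord_recl !rV_cons0; congr (_ + _).
by apply: eq_bigr => i _; rewrite !rV_consS [X in _ = _ * X]mxE.
Qed.

Lemma tr_corner_mx n (a : R) b c (D : 'M[R]_n) :
  (corner_mx a b c D)^T = corner_mx a c^T b^T D^T.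
Proof.
by apply: etrans (tr_block_mx (a%:M : 'M[R]_1) b c D) _; rewrite tr_scalar_mx.
Qed.

(* Cholesky factorization by Schur complements; the diagonal entries of the
   Schur complement decrease, which gives the bound on the determinant. *)
Lemma posdef_cholesky n (S : 'M[R]_n) : posdef S ->
  (exists P : 'M[R]_n, S = P *m P^T) /\ \det S <= \prod_i S i i.
Proof.
elim: n S => [|n IH] S [Ssym Spos].
  split; first by exists 0; rewrite [LHS]flatmx0 [RHS]flatmx0.
  by rewrite det_mx00 big_ord0.
pose a := S ord0 ord0; pose b : 'rV[R]_n := \row_i S ord0 (lift ord0 i).
pose D : 'M[R]_n := \matrix_(i, j) S (lift ord0 i) (lift ord0 j).
have SE : S = corner_mx a b b^T D.
  rewrite [LHS]corner_mx_sub; congr corner_mx.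
  by apply/colP => i; rewrite !mxE -{1}Ssym mxE.
have Dsym : D^T = D by apply/matrixP => i j; rewrite !mxE -{1}Ssym mxE.
have a0 : 0 < a.
  have := Spos (rV_cons 1 0); rewrite SE rV_cons_corner rV_cons_dot.
  rewrite mul0mx !mxE !mul1r big1 ?addr0 ?mulr1 => [|i _]; last by rewrite !mxE mulr0.
  apply; apply/eqP => /rowP/(_ ord0).
  by rewrite rV_cons0 mxE => /eqP; rewrite oner_eq0.
pose T : 'M[R]_n := D - a^-1 *: (b^T *m b).
have Tsym : T^T = T.
  by rewrite /T linearB/= linearZ/= trmx_mul trmxK Dsym.
have Tpos (v : 'rV[R]_n) : v != 0 -> 0 < (v *m T *m v^T) ord0 ord0.
  (* This t makes the first coordinate of (t, v) S vanish, so the form of S at (t, v) is the form of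
     the Schur complement T at v. *)
  move=> v0; set t := - a^-1 * (v *m b^T) ord0 ord0.
  have := Spos (rV_cons t v); rewrite SE rV_cons_corner rV_cons_dot.
  have -> : t * a + (v *m b^T) ord0 ord0 = 0.
    by rewrite /t mulrAC mulNr mulVf ?gt_eqF// mulN1r addNr.
  rewrite mul0r add0r; have -> : t *: b + v *m D = v *m T.
    rewrite /T mulmxBr addrC -scalemxAr mulmxA; congr (_ + _).
    by rewrite [v *m b^T]mx11_scalar mul_scalar_mx scalerA -scaleNr -mulNr.
  apply; apply: contra v0 => /eqP/rowP h; apply/eqP/rowP => i.
  by have := h (lift ord0 i); rewrite rV_consS !mxE.
have [[P TE] detT] := IH T (conj Tsym Tpos).
have sa0 : Num.sqrt a != 0 by rewrite gt_eqF// sqrtr_gt0.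
have saa : Num.sqrt a * Num.sqrt a = a by rewrite -expr2 sqr_sqrtr// ltW.
split.
  exists (corner_mx (Num.sqrt a) 0 ((Num.sqrt a)^-1 *: b^T) P).
  rewrite tr_corner_mx mul_corner SE trmx0 linearZ/= trmxK saa.
  rewrite !(mul0mx, mulmx0, addr0, add0r) mxE addr0 !scalerA mulfV// !scale1r.
  congr corner_mx; rewrite -TE /T -scalemxAl -scalemxAr scalerA -invfM saa.
  by rewrite addrC subrK.
have -> : \det S = a * \det T.
  have -> : S = corner_mx 1 0 (a^-1 *: b^T) 1%:M *m corner_mx a b 0 T.
    rewrite SE mul_corner !(mul0mx, mulmx0, mul1mx, addr0, add0r) !mxE.
    rewrite !(mul1r, addr0) !scale1r scalerA mulfV ?gt_eqF// scale1r.
    by congr corner_mx; rewrite /T -scalemxAl addrC subrK.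
  by rewrite det_mulmx det_corner_lower det_corner_upper det1 !mul1r.
rewrite big_ord_recl -/a ler_pM2l//; apply: le_trans detT _.
apply: ler_prod => i _; apply/andP; split.
  have := Tpos (delta_mx ord0 i); rewrite -rowE trmx_delta -colE => h.
  apply/ltW; have := h _; rewrite [(col _ _) _ _]mxE [(row _ _) _ _]mxE; apply; apply/eqP => /rowP/(_ i).
  by rewrite !mxE !eqxx => /eqP; rewrite oner_eq0.
rewrite /T !mxE big_ord1 !mxE lerBlDr lerDl mulr_ge0 ?invr_ge0 ?(ltW a0)//.
by rewrite -expr2 sqr_ge0.
Qed.

Lemma posdef_det_neq0 n (S P : 'M[R]_n) : posdef S -> S = P *m P^T -> \det P != 0.
Proof.
move=> [_ Spos] SE; apply/negP => /det0P[u u0 uP].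
have := Spos u u0; rewrite SE mulmxA uP !mul0mx mxE.
by rewrite ltxx.
Qed.

(** The determinant bound of [posdef_cholesky] for the Gram matrix Y Y^T, whose diagonal holds the
    squared lengths of the rows. *)
Lemma hadamard n (Y : 'M[R]_n) : (\det Y) ^+ 2 <= \prod_i sqn (row i Y).
Proof.
have [Y0|Y0] := eqVneq (\det Y) 0.
  by rewrite Y0 expr0n/= prodr_ge0// => i _; exact: sqn_ge0.
have : posdef (Y *m Y^T).
  split; first by rewrite trmx_mul trmxK.
  move=> u u0; rewrite mulmxA -mulmxA -trmx_mul -/(sqn (u *m Y)) sqn_gt0.
  apply: contra Y0 => /eqP uY; apply/det0P; by exists u.
move=> /posdef_cholesky[_]; rewrite det_mulmx det_tr -expr2 => /le_trans; apply.
rewrite le_eqVlt; apply/orP; left; apply/eqP; apply: eq_bigr => i _.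
by rewrite sqnE mxE; apply: eq_bigr => j _; rewrite !mxE expr2.
Qed.

End positive_definite.

(** * Integrals of nonnegative real functions and of Gaussians *)

Section real_integrands.
Local Open Scope ereal_scope.
Context d (T : measurableType d) (R : realType) (m : {measure set T -> \bar R}).
Implicit Types f g : T -> R.

Lemma ge0_integralZ_EFin f c : measurable_fun setT f ->
  (forall x, (0 <= f x)%R) -> (0 <= c)%R ->
  \int[m]_x (c * f x)%:E = c%:E * \int[m]_x (f x)%:E.
Proof.
move=> mf f0 c0; under eq_integral do rewrite EFinM.
by rewrite ge0_integralZl//; [exact/measurable_EFinP|move=> x _; rewrite lee_fin].
Qed.

Lemma ge0_integralD_EFin f g : measurable_fun setT f -> measurable_fun setT g ->
  (forall x, (0 <= f x)%R) -> (forall x, (0 <= g x)%R) ->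
  \int[m]_x (f x + g x)%:E = \int[m]_x (f x)%:E + \int[m]_x (g x)%:E.
Proof.
move=> mf mg f0 g0; under eq_integral do rewrite EFinD.
by rewrite ge0_integralD//; try exact/measurable_EFinP; move=> x _; rewrite lee_fin.
Qed.

Lemma ge0_le_integral_EFin f g : measurable_fun setT f -> measurable_fun setT g ->
  (forall x, (0 <= f x)%R) -> (forall x, (f x <= g x)%R) ->
  \int[m]_x (f x)%:E <= \int[m]_x (g x)%:E.
Proof.
move=> mf mg f0 fg; apply: ge0_le_integral => //; try exact/measurable_EFinP.
- by move=> x _; rewrite lee_fin.
- by move=> x _; rewrite lee_fin.
Qed.

End real_integrands.

Section gaussian.
Context {R : realType}.
Local Notation lam n := (@lebesgue_rV R n).

Lemma measurable_mulmx_fun d (T : measurableType d) m n (A : 'M[R]_(m, n))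
    (x : T -> 'rV[R]_m) : measurable_fun setT x ->
  measurable_fun setT (fun t => x t *m A).
Proof. by move=> mx; exact: (measurableT_comp (measurable_mulmxr A) mx). Qed.

Lemma measurable_sqn d (T : measurableType d) n (x : T -> 'rV[R]_n) :
  measurable_fun setT x -> measurable_fun setT (fun t => sqn (x t)).
Proof.
move=> mx; under eq_fun do rewrite sqnE.
apply: measurable_sum => i; apply: measurable_funX.
exact: (measurableT_comp (measurable_coord i) mx).
Qed.

Lemma measurable_gauss d (T : measurableType d) n (x : T -> 'rV[R]_n) :
  measurable_fun setT x -> measurable_fun setT (fun t => expR (- sqn (x t))).
Proof.
by move=> mx; apply: measurableT_comp => //; apply: measurable_funN; exact: measurable_sqn.
Qed.

Local Open Scope ereal_scope.

Lemma integral_gauss n :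
  \int[lam n]_x (expR (- sqn x))%:E = (Num.sqrt pi ^+ n)%:E.
Proof.
transitivity (\prod_(i < n) \int[@lebesgue_measure R]_t (gauss_fun t)%:E).
  rewrite prod_integral1; last 2 first.
  - by move=> i; apply/measurable_EFinP; exact: measurable_gauss_fun.
  - by move=> i t; rewrite lee_fin gauss_fun_ge0.
  apply: eq_integral => x _; rewrite prodEFin; congr (_%:E).
  rewrite sqnE (big_morph _ (@opprD R) (@oppr0 R)) expR_sum.
  by apply: eq_bigr => i _.
under eq_bigr do rewrite integralT_gauss.
by rewrite prodEFin prodr_const card_ord.
Qed.

Lemma integral_gauss_mulmx n (W : 'M[R]_n) : \det W != 0%R ->
  \int[lam n]_x (expR (- sqn (x *m W)%R))%:E =
  (`|\det W|^-1 * Num.sqrt pi ^+ n)%:E.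
Proof.
move=> W0; have := dilatesP W0 (f := fun x => (expR (- sqn x))%:E).
rewrite integral_gauss => h; have := h _ (fun x => _).
have mg : measurable_fun setT (fun x : 'rV[R]_n => (expR (- sqn x))%:E : \bar R).
  by apply/measurable_EFinP; exact: measurable_gauss.
move=> /(_ mg) => {}h.
have /h : forall x : 'rV[R]_n, 0 <= (expR (- sqn x))%:E by move=> x; rewrite lee_fin expR_ge0.
move=> {}h; rewrite EFinM -h muleA -EFinM mulVf ?mul1e//.
by rewrite normr_eq0.
Qed.

End gaussian.

(** * Second moments of a density with bounded support *)

Section bounded_support.
Context {R : realType} {s : nat}.
Local Notation lam n := (@lebesgue_rV R n).
Variables (f : 'rV[R]_s -> R) (rho : R).
Hypotheses (mf : measurable_fun setT f) (f01 : forall x, 0 <= f x <= 1).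
Hypothesis fs : forall x i, f x != 0 -> `|x ord0 i| <= rho.

Definition cube (rho : R) : set 'rV[R]_s :=
  [set x | forall i, `[- rho, rho]%classic (x ord0 i)].

Lemma measurable_cube r : measurable (cube r).
Proof.
have mI : measurable (`[- r, r]%classic : set (measurableTypeR R)).
  exact: measurable_itv.
rewrite [X in measurable X](_ : _ = \big[setI/setT]_(i < s)
    ((fun x : 'rV[R]_s => x ord0 i) @^-1` `[- r, r])).
  apply: bigsetI_measurable => i _.
  rewrite -[X in measurable X]setTI; exact: (measurable_coord i).
rewrite -bigcap_seq; apply/seteqP; split => t /= h i.
  by move=> _; exact: h.
by apply: h; rewrite /= mem_index_enum.
Qed.

Lemma lebesgue_cube r : exists2 M : R, 0 <= M & lam s (cube r) = M%:E.
Proof.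
have [r1 r0 rE] : exists2 r1 : R, 0 <= r1 &
    @lebesgue_measure R `[- r, r]%classic = r1%:E.
  rewrite lebesgue_measure_itv/=; case: ifP => [h|_]; last by exists 0.
  exists (r - - r); last by rewrite EFinB.
  by rewrite subr_ge0 ltW// -lte_fin.
exists (r1 ^+ s); first exact: exprn_ge0.
rewrite (lebesgue_rV_box (A := fun=> `[- r, r]%classic))//.
by under eq_bigr do rewrite rE; rewrite prodEFin prodr_const card_ord.
Qed.

Local Open Scope ereal_scope.

(** A bound on the support makes the second moments finite. Its size rho does not enter the later
    estimates, so a crude one will do. *)
Lemma integrable_cube (h : 'rV[R]_s -> R) M :
  measurable_fun setT h -> (forall x, (`|h x| <= M * \1_(cube rho) x)%R) ->
  (lam s).-integrable setT (EFin \o h).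
Proof.
move=> mh hM.
apply: (@le_integrable _ _ _ (lam s) setT measurableT _
    (fun x => M%:E * (\1_(cube rho) x)%:E)).
- exact/measurable_EFinP.
- move=> x _ /=; rewrite lee_fin (le_trans (hM x))//.
  by rewrite ler_norm.
- apply: integrableZl => //; apply/integrableP; split.
    by apply/measurable_EFinP; apply: measurable_indic; exact: measurable_cube.
  under eq_integral do rewrite gee0_abs ?lee_fin//.
  rewrite integral_indic ?setIT//; last exact: measurable_cube.
  have [r _ rE] := lebesgue_cube rho.
  by have : lam s (cube rho) < +oo by rewrite rE ltry.
Qed.

Definition moment2 (a b : 'I_s) : R :=
  fine (\int[lam s]_x (f x * (x ord0 a * x ord0 b))%:E).

Lemma integrable_moment2 a b :
  (lam s).-integrable setT (EFin \o (fun x => f x * (x ord0 a * x ord0 b))%R).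
Proof.
apply: (@integrable_cube _ (rho * rho)%R) => [|x].
  apply: measurable_funM => //; apply: measurable_funM; exact: measurable_coord.
rewrite indicE; have [/= xc|xc] := boolP (x \in cube rho).
  rewrite mulr1 !normrM -[leRHS]mul1r; have /andP[f0 f1] := f01 x.
  move: xc; rewrite inE /cube/= => xc.
  have xi i : (`|x ord0 i| <= rho)%R by have := xc i; rewrite in_itv/= -ler_norml.
  apply: ler_pM; rewrite ?mulr_ge0//; first by rewrite ger0_norm.
  exact: ler_pM.
rewrite mulr0; have -> : f x = 0%R; last by rewrite mul0r normr0.
apply/eqP; apply: contraR xc => fx; rewrite inE /cube/= => i.
by rewrite in_itv/= -ler_norml; exact: fs.
Qed.

Lemma moment2E a b :
  \int[lam s]_x (f x * (x ord0 a * x ord0 b))%:E = (moment2 a b)%:E.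
Proof.
by rewrite /moment2 fineK//; exact: (integrable_fin_num measurableT (integrable_moment2 a b)).
Qed.

Definition moment2_mx : 'M[R]_s := \matrix_(a, b) moment2 a b.

Lemma moment2_sym : (moment2_mx^T = moment2_mx)%R.
Proof.
apply/matrixP => a b; rewrite !mxE /moment2; congr fine.
by apply: eq_integral => x _; rewrite [(x ord0 a * _)%R]mulrC.
Qed.

Lemma sum_moment2 (c : 'I_s -> 'I_s -> R) :
  (\sum_a \sum_b c a b * moment2 a b)%R%:E =
  \int[lam s]_x (f x * \sum_a \sum_b c a b * (x ord0 a * x ord0 b))%:E.
Proof.
transitivity (\sum_a \sum_b \int[lam s]_x
   ((c a b)%:E * (f x * (x ord0 a * x ord0 b))%:E)).
  rewrite -sumEFin; apply: eq_bigr => a _; rewrite -sumEFin; apply: eq_bigr => b _.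
  by rewrite integralZl ?EFinM ?moment2E//; exact: integrable_moment2.
have ib a b : (lam s).-integrable setT
    (fun x => (c a b)%:E * (f x * (x ord0 a * x ord0 b))%:E).
  by apply: integrableZl => //; exact: integrable_moment2.
transitivity (\sum_a \int[lam s]_x \sum_b
   ((c a b)%:E * (f x * (x ord0 a * x ord0 b))%:E)).
  by apply: eq_bigr => a _; rewrite integral_sum.
rewrite -integral_sum//; last by move=> a; exact: integrable_sum.
apply: eq_integral => x _; rewrite mulr_sumr -sumEFin; apply: eq_bigr => a _.
rewrite mulr_sumr -sumEFin; apply: eq_bigr => b _.
by rewrite -EFinM mulrCA.
Qed.

End bounded_support.

(** * Lower bound on the determinant of the second moments *)

Section det_moment.
Context {R : realType} {s : nat}.
Local Notation lam n := (@lebesgue_rV R n).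

Lemma quad_formE (M : 'M[R]_s) (x y : 'rV[R]_s) :
  (x *m M *m y^T) ord0 ord0 = \sum_a \sum_b M a b * (x ord0 a * y ord0 b).
Proof.
rewrite mxE exchange_big/=; apply: eq_bigr => b _.
rewrite !mxE big_distrl/=; apply: eq_bigr => a _.
by rewrite mulrCA mulrA.
Qed.

Lemma sqn_mulmx (W : 'M[R]_s) (x : 'rV[R]_s) :
  sqn (x *m W) = \sum_a \sum_b (W *m W^T) a b * (x ord0 a * x ord0 b).
Proof. by rewrite -quad_formE /sqn trmx_mul !mulmxA. Qed.

Variables (f : 'rV[R]_s -> R) (rho V : R).
Hypotheses (mf : measurable_fun setT f) (f01 : forall x, 0 <= f x <= 1).
Hypothesis fs : forall x i, f x != 0 -> `|x ord0 i| <= rho.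
Hypotheses (fV : (\int[lam s]_x (f x)%:E)%E = V%:E) (V0 : 0 < V) (s0 : (0 < s)%N).

Local Notation Sig := (moment2_mx f).

Let f0 x : 0 <= f x. Proof. by have /andP[] := f01 x. Qed.

(** In [det_moment2_reg] the Gaussian integral contributes sqrt pi^s and the shift 2 s of the
    exponent contributes e^(2 s); squaring gives pi^s e^(4 s). *)
Definition kappa0 : R := expR (- 4) / pi.

Lemma kappa0_gt0 : 0 < kappa0.
Proof. by rewrite divr_gt0// ?expR_gt0// pi_gt0. Qed.

(** [Sig] alone is only seen to be semidefinite; the added e makes a Cholesky factorization
    available. *)
Lemma posdef_moment2 e : 0 < e -> posdef (Sig + e%:M).
Proof.
move=> e0; split.
  by rewrite linearD/= moment2_sym tr_scalar_mx.
move=> u u0; rewrite mulmxDr mulmxDl mxE.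
apply: ltr_wpDl; last first.
  by rewrite mul_mx_scalar -scalemxAl mxE mulr_gt0// -/(sqn u) sqn_gt0.
rewrite quad_formE -lee_fin.
under eq_bigr do under eq_bigr do rewrite mxE mulrC.
rewrite (sum_moment2 mf f01 fs (fun a b => u ord0 a * u ord0 b)).
apply: integral_ge0 => x _; rewrite lee_fin mulr_ge0//.
rewrite [leRHS](_ : _ = (\sum_a u ord0 a * x ord0 a) ^+ 2) ?sqr_ge0//.
rewrite expr2 big_distrl/=; apply: eq_bigr => a _; rewrite big_distrr/=.
by apply: eq_bigr => b _; rewrite mulrACA.
Qed.

(* With S = Sig + e = P P^T, the quadratic form q(x) = |x P^-T|^2 has f-mean at
   most s, and f (2s - V q) <= exp (2s - V q) integrates to a Gaussian integral
   proportional to |det P|. *)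
Lemma det_moment2_reg e : 0 < e -> V ^+ s.+2 * kappa0 ^+ s <= \det (Sig + e%:M).
Proof.
move=> e0; have pd := posdef_moment2 e0; set S := Sig + e%:M in pd *.
have [[P SE] _] := posdef_cholesky pd.
have P0 := posdef_det_neq0 pd SE.
have Pu : P \in unitmx by rewrite unitmxE unitfE.
pose W := (invmx P)^T; pose q x := sqn (x *m W).
have WS : W *m W^T *m S = 1%:M.
  rewrite /W trmxK SE -mulmxA [invmx P *m _]mulmxA mulVmx// mul1mx.
  by rewrite -trmx_mul mulmxV// trmx1.
(* Since W W^T = S^-1, the sum is tr (S^-1 Sig) = s - e tr (S^-1), and the last trace is
   nonnegative. *)
have trle : \sum_a \sum_b (W *m W^T) a b * moment2 f a b <= s%:R.
  have -> : \sum_a \sum_b (W *m W^T) a b * moment2 f a b = \tr (W *m W^T *m Sig).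
    apply: eq_bigr => a _; rewrite mxE; apply: eq_bigr => b _.
    by rewrite -moment2_sym !mxE.
  have -> : Sig = S - e%:M by rewrite /S addrK.
  rewrite mulmxBr WS mul_mx_scalar linearB/= mxtrace1 linearZ/= lerBlDr lerDl.
  rewrite mulr_ge0 ?(ltW e0)// /mxtrace; apply: sumr_ge0 => i _.
  by rewrite mxE; apply: sumr_ge0 => j _; rewrite [X in _ * X]mxE -expr2 sqr_ge0.
have mW : measurable_fun setT (fun x : 'rV[R]_s => x *m W) by exact: measurable_mulmxr.
have mq : measurable_fun setT q by exact: measurable_sqn.
have q0 x : 0 <= q x by exact: sqn_ge0.
have fq : (\int[lam s]_x (f x * q x)%:E)%E =
    (\sum_a \sum_b (W *m W^T) a b * moment2 f a b)%:E.
  rewrite (sum_moment2 mf f01 fs); apply: eq_integral => x _.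
  by rewrite /q sqn_mulmx.
have sV0 : 0 < Num.sqrt V by rewrite sqrtr_gt0.
have detW : \det (Num.sqrt V *: W) = Num.sqrt V ^+ s / \det P.
  by rewrite detZ /W det_tr det_inv.
have detW0 : \det (Num.sqrt V *: W) != 0.
  by rewrite detW mulf_neq0 ?invr_eq0// expf_neq0// gt_eqF.
pose X := expR (2 * s%:R) * (`|\det (Num.sqrt V *: W)|^-1 * Num.sqrt pi ^+ s).
have VqE x : expR (2 * s%:R - V * q x) =
    expR (2 * s%:R) * expR (- sqn (x *m (Num.sqrt V *: W))).
  rewrite -expRD /q -scalemxAr; congr (expR (_ - _)).
  rewrite /sqn linearZ/= -scalemxAl -scalemxAr !mxE mulrA.
  by rewrite -expr2 sqr_sqrtr// ltW.
have mVq : measurable_fun setT (fun x => expR (2 * s%:R - V * q x)).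
  by apply: measurableT_comp => //; apply: measurable_funB => //; exact: measurable_funM.
have XE : (\int[lam s]_x (expR (2 * s%:R - V * q x))%:E = X%:E)%E.
  under eq_integral do rewrite VqE.
  rewrite (ge0_integralZ_EFin _ _ _ (expR_ge0 _)).
  - by rewrite integral_gauss_mulmx// -EFinM.
  - by apply: measurable_gauss; exact: measurable_mulmxr.
  - by move=> x; exact: expR_ge0.
have mfq : measurable_fun setT (fun x => f x * q x) by exact: measurable_funM.
have fq0 x : 0 <= f x * q x by rewrite mulr_ge0.
have mVfq : measurable_fun setT (fun x => V * (f x * q x)) by exact: measurable_funM.
(* The pointwise bound is integrated: from 2 s V one subtracts V times the integral of f q, at most
   V s, and s V remains. *)
have key : s%:R * V <= X.
  have : (\int[lam s]_x (2 * s%:R * f x)%:E <=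
      \int[lam s]_x (V * (f x * q x) + expR (2 * s%:R - V * q x))%:E)%E.
    apply: ge0_le_integral_EFin => [| | |x].
    - exact: measurable_funM.
    - exact: measurable_funD.
    - by move=> x; rewrite !mulr_ge0.
    rewrite -lerBlDl.
    have -> : 2 * s%:R * f x - V * (f x * q x) = f x * (2 * s%:R - V * q x) by ring.
    have [h|h] := leP (2 * s%:R - V * q x) 0.
      by apply: (@le_trans _ _ 0); [exact: mulr_ge0_le0|exact: expR_ge0].
    apply: (@le_trans _ _ (2 * s%:R - V * q x)).
      by apply: ler_piMl; [exact: ltW|have /andP[] := f01 x].
    by apply: le_trans (expR_ge1Dx _); rewrite lerDr.
  rewrite (ge0_integralD_EFin _ mVfq mVq); last 2 first.
  - by move=> x; rewrite mulr_ge0// ltW.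
  - by move=> x; exact: expR_ge0.
  rewrite XE (ge0_integralZ_EFin _ mf f0) ?mulr_ge0//.
  rewrite (ge0_integralZ_EFin _ mfq fq0) ?(ltW V0)//.
  rewrite fV fq -!EFinM -EFinD lee_fin => h.
  have h2 := ler_wpM2l (ltW V0) trle.
  lra.
have detX : X = expR 2 ^+ s * (`|\det P| / Num.sqrt V ^+ s * Num.sqrt pi ^+ s).
  rewrite /X detW mulrC -expRM_natr mulrC; congr (_ * (_ * _)).
  rewrite normrM normfV invfM invrK mulrC ger0_norm// exprn_ge0// ltW//.
have detS : \det S = `|\det P| ^+ 2.
  by rewrite SE det_mulmx det_tr -expr2 real_normK ?num_real.
have pi0 : 0 < Num.sqrt pi :> R by rewrite sqrtr_gt0 pi_gt0.
have S0 : 0 < Num.sqrt V ^+ s by rewrite exprn_gt0.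
have p0 : 0 < Num.sqrt pi ^+ s :> R by rewrite exprn_gt0.
have e20 : 0 < expR 2 ^+ s :> R by rewrite exprn_gt0// expR_gt0.
have lb : V * Num.sqrt V ^+ s <= expR 2 ^+ s * Num.sqrt pi ^+ s * `|\det P|.
  rewrite -ler_pdivlMr//; apply: le_trans (_ : s%:R * V <= _).
    by rewrite ler_peMl// ?ler1n// ltW.
  by apply: le_trans key _; rewrite detX le_eqVlt; apply/orP; left; apply/eqP; field; rewrite gt_eqF.
have lb2 : (V * Num.sqrt V ^+ s) ^+ 2 <=
    (expR 2 ^+ s * Num.sqrt pi ^+ s * `|\det P|) ^+ 2.
  by rewrite ler_pXn2r// nnegrE ?mulr_ge0// ltW.
have V2 : (Num.sqrt V ^+ s) ^+ 2 = V ^+ s by rewrite exprAC sqr_sqrtr// ltW.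
have pi2 : (Num.sqrt pi ^+ s) ^+ 2 = pi ^+ s :> R.
  by rewrite exprAC sqr_sqrtr// ltW// pi_gt0.
have e4 : (expR 2 ^+ s) ^+ 2 = (expR (- 4) ^+ s)^-1 :> R.
  by rewrite exprAC -exprVn -expRN opprK -expRM_natl; congr (expR _ ^+ _); ring.
rewrite !exprMn V2 pi2 e4 -detS in lb2.
rewrite /kappa0 expr_div_n -addn2 exprD mulrA ler_pdivrMr ?exprn_gt0 ?pi_gt0//.
rewrite -ler_pdivlMr ?exprn_gt0 ?expR_gt0// [V ^+ s * _]mulrC.
by apply: le_trans lb2 _; rewrite le_eqVlt; apply/orP; left; apply/eqP; ring.
Qed.

Lemma horner_char_polyN (A : 'M[R]_s) e :
  (char_poly (- A)).[e] = \det (A + e%:M).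
Proof.
rewrite horner_sum; apply: eq_bigr => t _.
rewrite hornerM horner_exp !hornerE; congr (_ * _).
rewrite (big_morph _ (fun p q => hornerM p q e) (hornerC 1 e)).
apply: eq_bigr => i _; rewrite !mxE !(hornerE, hornerMn) opprK addrC.
by [].
Qed.

(** The limit e -> 0 is taken algebraically, det (Sig + e) being a polynomial in e. Were det Sig
    less than L, the intermediate value theorem would give some e in ]0, 1] where the polynomial
    equals the midpoint M < L, against [det_moment2_reg]. *)
Lemma det_moment2_ge : V ^+ s.+2 * kappa0 ^+ s <= \det Sig.
Proof.
set L := V ^+ _ * _; rewrite leNgt; apply/negP => detL.
pose M := (\det Sig + L) / 2; pose p := char_poly (- Sig) - M%:P.
have pE e : p.[e] = \det (Sig + e%:M) - M.
  by rewrite /p hornerD hornerN hornerC horner_char_polyN.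
have p0 : p.[0] < 0.
  by rewrite pE raddf0 addr0 /M; lra.
have p1 : 0 <= p.[1].
  by rewrite pE; have := det_moment2_reg ltr01; rewrite -/L /M; lra.
have [|x /andP[x0 _] /rootP px] := @poly_ivt R p 0 1 ler01.
  by rewrite ltW.
have xgt0 : 0 < x.
  rewrite lt_neqAle x0 andbT; apply/negP => /eqP xE.
  have e : p.[0] = 0 by rewrite -[RHS]px; congr (p.[_]).
  by move: p0; rewrite e ltxx.
have := det_moment2_reg xgt0; rewrite -/L.
by move: px; rewrite pE /M; lra.
Qed.

Lemma prod_det_sqE (Y : 'M[R]_s) :
  (\prod_i f (row i Y)) * \det Y ^+ 2 =
  \sum_(t : 'S_s) \sum_(u : 'S_s) (-1) ^+ t * (-1) ^+ u *
    \prod_i (f (row i Y) * (row i Y ord0 (t i) * row i Y ord0 (u i))).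
Proof.
have rE (t : 'S_s) : \prod_i Y i (t i) = \prod_i row i Y ord0 (t i).
  by apply: eq_bigr => i _; rewrite mxE.
rewrite expr2 /determinant big_distrl/= big_distrr/=; apply: eq_bigr => t _.
rewrite big_distrr/= big_distrr/=; apply: eq_bigr => u _.
rewrite big_split/= big_split/=.
rewrite !rE; by rewrite [RHS]mulrCA; congr (_ * _); rewrite mulrACA.
Qed.

(** For a pair t, u of permutations the integral factors over the rows into entries of [Sig]. For
    fixed t the sum over u is the determinant of [Sig] with rows permuted by t, whose sign cancels
    that of t; each of the s! permutations t thus contributes det Sig. *)
Lemma integral_det_sq :
  (integral_mx (fun Y : 'M[R]_s => ((\prod_i f (row i Y)) * \det Y ^+ 2)%:E) =
   (s`!%:R * \det Sig)%:E)%E.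
Proof.
pose h (t u : 'S_s) i x := f x * (x ord0 (t i) * x ord0 (u i)).
have ih t u i : (lam s).-integrable setT (EFin \o h t u i).
  exact: (integrable_moment2 mf f01 fs).
rewrite /integral_mx.
transitivity (\int[lam (s * s)]_v \sum_(t : 'S_s) \sum_(u : 'S_s)
    (((-1) ^+ t * (-1) ^+ u)%:E * (\prod_i h t u i (row i (mx_of_rV v)))%:E))%E.
  apply: eq_integral => v _; rewrite prod_det_sqE -sumEFin.
  by apply: eq_bigr => t _; rewrite -sumEFin; apply: eq_bigr => u _; rewrite EFinM.
have ip (t u : 'S_s) : (lam (s * s)).-integrable setT (fun v =>
    (((-1) ^+ t * (-1) ^+ u)%:E * (\prod_i h t u i (row i (mx_of_rV v)))%:E)%E).
  apply: integrableZl => //; exact: integrable_prod_row.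
rewrite integral_sum//; last by move=> t; exact: integrable_sum.
transitivity (\sum_(t : 'S_s) (\det Sig)%:E)%E; last first.
  by rewrite sumEFin sumr_const card_Sn mulr_natl.
apply: eq_bigr => t _; rewrite integral_sum//.
transitivity (\sum_(u : 'S_s) ((-1) ^+ t * (-1) ^+ u * \prod_i Sig (t i) (u i))%:E)%E.
  apply: eq_bigr => u _; rewrite integralZl//; last exact: integrable_prod_row.
  rewrite prod_integral_row_signed// [RHS]EFinM; congr (_ * _)%E.
  rewrite -prodEFin; apply: eq_bigr => i _.
  by rewrite (moment2E mf f01 fs) mxE.
rewrite sumEFin; congr (_%:E).
under eq_bigr do rewrite -mulrA.
rewrite -big_distrr/= -[X in _ * X](_ : \det (row_perm t Sig) = _); last first.
  by apply: eq_bigr => u _; congr (_ * _); apply: eq_bigr => i _; rewrite mxE.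
by rewrite row_permE det_mulmx det_perm mulrA -signr_addb addbb expr0 mul1r.
Qed.

End det_moment.

(** * From the second moment of the determinant to its absolute moments *)

Section det_abs_moment.
Context {R : realType}.
Local Notation lam n := (@lebesgue_rV R n).

(** Extracts from s! the factor s^s whose square root is the (sqrt s)^s of the moment bound. The
    induction step is (1 + 1/n)^n <= e. *)
Lemma fact_ge_exp n : (n%:R / expR 1) ^+ n <= n`!%:R :> R.
Proof.
elim: n => [|n IH]; first by rewrite expr0.
have e0 : 0 < expR 1 :> R by exact: expR_gt0.
have [->|n0] := eqVneq n 0%N.
  by rewrite expr1 (_ : 1`! = 1%N)// ler_pdivrMr// mul1r (le_trans _ (expR_ge1Dx _))// lerDl.
have nR : 0 < n%:R :> R by rewrite ltr0n lt0n.
rewrite factS natrM expr_div_n ler_pdivrMr ?exprn_gt0// [X in X <= _]exprS -mulrA.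
rewrite ler_pM2l ?ltr0n//.
have h : n.+1%:R ^+ n <= n%:R ^+ n * expR 1 :> R.
  have -> : n.+1%:R = n%:R * (1 + n%:R^-1) :> R.
    by rewrite mulrDr mulr1 mulfV ?gt_eqF// -natr1.
  rewrite exprMn ler_pM2l ?exprn_gt0//.
  apply: (@le_trans _ _ (expR (n%:R^-1) ^+ n)).
    by rewrite lerXn2r ?nnegrE ?expR_ge0 ?expR_ge1Dx// addr_ge0// invr_ge0 ltW.
  by rewrite -expRM_natl mulfV// gt_eqF.
apply: (le_trans h); rewrite exprSr mulrA ler_pM2r//.
by move: IH; rewrite expr_div_n ler_pdivrMr ?exprn_gt0.
Qed.

(** Under the root, [kappa0] comes from det Sig and 1/e from s!. The 1/2 pays for the threshold t in
    [det_abs_moment], which is half of the lower bound on the root mean square. *)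
Definition c1 : R := Num.sqrt (kappa0 / expR 1) / 2.

Lemma c1_gt0 : 0 < c1.
Proof. by rewrite divr_gt0// sqrtr_gt0 divr_gt0 ?kappa0_gt0 ?expR_gt0. Qed.

(** If d <= t, the last term suffices. Otherwise t^k is at most d^k, and one of the resulting
    factors d is at most D. *)
Lemma det_moment_pointwise (d t D : R) k : 0 <= t -> 0 <= d -> d <= D ->
  t ^+ k * d ^+ 2 <= D * d ^+ k.+1 + t ^+ k.+2.
Proof.
move=> t0 d0 dD; have [dt|td] := leP d t.
  have -> : t ^+ k.+2 = t ^+ k * t ^+ 2 by rewrite -exprD addn2.
  rewrite (@le_trans _ _ (t ^+ k * t ^+ 2))//.
    by rewrite ler_wpM2l ?exprn_ge0// lerXn2r.
  by rewrite lerDr mulr_ge0 ?exprn_ge0// (le_trans d0).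
apply: (@le_trans _ _ (D * d ^+ k.+1)); last by rewrite lerDl exprn_ge0.
apply: (@le_trans _ _ (d ^+ k * d ^+ 2)).
  by rewrite ler_wpM2r ?exprn_ge0// lerXn2r// ltW.
by rewrite -exprD addn2 exprS ler_wpM2r ?exprn_ge0.
Qed.

Context {s : nat}.
Variables (f : 'rV[R]_s -> R) (rho V : R).
Hypotheses (mf : measurable_fun setT f) (f01 : forall x, 0 <= f x <= 1).
Hypothesis fs : forall x i, f x != 0 -> `|x ord0 i| <= rho.
Hypotheses (fV : (\int[lam s]_x (f x)%:E)%E = V%:E) (V0 : 0 < V) (s0 : (0 < s)%N).
Variables (D : R) (k : nat).
Hypothesis detD : forall Y : 'M[R]_s, (forall i, f (row i Y) != 0) -> `|\det Y| <= D.

Local Notation Sig := (moment2_mx f).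

(* Since |det| <= D on the support, t^k (det^2 - t^2) <= D |det|^(k+1) there, so
   the second moment controls all absolute moments, including the first. *)
Lemma det_abs_moment :
  ((((c1 * Num.sqrt s%:R) ^+ s * V) ^+ k.+2 * V ^+ s)%:E <= D%:E * integral_mx
    (fun Y => ((\prod_i f (row i Y)) * `|\det Y| ^+ k.+1)%:E))%E.
Proof.
have f0 x : 0 <= f x by have /andP[] := f01 x.
have kap0 : 0 < kappa0 / expR 1 :> R by rewrite divr_gt0 ?kappa0_gt0 ?expR_gt0.
pose r := (Num.sqrt (kappa0 / expR 1) * Num.sqrt s%:R : R) ^+ s.
have r0 : 0 <= r by rewrite exprn_ge0// mulr_ge0 ?sqrtr_ge0.
have r2 : r ^+ 2 = (kappa0 / expR 1) ^+ s * s%:R ^+ s.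
  by rewrite /r -exprM mulnC exprM [X in X ^+ s]exprMn !sqr_sqrtr ?(ltW kap0)// exprMn.
(* r V is a lower bound for the root mean square of |det| over the mass V^s. With half of it the
   second moment is at least 4 t^2 V^s, and enough is left after t^2 V^s is subtracted. *)
pose t := r * V / 2.
have t0 : 0 <= t by rewrite divr_ge0// mulr_ge0// ltW.
have m2 : 4 * t ^+ 2 * V ^+ s <= s`!%:R * \det Sig.
  apply: (@le_trans _ _ ((s%:R / expR 1) ^+ s * (V ^+ s.+2 * kappa0 ^+ s))).
    have -> : V ^+ s.+2 = V ^+ s * V ^+ 2 by rewrite -exprD addn2.
    rewrite le_eqVlt; apply/orP; left; apply/eqP.
    have -> : t ^+ 2 = r ^+ 2 * V ^+ 2 / 4 by rewrite /t; field.
    by rewrite r2 !expr_div_n; field; rewrite !expf_neq0 ?gt_eqF ?expR_gt0 ?pi_gt0.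
  apply: ler_pM; rewrite ?fact_ge_exp ?exprn_ge0 ?divr_ge0 ?expR_ge0//.
    by rewrite mulr_ge0 ?exprn_ge0// ltW// kappa0_gt0.
  exact: (det_moment2_ge mf f01 fs fV V0 s0).
(* The 1/2 inside [c1] occurs to the power s >= 1, hence is at most the single 1/2 in t. *)
have ct : (c1 * Num.sqrt s%:R) ^+ s * V <= t.
  rewrite /t [X in _ <= X]mulrAC ler_pM2r// /r /c1 mulrAC expr_div_n.
  rewrite ler_wpM2l ?exprn_ge0 ?mulr_ge0 ?sqrtr_ge0// lef_pV2 ?posrE ?exprn_gt0//.
  by rewrite -[X in X <= _]expr1 ler_weXn2l// ler1n.
have mP : measurable_fun setT (fun v : 'rV[R]_(s * s) => \prod_i f (row i (mx_of_rV v))).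
  apply: measurable_prod => i _.
  by apply: (measurableT_comp mf); apply: measurable_mx_row; exact: measurable_mx_of_rV.
have mdet : measurable_fun setT (fun v : 'rV[R]_(s * s) => \det (mx_of_rV v)).
  by apply: measurable_mx_det; exact: measurable_mx_of_rV.
have P0 (Y : 'M[R]_s) : 0 <= \prod_i f (row i Y) by exact: prodr_ge0.
have mPd : measurable_fun setT (fun v : 'rV[R]_(s * s) =>
    (\prod_i f (row i (mx_of_rV v))) * \det (mx_of_rV v) ^+ 2).
  by apply: measurable_funM => //; exact: measurable_funX.
have mPa : measurable_fun setT (fun v : 'rV[R]_(s * s) =>
    (\prod_i f (row i (mx_of_rV v))) * `|\det (mx_of_rV v)| ^+ k.+1).
  by apply: measurable_funM => //; apply: measurable_funX; exact: measurableT_comp.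
have Pa0 (v : 'rV[R]_(s * s)) :
    0 <= (\prod_i f (row i (mx_of_rV v))) * `|\det (mx_of_rV v)| ^+ k.+1.
  by rewrite mulr_ge0// exprn_ge0.
(* As V > 0, f is nonzero at some x, and [detD] applies to the matrix whose rows all equal x. *)
have D0 : 0 <= D.
  have [fx|/forallNP fx] := pselect (exists x, f x != 0).
    have [x fx0] := fx; apply: le_trans (normr_ge0 _) (@detD (\matrix_(i < s) x) _).
    by move=> i; rewrite rowK.
  have := V0; rewrite -lte_fin -fV integral0_eq ?ltxx// => x _.
  by have /negP := fx x; rewrite negbK => /eqP ->.
have IP : (\int[lam (s * s)]_v (\prod_i f (row i (mx_of_rV v)))%:E = (V ^+ s)%:E)%E.
  have mfE (i : 'I_s) : measurable_fun setT (fun x => (f x)%:E : \bar R).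
    exact/measurable_EFinP.
  have f0E (i : 'I_s) x : (0 <= (f x)%:E)%E by rewrite lee_fin.
  transitivity (integral_mx (fun Y => \prod_(i < s) (f (row i Y))%:E))%E.
    by apply: eq_integral => v _; rewrite prodEFin.
  rewrite -(prod_integral_row mfE f0E); under eq_bigr do rewrite fV.
  by rewrite prodEFin prodr_const card_ord.
have key : ((t ^+ k * (s`!%:R * \det Sig))%:E <= D%:E * integral_mx
    (fun Y => ((\prod_i f (row i Y)) * `|\det Y| ^+ k.+1)%:E) + (t ^+ k.+2 * V ^+ s)%:E)%E.
  rewrite EFinM -(integral_det_sq mf f01 fs) [(_ * V ^+ s)%:E]EFinM -IP /integral_mx.
  rewrite -(ge0_integralZ_EFin _ mPd)//; last 2 first.
  - by move=> v; rewrite mulr_ge0// sqr_ge0.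
  - exact: exprn_ge0.
  rewrite -(ge0_integralZ_EFin _ mPa)// -(ge0_integralZ_EFin _ mP) ?exprn_ge0//.
  rewrite -ge0_integralD_EFin//; last 4 first.
  - exact: measurable_funM.
  - exact: measurable_funM.
  - by move=> v; rewrite mulr_ge0.
  - by move=> v; rewrite mulr_ge0// exprn_ge0.
  apply: ge0_le_integral_EFin => [| | |v].
  - exact: measurable_funM.
  - by apply: measurable_funD; exact: measurable_funM.
  - by move=> v; rewrite mulr_ge0 ?(exprn_ge0 _ t0)// mulr_ge0// sqr_ge0.
  set Y := mx_of_rV v; rewrite mulrCA [D * _]mulrCA [_ * \prod_i _]mulrC -mulrDr.
  have [/existsP[i fi]|] := boolP [exists i, f (row i Y) == 0].
    by rewrite (bigD1 i)//= (eqP fi) !mul0r.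
  rewrite negb_exists => /forallP fY; rewrite ler_wpM2l//.
  rewrite -[\det Y ^+ 2]real_normK ?num_real//.
  exact/det_moment_pointwise/detD.
move: key; rewrite -leeBlDr// -EFinB => /(le_trans _); apply.
rewrite lee_fin lerBrDr.
apply: (@le_trans _ _ (t ^+ k.+2 * V ^+ s + t ^+ k.+2 * V ^+ s)).
  rewrite lerD2r; apply: ler_wpM2r; first by rewrite exprn_ge0// ltW.
  apply: lerXn2r; rewrite ?nnegrE//.
  by rewrite mulr_ge0 ?(ltW V0)// exprn_ge0// mulr_ge0 ?sqrtr_ge0// ltW// c1_gt0.
apply: (@le_trans _ _ (t ^+ k * (4 * t ^+ 2 * V ^+ s))); last first.
  by rewrite ler_wpM2l// exprn_ge0.
have -> : t ^+ k * (4 * t ^+ 2 * V ^+ s) = 4 * (t ^+ k.+2 * V ^+ s).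
  have -> : t ^+ k.+2 = t ^+ k * t ^+ 2 by rewrite -exprD addn2.
  by ring.
have tV0 : 0 <= t ^+ k.+2 * V ^+ s by rewrite mulr_ge0 ?exprn_ge0// ltW.
lra.
Qed.

End det_abs_moment.

(** * Truncated Gaussians *)

Section truncated_gaussian.
Context {R : realType} {s : nat}.
Hypothesis s0 : (0 < s)%N.
Local Notation lam n := (@lebesgue_rV R n).

(** [det_abs_moment] asks for a bound on the determinant over the support, which a full Gaussian
    lacks. The radius 2 sqrt s keeps half of the mass and, by Hadamard, keeps |det| below (2 sqrt
    s)^s. *)
Definition trunc_gauss (x : 'rV[R]_s) : R :=
  if sqn x <= 4 * s%:R then expR (- sqn x) else 0.

Lemma trunc_gauss01 x : 0 <= trunc_gauss x <= 1.
Proof.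
rewrite /trunc_gauss; case: ifP => _; last by rewrite lexx ler01.
by rewrite expR_ge0 -[leRHS]expR0 ler_expR oppr_le0 sqn_ge0.
Qed.

Lemma trunc_gauss_le x : trunc_gauss x <= expR (- sqn x).
Proof. by rewrite /trunc_gauss; case: ifP => // _; exact: expR_ge0. Qed.

Lemma trunc_gauss_neq0 x : trunc_gauss x != 0 -> sqn x <= 4 * s%:R.
Proof. by rewrite /trunc_gauss; case: ifP => //; rewrite eqxx. Qed.

Let s1 : 1 <= s%:R :> R. Proof. by rewrite ler1n. Qed.

Lemma trunc_gauss_supp x i : trunc_gauss x != 0 -> `|x ord0 i| <= 4 * s%:R.
Proof.
move=> /trunc_gauss_neq0 xs; rewrite -(@ler_pXn2r _ 2)// ?nnegrE ?mulr_ge0//.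
rewrite real_normK ?num_real// (@le_trans _ _ (sqn x))//.
  rewrite sqnE (bigD1 i)//= lerDl; apply: sumr_ge0 => j _; exact: sqr_ge0.
by apply: le_trans xs _; rewrite expr2 ler_peMr ?mulr_ge0//; have := s1; lra.
Qed.

Lemma trunc_gauss_det (Y : 'M[R]_s) : (forall i, trunc_gauss (row i Y) != 0) ->
  `|\det Y| <= (2 * Num.sqrt s%:R) ^+ s.
Proof.
move=> hY; rewrite -(@ler_pXn2r _ 2)// ?nnegrE ?exprn_ge0 ?mulr_ge0 ?sqrtr_ge0//.
rewrite real_normK ?num_real//; apply: le_trans (hadamard Y) _.
have E : (2 * Num.sqrt s%:R) ^+ 2 = 4 * s%:R :> R.
  by rewrite exprMn sqr_sqrtr// -natrX.
rewrite -exprM mulnC exprM E.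
apply: (@le_trans _ _ (\prod_(i < s) (4 * s%:R))).
  by apply: ler_prod => i _; rewrite sqn_ge0/= trunc_gauss_neq0.
by rewrite prodr_const card_ord.
Qed.

Lemma measurable_trunc_gauss : measurable_fun setT trunc_gauss.
Proof.
apply: measurable_fun_ifT => //.
  by apply: measurable_fun_ler => //; exact: measurable_sqn.
exact: measurable_gauss.
Qed.

(** A Chernoff bound: where |x|^2 > 4 s, exp (- |x|^2) is at most e^(-2 s) exp (- |x|^2 / 2). The
    integral of the latter is (e^-2 sqrt 2)^s times the Gaussian mass, and e^-2 sqrt 2 <= 1/2. *)
Lemma integral_trunc_gauss : exists2 V : R, Num.sqrt pi ^+ s / 2 <= V &
  (\int[lam s]_x (trunc_gauss x)%:E)%E = V%:E.
Proof.
have mt := measurable_trunc_gauss.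
have t0 x : 0 <= trunc_gauss x by have /andP[] := trunc_gauss01 x.
have mg : measurable_fun setT (fun x : 'rV[R]_s => expR (- sqn x)) by exact: measurable_gauss.
have p0 : 0 < Num.sqrt pi ^+ s :> R by rewrite exprn_gt0// sqrtr_gt0 pi_gt0.
pose V := fine (\int[lam s]_x (trunc_gauss x)%:E)%E.
have VE : (\int[lam s]_x (trunc_gauss x)%:E)%E = V%:E.
  rewrite /V fineK// ge0_fin_numE ?integral_ge0// => [|x _]; last by rewrite lee_fin.
  apply: (@le_lt_trans _ _ (\int[lam s]_x (expR (- sqn x))%:E)%E).
    by apply: ge0_le_integral_EFin => // x; exact: trunc_gauss_le.
  by rewrite integral_gauss ltry.
exists V => //.
pose W : 'M[R]_s := (Num.sqrt 2)^-1%:M.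
have r2 : 0 < Num.sqrt 2 :> R by rewrite sqrtr_gt0.
have detW : \det W = (Num.sqrt 2)^-1 ^+ s by rewrite /W det_scalar.
have sW x : sqn (x *m W) = sqn x / 2.
  rewrite /W mul_mx_scalar !sqnE mulr_suml; apply: eq_bigr => i _.
  by rewrite mxE exprMn exprVn sqr_sqrtr// mulrC.
have mW : measurable_fun setT (fun x : 'rV[R]_s => expR (- sqn (x *m W))).
  by apply: measurable_gauss; exact: measurable_mulmxr.
have : (\int[lam s]_x (expR (- sqn x))%:E <=
    \int[lam s]_x (trunc_gauss x + expR (- 2) ^+ s * expR (- sqn (x *m W)))%:E)%E.
  apply: ge0_le_integral_EFin => // [|x].
    by apply: measurable_funD => //; exact: measurable_funM.
  rewrite /trunc_gauss; case: ifPn => [_|].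
    by rewrite lerDl mulr_ge0 ?exprn_ge0 ?expR_ge0.
  rewrite -ltNge add0r => xs; rewrite -expRM_natl -expRD ler_expR sW.
  by move: xs; lra.
have mgW : measurable_fun setT
    (fun x : 'rV[R]_s => expR (- 2) ^+ s * expR (- sqn (x *m W))).
  exact: measurable_funM.
have gW0 (x : 'rV[R]_s) : 0 <= expR (- 2) ^+ s * expR (- sqn (x *m W)).
  by rewrite mulr_ge0 ?exprn_ge0 ?expR_ge0.
rewrite (ge0_integralD_EFin _ mt mgW t0 gW0).
rewrite VE integral_gauss (ge0_integralZ_EFin _ mW (fun=> expR_ge0 _) (exprn_ge0 s (expR_ge0 _))).
rewrite integral_gauss_mulmx ?detW ?expf_neq0 ?invr_eq0 ?gt_eqF//.
rewrite -EFinM -EFinD lee_fin ger0_norm ?exprn_ge0 ?invr_ge0 ?sqrtr_ge0//.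
rewrite exprVn invrK mulrA -exprMn => h.
suff : (expR (- 2) * Num.sqrt 2) ^+ s <= 1 / 2 :> R by nra.
have e0 : 0 <= expR (- 2) * Num.sqrt 2 :> R by rewrite mulr_ge0 ?expR_ge0 ?sqrtr_ge0.
have e2 : expR (- 2) * Num.sqrt 2 <= 1 / 2 :> R.
  have e3 : 3 <= expR 2 :> R by apply: le_trans (expR_ge1Dx _); lra.
  have s2 : Num.sqrt 2 <= 3 / 2 :> R.
    rewrite -[leRHS]ger0_norm// -sqrtr_sqr ler_wsqrtr//; lra.
  rewrite expRN mulrC ler_pdivrMr ?expR_gt0//; lra.
rewrite -(prednK s0) exprS; apply: le_trans (e2); rewrite ler_piMr//.
apply: exprn_ile1 => //; apply: le_trans (e2) _; lra.
Qed.

End truncated_gaussian.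

(** * The Jacobian of a graph and the integral of its inverse powers *)

Section jacobian.
Context {R : realType} {s k : nat}.
Hypotheses (s0 : (0 < s)%N) (k0 : (0 < k)%N).
Local Notation lam n := (@lebesgue_rV R n).
Implicit Types B : 'M[R]_(k, s).

Definition graph_jac B : R := Num.sqrt (\det (graph_mx B *m (graph_mx B)^T)).

Lemma posdef_gram_graph B : posdef (graph_mx B *m (graph_mx B)^T).
Proof.
split; first by rewrite trmx_mul trmxK.
move=> u u0; rewrite mulmxA -mulmxA -trmx_mul -/(sqn (u *m graph_mx B)) sqn_gt0.
apply: contra u0; rewrite /graph_mx mul_mx_row mulmx1 => /eqP h.
by rewrite -[u](row_mxKl _ (u *m B^T)) h; apply/eqP/rowP => i; rewrite !mxE.
Qed.

Lemma graph_jac_gram B P : graph_mx B *m (graph_mx B)^T = P *m P^T ->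
  graph_jac B = `|\det P|.
Proof. by move=> PE; rewrite /graph_jac PE det_mulmx det_tr -expr2 sqrtr_sqr. Qed.

Lemma graph_jac_gt0 B : 0 < graph_jac B.
Proof.
have [[P PE] _] := posdef_cholesky (posdef_gram_graph B).
by rewrite (graph_jac_gram PE) normr_gt0 (posdef_det_neq0 (posdef_gram_graph B) PE).
Qed.

Lemma measurable_graph_jac : measurable_fun setT
  (fun v : 'rV[R]_(k * s) => graph_jac (mx_of_rV v)).
Proof.
have ms : measurable_fun setT (@Num.sqrt R).
  by apply: continuous_measurable_fun; exact: sqrt_continuous.
apply: (measurableT_comp ms); apply: measurable_mx_det; apply: measurable_mx_mul.
  by apply: measurable_graph_mx; exact: measurable_mx_of_rV.
by apply: measurable_mx_tr; apply: measurable_graph_mx; exact: measurable_mx_of_rV.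
Qed.

Lemma measurable_graph_jacV : measurable_fun setT
  (fun v : 'rV[R]_(k * s) => (graph_jac (mx_of_rV v))^-1).
Proof.
under eq_fun => v.
  rewrite -[graph_jac _]lnK ?posrE ?graph_jac_gt0// -expRN.
  over.
have ml := measurableT_comp (@measurable_ln R) measurable_graph_jac.
exact: (measurableT_comp (@measurable_expR R) (measurable_funN ml)).
Qed.

Lemma c1_le1 : c1 <= 1 :> R.
Proof.
rewrite /c1 ler_pdivrMr// mul1r (@le_trans _ _ 1)//; last by rewrite ler1n.
rewrite -[leRHS]sqrtr1 ler_wsqrtr// /kappa0 ler_pdivrMr ?expR_gt0// mul1r.
have h1 : expR (- 4) <= 1 :> R by rewrite -[leRHS]expR0 ler_expR; lra.
have h2 : 1 <= expR 1 :> R by rewrite -[leLHS]expR0 ler_expR.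
apply: le_trans h2; apply: le_trans h1; rewrite ler_pdivrMr ?pi_gt0//.
by rewrite ler_peMr ?expR_ge0//; have := @pi_ge2 R; lra.
Qed.

(** For p = sqrt pi^s, V the truncated mass and (2 r)^s the determinant bound. Replacing V by p / 2
    and dropping one factor p >= 1 costs 2^(s + k + 1); with the 2^s on the left this is at most
    16^(s k), with equality for s = k = 1. The powers of c compare because c <= 1 and k + 1 <= 2
    k. *)
Lemma graph_jac_constant (c p r V : R) : 0 < c -> c <= 1 -> 1 <= p -> 0 < r ->
  p / 2 <= V ->
  (2 * r) ^+ s * p ^+ (s + k) <=
  ((c * r) ^+ s * V) ^+ k.+1 * V ^+ s * ((16 / c ^+ 2) ^+ (s * k) / r ^+ (s * k)).
Proof.
move=> c0 c1' p1 r0 pV.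
have p0 : 0 < p by lra.
have V0 : 0 < V by lra.
have -> : ((c * r) ^+ s * V) ^+ k.+1 * V ^+ s =
    c ^+ (s * k.+1) * r ^+ (s * k.+1) * V ^+ (s + k).+1.
  rewrite (exprMn k.+1 ((c * r) ^+ s) V) -[_ ^+ s ^+ k.+1]exprM.
  by rewrite (exprMn (s * k.+1) c r) -[LHS]mulrA -[V ^+ k.+1 * V ^+ s]exprD addSn [(k + s)%N]addnC.
have cE : (16 / c ^+ 2) ^+ (s * k) = 16 ^+ (s * k) * (c ^+ (2 * (s * k)))^-1.
  by rewrite expr_div_n -exprM.
have rE : r ^+ (s * k.+1) = r ^+ s * r ^+ (s * k) by rewrite mulnS exprD.
have hc : 1 <= c ^+ (s * k.+1) / c ^+ (2 * (s * k)).
  rewrite ler_pdivlMr ?exprn_gt0// mul1r ler_wiXn2l ?(ltW c0)//.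
  by rewrite mulnCA leq_mul2l mul2n -addnn -addn1 leq_add2l k0 orbT.
have hV : p ^+ (s + k) / 2 ^+ (s + k).+1 <= V ^+ (s + k).+1.
  apply: (@le_trans _ _ ((p / 2) ^+ (s + k).+1)).
    rewrite expr_div_n ler_pM2r ?invr_gt0 ?exprn_gt0//.
    by rewrite ler_weXn2l.
  by rewrite lerXn2r// ?nnegrE ?(ltW V0)// divr_ge0// ltW.
have h2 : 2 ^+ s * 2 ^+ (s + k).+1 <= 16 ^+ (s * k) :> R.
  rewrite (_ : 16 = 2 ^+ 4 :> R); last by rewrite -natrX.
  rewrite -exprD -exprM ler_weXn2l ?ler1n//.
  move: s0 k0; case: (s) => // s'; case: (k) => // k' _ _.
  by rewrite !(mulSn, mulnS, addSn, addnS); lia.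
have r0' : r ^+ (s * k) != 0 by rewrite expf_neq0// gt_eqF.
have -> : c ^+ (s * k.+1) * r ^+ (s * k.+1) * V ^+ (s + k).+1 *
    ((16 / c ^+ 2) ^+ (s * k) / r ^+ (s * k)) =
  r ^+ s * ((c ^+ (s * k.+1) / c ^+ (2 * (s * k))) *
     (V ^+ (s + k).+1 * 16 ^+ (s * k))).
  by rewrite cE rE; field; rewrite r0' expf_neq0// gt_eqF.
have -> : (2 * r) ^+ s * p ^+ (s + k) = r ^+ s * (2 ^+ s * p ^+ (s + k)).
  by rewrite (exprMn s 2 r); ring.
rewrite ler_pM2l ?exprn_gt0//.
rewrite -[leLHS]mul1r; apply: ler_pM => //.
  by rewrite mulr_ge0// exprn_ge0// ltW.
apply: (@le_trans _ _ (p ^+ (s + k) / 2 ^+ (s + k).+1 * (2 ^+ s * 2 ^+ (s + k).+1))).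
  by rewrite le_eqVlt; apply/orP; left; apply/eqP; field; rewrite expf_neq0.
apply: ler_pM => //; first by rewrite divr_ge0 ?exprn_ge0// ltW.
Qed.

Local Open Scope ereal_scope.

(** When G G^T = P P^T, the rows of Y G and of Y P have the same lengths. Taking Y P as the new
    variable gives |det P|^-s from the substitution and |det P|^-k from the power of the
    determinant, and |det P| is the Jacobian. *)
Lemma integral_graph_kernel_gauss B :
  integral_mx (fun Y => graph_kernel (fun x => (expR (- sqn x))%:E) Y B) =
  ((graph_jac B)^-1 ^+ (s + k))%:E * integral_mx
    (fun Y : 'M[R]_s => ((\prod_i expR (- sqn (row i Y))) * `|\det Y| ^+ k)%R%:E).
Proof.
have [[P PE] _] := posdef_cholesky (posdef_gram_graph B).
have P0 := posdef_det_neq0 (posdef_gram_graph B) PE.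
rewrite (graph_jac_gram PE).
have detP : (0 < `|\det P|)%R by rewrite normr_gt0.
pose F (Y : 'M[R]_s) : R := ((\prod_i expR (- sqn (row i Y))) * `|\det Y| ^+ k)%R.
have F0 Y : (0 <= F Y)%R.
  by rewrite mulr_ge0 ?exprn_ge0// prodr_ge0// => i _; exact: expR_ge0.
have mF d (T : measurableType d) (h : T -> 'M[R]_s) : measurable_mx h ->
    measurable_fun setT (fun t => F (h t)).
  move=> mh; apply: measurable_funM.
    apply: measurable_prod => i _; apply: measurable_gauss.
    exact: measurable_mx_row.
  by apply: measurable_funX; apply: measurableT_comp => //;
     exact: measurable_mx_det.
have mFx : measurable_fun_mx (fun Y => (F Y)%:E).
  by apply/(measurable_EFinP _ (fun v => F (mx_of_rV v))); apply: mF; exact: measurable_mx_of_rV.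
have F0E Y : 0 <= (F Y)%:E by rewrite lee_fin.
have mFP : measurable_fun setT (fun v : 'rV[R]_(s * s) => F (mx_of_rV v *m P)%R).
  apply: mF; apply: measurable_mx_mul; last exact: measurable_mx_cst.
  exact: measurable_mx_of_rV.
have c0 : (0 <= `|\det P|^-1 ^+ (s + k) * `|\det P| ^+ s)%R.
  by rewrite mulr_ge0 ?exprn_ge0// invr_ge0.
rewrite -/F -(integral_mx_mulr P0 mFx F0E) muleA -EFinM /integral_mx.
rewrite -(ge0_integralZ_EFin _ mFP (fun=> F0 _) c0).
apply: eq_integral => v _; rewrite /F /graph_kernel prodEFin -EFinM; congr (_%:E).
rewrite det_mulmx normrM (exprMn k).
have -> : (\prod_i expR (- sqn (row i (mx_of_rV v *m graph_mx B))) =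
           \prod_i expR (- sqn (row i (mx_of_rV v *m P))))%R.
  apply: eq_bigr => i _; congr (expR (- _)); rewrite !row_mul /sqn !trmx_mul.
  by rewrite !mulmxA -[(_ *m graph_mx B *m _)%R]mulmxA PE !mulmxA.
rewrite exprD exprVn exprVn; field.
by rewrite !expf_neq0// gt_eqF.
Qed.

(* Comparing the total Gaussian mass of (R^(s+k))^s in the two sets of
   coordinates bounds the mass of the invariant measure on the Grassmannian. *)
Lemma integral_graph_jac :
  integral_mx (fun B => ((graph_jac B)^-1 ^+ (s + k))%:E) <=
  (((16 / c1 ^+ 2) ^+ (s * k)) / Num.sqrt s%:R ^+ (s * k))%:E.
Proof.
have mphi : measurable_fun setT
    (fun x : 'rV[R]_(s + k) => (expR (- sqn x))%:E : \bar R).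
  by apply/measurable_EFinP; exact: measurable_gauss.
have phi0 (x : 'rV[R]_(s + k)) : 0 <= (expR (- sqn x))%:E by rewrite lee_fin expR_ge0.
have := prod_integral_graph mphi phi0 s0 k0.
rewrite integral_gauss prodEFin prodr_const card_ord.
pose F (Y : 'M[R]_s) : R := ((\prod_i expR (- sqn (row i Y))) * `|\det Y| ^+ k)%R.
rewrite (eq_integral_mx integral_graph_kernel_gauss) -/F.
set G := integral_mx (fun Y => (F Y)%:E).
have F0 Y : (0 <= F Y)%R.
  by rewrite mulr_ge0 ?exprn_ge0// prodr_ge0// => i _; exact: expR_ge0.
have G0 : 0 <= G by apply: integral_mx_ge0 => Y; rewrite lee_fin.
have mJ : measurable_fun setT (fun v : 'rV[R]_(k * s) =>
    ((graph_jac (mx_of_rV v))^-1 ^+ (s + k))%R).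
  by apply: measurable_funX; exact: measurable_graph_jacV.
have J0 B : (0 <= (graph_jac B)^-1 ^+ (s + k))%R.
  by rewrite exprn_ge0// invr_ge0 ltW// graph_jac_gt0.
have mJE : measurable_fun setT (fun v : 'rV[R]_(k * s) =>
    ((graph_jac (mx_of_rV v))^-1 ^+ (s + k))%:E : \bar R).
  exact/measurable_EFinP.
rewrite {1}/integral_mx (ge0_integralZr _ measurableT mJE) => [|v _|//]; last first.
  by rewrite lee_fin.
rewrite -/(integral_mx (fun B => ((graph_jac B)^-1 ^+ (s + k))%:E)).
set C0 := integral_mx (fun B => _) => GE.
have C0_ge0 : 0 <= C0 by apply: integral_mx_ge0 => B; rewrite lee_fin.
have [V pV VE] := @integral_trunc_gauss R s s0.
have V0 : (0 < V)%R.
  by apply: lt_le_trans pV; rewrite divr_gt0// exprn_gt0// sqrtr_gt0 pi_gt0.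
(* The moment lemma treats the exponent [k.+1], hence [k.-1] here. The truncated density is below
   the Gaussian, so its moment bounds G from below. *)
have := det_abs_moment measurable_trunc_gauss trunc_gauss01
  (@trunc_gauss_supp _ _ s0) VE V0 s0 k.-1 (@trunc_gauss_det R s).
rewrite (prednK k0); set a := (_ * V ^+ s)%R; set D := (_ ^+ s)%R => aD.
have sr0 : (0 < Num.sqrt s%:R :> R)%R by rewrite sqrtr_gt0 ltr0n.
have a0 : (0 < a)%R.
  by rewrite mulr_gt0 ?exprn_gt0// mulr_gt0// exprn_gt0// mulr_gt0// c1_gt0.
have D0 : (0 <= D)%R by rewrite exprn_ge0// mulr_ge0// ltW.
have mdec := @measurable_mx_of_rV R s s.
have mdet : measurable_fun setT (fun v : 'rV[R]_(s * s) => `|\det (mx_of_rV v)| ^+ k)%R.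
  by apply: measurable_funX; apply: measurableT_comp => //; exact: measurable_mx_det.
have GD : a%:E <= D%:E * G.
  apply: le_trans aD _; apply: lee_wpmul2l; first by rewrite lee_fin.
  apply: ge0_le_integral_EFin => [| |v|v].
  - apply: measurable_funM => //; apply: measurable_prod => i _.
    by apply: (measurableT_comp measurable_trunc_gauss); exact: measurable_mx_row.
  - apply: measurable_funM => //; apply: measurable_prod => i _.
    by apply: measurable_gauss; exact: measurable_mx_row.
  - rewrite mulr_ge0 ?exprn_ge0// prodr_ge0// => i _.
    by have /andP[] := trunc_gauss01 (row i (mx_of_rV v)).
  - rewrite ler_wpM2r ?exprn_ge0//; apply: ler_prod => i _.
    have /andP[-> _] := trunc_gauss01 (row i (mx_of_rV v)).
    exact: trunc_gauss_le.
have aC : a%:E * C0 <= (D * (Num.sqrt pi ^+ (s + k)) ^+ s)%:E.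
  rewrite [X in _ <= X]EFinM GE [C0 * G]muleC muleA; exact: lee_wpmul2r.
rewrite -(@lee_pmul2l _ a%:E)//.
apply: le_trans aC _; rewrite -EFinM lee_fin.
have p1 : (1 <= Num.sqrt pi ^+ s :> R)%R.
  rewrite exprn_ege1// -[leLHS]sqrtr1 ler_wsqrtr//.
  by have := @pi_ge2 R; lra.
rewrite [((_ ^+ (s + k)) ^+ s)%R]exprAC.
exact: graph_jac_constant c1_gt0 c1_le1 p1 sr0 pV.
Qed.

End jacobian.

(** * Determinants of points of a convex set *)

Section convexity.
Context {R : realType} {n : nat}.
Implicit Types (K : set 'rV[R]_n).

Definition convex_comb K := forall x y t, 0 <= t -> t <= 1 ->
  K x -> K y -> K (t *: x + (1 - t) *: y).

Lemma convex_set_comb K : convex_set K -> convex_comb K.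
Proof.
move=> cK x y t t0 t1 Kx Ky.
have := cK x y (Itv01 t0 t1) (mem_set Kx) (mem_set Ky).
by rewrite inE.
Qed.

Lemma convex_mean K m (z : 'I_m.+1 -> 'rV[R]_n) : convex_comb K ->
  (forall i, K (z i)) -> K (m.+1%:R^-1 *: \sum_i z i).
Proof.
move=> cK; elim: m z => [|m IH] z Kz.
  by rewrite big_ord1 invr1 scale1r; exact: Kz.
rewrite big_ord_recl.
have := cK _ _ (m.+2%:R^-1) _ _ (Kz ord0) (IH (fun i => z (lift ord0 i)) (fun i => Kz _)).
have m0 : m.+1%:R != 0 :> R by rewrite pnatr_eq0.
have m2 : m.+2%:R != 0 :> R by rewrite pnatr_eq0.
rewrite scalerA (_ : (1 - m.+2%:R^-1) / m.+1%:R = m.+2%:R^-1 :> R); last first.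
  move: m0 m2; rewrite -[m.+2%:R]natr1; move: (m.+1%:R : R) => a a0 a1.
  by field; rewrite a0 a1.
rewrite -scalerDr; apply; first by rewrite invr_ge0.
by rewrite invf_le1 ?ltr0n// ler1n.
Qed.

End convexity.

Section convex_section.
Context {R : realType} {s : nat}.
Local Notation lam n := (@lebesgue_rV R n).
Variables (L : set 'rV[R]_s) (v rho : R).
Hypotheses (mL : measurable L) (cL : convex_comb L) (L0 : L 0).
Hypotheses (vE : lam s L = v%:E) (s0 : (0 < s)%N).
Hypothesis Lrho : forall x i, L x -> `|x ord0 i| <= rho.

Let v0 : 0 <= v.
Proof. by rewrite -lee_fin -vE measure_ge0. Qed.

(** u Y is the mean of the s points s u_i y_i, each on the segment from 0 to y_i. The cube
    [0, 1/s]^s is preferred to the simplex because its volume is a plain product. *)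
Lemma mulmx_box_convex (Y : 'M[R]_s) (u : 'rV[R]_s) :
  (forall i, L (row i Y)) -> (forall i, 0 <= u ord0 i <= s%:R^-1) -> L (u *m Y).
Proof.
move=> LY hu; have sn0 : s%:R != 0 :> R by rewrite pnatr_eq0 -lt0n.
have hz i : L ((s%:R * u ord0 i) *: row i Y).
  have /andP[u0 u1] := hu i.
  have := cL (_ : 0 <= s%:R * u ord0 i) _ (LY i) L0.
  rewrite scaler0 addr0; apply; first by rewrite mulr_ge0.
  by rewrite mulrC -ler_pdivlMr ?div1r// ltr0n.
have := @convex_mean R s L s.-1.
move: hz; rewrite /= (prednK s0) => hz /(_ (fun i => (s%:R * u ord0 i) *: row i Y) cL hz).
rewrite scaler_sumr mulmx_sum_row; congr (L _); apply: eq_bigr => i _.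
by rewrite scalerA mulrA mulVf// mul1r.
Qed.

(* L contains the image under Y of the cube [0, 1/s]^s, of volume |det Y| / s^s. *)
Lemma det_le_convex (Y : 'M[R]_s) : (forall i, L (row i Y)) ->
  `|\det Y| <= s%:R ^+ s * v.
Proof.
move=> LY; have [->|detY] := eqVneq (\det Y) 0.
  by rewrite normr0 mulr_ge0// exprn_ge0.
pose I : set (measurableTypeR R) := `[0, s%:R^-1]%classic.
have mI : measurable I by exact: measurable_itv.
pose C := [set u : 'rV[R]_s | forall i, I (u ord0 i)].
have mC : measurable C.
  rewrite [X in measurable X](_ : _ = \big[setI/setT]_(i < s)
      ((fun x : 'rV[R]_s => x ord0 i) @^-1` I)).
    apply: bigsetI_measurable => i _.
    rewrite -[X in measurable X]setTI; exact: (measurable_coord i).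
  rewrite -bigcap_seq; apply/seteqP; split => t /= h i.
    by move=> _; exact: h.
  by apply: h; rewrite /= mem_index_enum.
have CE : lam s C = (s%:R^-1 ^+ s)%:E.
  rewrite (lebesgue_rV_box (A := fun=> I))//.
  have -> : @lebesgue_measure R I = (s%:R^-1)%:E.
    rewrite /I lebesgue_measure_itv/= lte_fin invr_gt0 ltr0n s0.
    by rewrite -EFinB subr0.
  by rewrite prodEFin prodr_const card_ord.
have m1 : measurable_fun setT (fun x : 'rV[R]_s => (\1_L x)%:E : \bar R).
  exact/measurable_EFinP/measurable_indic.
have h1 (x : 'rV[R]_s) : (0 <= (\1_L x)%:E :> \bar R)%E by rewrite lee_fin.
have iL : (\int[lam s]_x (\1_L x)%:E = v%:E)%E by rewrite integral_indic// setIT.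
have iC : (\int[lam s]_x (\1_C x)%:E = (s%:R^-1 ^+ s)%:E)%E.
  by rewrite integral_indic// setIT.
have vY := dilatesP detY m1 h1; rewrite iL in vY.
have : (\int[lam s]_u (\1_C u)%:E <= \int[lam s]_u (\1_L (u *m Y))%:E)%E.
  apply: ge0_le_integral_EFin => // [|u].
    by apply: (measurableT_comp (measurable_indic mL)); exact: measurable_mulmxr.
  rewrite !indicE; have [uC|] := boolP (u \in C); last by rewrite ler0n.
  rewrite mem_set//; apply: mulmx_box_convex => // i.
  by move: uC; rewrite inE => /(_ i); rewrite /I /= in_itv.
rewrite iC => h.
have := lee_wpmul2l (_ : (0 <= `|\det Y|%:E)%E) h.
rewrite vY lee_fin => /(_ (normr_ge0 _)).
rewrite -EFinM lee_fin exprVn ler_pdivrMr ?exprn_gt0 ?ltr0n//.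
by rewrite mulrC.
Qed.

(** [det_abs_moment] for the indicator of L with D = s^s v. Both sides then carry a factor v, which
    is cancelled; hence the separate case v = 0. *)
Lemma volume_pow_le k : (0 < k)%N ->
  ((v ^+ (s + k) * (c1 * Num.sqrt s%:R) ^+ (s * k.+1))%:E <=
   (s%:R ^+ s)%:E * integral_mx
     (fun Y => ((\prod_i \1_L (row i Y)) * `|\det Y| ^+ k)%:E))%E.
Proof.
move=> k0; have [v00|vn0] := eqVneq v 0.
  rewrite v00 expr0n addn_eq0 (gtn_eqF s0)/= mul0r.
  apply: mule_ge0; first by rewrite lee_fin exprn_ge0.
  apply: integral_mx_ge0 => Y; rewrite lee_fin mulr_ge0 ?exprn_ge0//.
  by rewrite prodr_ge0.
have vgt0 : 0 < v by rewrite lt_neqAle eq_sym vn0.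
have m1 : measurable_fun setT (\1_L : 'rV[R]_s -> R) by exact: measurable_indic.
have h01 (x : 'rV[R]_s) : 0 <= (\1_L x : R) <= 1.
  by rewrite indicE ler0n lern1 leq_b1.
have hs (x : 'rV[R]_s) i : (\1_L x : R) != 0 -> `|x ord0 i| <= rho.
  rewrite indicE; have [xL _|] := boolP (x \in L); last by rewrite eqxx.
  by apply: Lrho; rewrite inE in xL.
have hV : (\int[lam s]_x (\1_L x)%:E = v%:E)%E by rewrite integral_indic// setIT.
have hD (Y : 'M[R]_s) : (forall i, (\1_L (row i Y) : R) != 0) -> `|\det Y| <= s%:R ^+ s * v.
  move=> hY; apply: det_le_convex => i; have := hY i.
  rewrite indicE; have [xL _|] := boolP (_ \in L); last by rewrite eqxx.
  by rewrite inE in xL.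
have := det_abs_moment m1 h01 hs hV vgt0 s0 k.-1 hD.
rewrite (prednK k0) => h.
rewrite -(@lee_pmul2l _ v%:E)// muleA -[(v%:E * (s%:R ^+ s)%:E)%E]EFinM [(v * s%:R ^+ s)%R]mulrC.
apply: le_trans h; rewrite -EFinM lee_fin le_eqVlt; apply/orP; left; apply/eqP.
rewrite (exprMn k.+1) -[_ ^+ s ^+ k.+1]exprM exprD exprS; ring.
Qed.

End convex_section.

(** * Graphs as subspaces and the measure of their sections *)

Section span_graph.
Context {R : realType} {s k : nat}.
Hypothesis s0 : (0 < s)%N.
Local Notation lam n := (@lebesgue_rV R n).
Implicit Types B : 'M[R]_(k, s).

Definition graph_space B : {vspace 'rV[R]_(s + k)} :=
  limg (linfun (mulmxr (graph_mx B))).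

Lemma lsubmx_graph B (y : 'rV[R]_s) : lsubmx (y *m graph_mx B) = y.
Proof. by rewrite /graph_mx mul_mx_row mulmx1 row_mxKl. Qed.

Lemma mem_graph_space B x :
  (x \in graph_space B) = (x == lsubmx x *m graph_mx B).
Proof.
apply/memv_imgP/eqP => [[y _]|xE].
  by rewrite lfunE/= => ->; rewrite lsubmx_graph.
by exists (lsubmx x); rewrite ?memvf// lfunE/=.
Qed.

Lemma dim_graph_space B : \dim (graph_space B) = s.
Proof.
rewrite limg_dim_eq ?dimvf /dim/= ?mul1n// capfv.
apply/eqP/lker0P => y z; rewrite !lfunE/= => yz.
by rewrite -(lsubmx_graph B y) yz lsubmx_graph.
Qed.

Lemma measurable_graph_space B : measurable [set` graph_space B].
Proof.
rewrite [X in measurable X](_ : _ = \big[setI/setT]_(i < s + k)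
    [set x : 'rV[R]_(s + k) | x ord0 i == (lsubmx x *m graph_mx B) ord0 i]).
  apply: bigsetI_measurable => i _.
  have mi : measurable_fun setT (fun x : 'rV[R]_(s + k) =>
      x ord0 i == (lsubmx x *m graph_mx B) ord0 i).
    apply: measurable_fun_eqr; first exact: measurable_coord.
    apply: (measurableT_comp (measurable_coord i)).
    apply: measurable_mulmx_fun; apply/measurable_fun_rVP => j.
    by under eq_fun do rewrite mxE; exact: measurable_coord.
  by have := mi measurableT [set true] I; rewrite setTI.
rewrite -bigcap_seq; apply/seteqP; split => x /=.
  by rewrite mem_graph_space => /eqP xE i _ /=; rewrite {1}xE.
move=> h; rewrite mem_graph_space; apply/eqP/rowP => i.
by apply/eqP; apply: (h i); rewrite /= mem_index_enum.
Qed.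

Local Open Scope ereal_scope.

(** Orthonormality of the rows of P G gives (det P)^2 J^2 = 1, so the substitution by P has factor
    J. The number d of rows is kept apart from s because a frame has [\dim F] rows, equal to s by
    proof and not by computation. *)
Lemma integral_orthonormal_graph B d (P : 'M[R]_(d, s)) (psi : 'rV[R]_(s + k) -> \bar R) :
  d = s -> ((P *m graph_mx B) *m (P *m graph_mx B)^T = 1%:M)%R ->
  measurable_fun setT psi -> (forall x, 0 <= psi x) ->
  \int[lam d]_w psi (w *m (P *m graph_mx B))%R =
  (graph_jac B)%:E * \int[lam s]_y psi (y *m graph_mx B)%R.
Proof.
move=> ds; subst d => PP mpsi psi0.
have := congr1 determinant PP.
rewrite trmx_mul mulmxA -[(P *m _ *m _)%R]mulmxA !det_mulmx det_tr det1.
rewrite mulrAC -expr2 => dP.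
have detP : \det P != 0%R.
  by apply: contra_eq_neq dP => ->; rewrite expr0n/= mul0r eq_sym oner_eq0.
have jP : graph_jac B = (`|\det P|^-1)%R.
  apply/eqP; rewrite -(@eqrXn2 _ 2)// ?invr_ge0 ?(ltW (graph_jac_gt0 _))//.
  rewrite /graph_jac sqr_sqrtr; last first.
    rewrite ltW//; have := graph_jac_gt0 B; rewrite /graph_jac sqrtr_gt0//.
  rewrite exprVn real_normK ?num_real//; apply/eqP.
  apply: (@mulfI _ ((\det P) ^+ 2)); first by rewrite expf_neq0.
  by rewrite mulfV ?expf_neq0// -[RHS]dP.
have mF : measurable_fun setT (fun y : 'rV[R]_s => psi (y *m graph_mx B)%R).
  exact: measurable_fun_comp_mulmx.
under eq_integral do rewrite mulmxA.
rewrite -(dilatesP detP mF (fun=> psi0 _)) jP muleA -EFinM mulVf ?mul1e//.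
by rewrite normr_eq0.
Qed.

Lemma mu_section_graph B (g : 'rV[R]_(s + k) -> R) K : measurable K ->
  measurable_fun setT g -> (forall x, (0 <= g x)%R) ->
  mu_section g (graph_space B) K =
  (graph_jac B)%:E * \int[lam s]_y (g (y *m graph_mx B)%R * \1_K (y *m graph_mx B)%R)%:E.
Proof.
move=> mK mg g0; set F := graph_space B.
have [FF rF] := frameP F.
pose P : 'M[R]_(\dim F, s) := \matrix_i lsubmx (row i (frame F)).
(* A vector of the graph is determined by its first s coordinates, so the frame factors through
   [graph_mx B]. *)
have PE : frame F = (P *m graph_mx B)%R.
  apply/row_matrixP => i; rewrite row_mul rowK.
  by have := rF i; rewrite mem_graph_space => /eqP.
rewrite /mu_section /lebesgue_on.
have mD : measurable (K `&` [set` F]).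
  by apply: measurableI => //; exact: measurable_graph_space.
rewrite (ge0_integral_pushforward (measurable_mulmxr (frame F)))//; last 2 first.
- by apply: measurable_funTS; exact/measurable_EFinP.
- by move=> x _; rewrite lee_fin.
rewrite integral_mkcond.
rewrite -(@integral_orthonormal_graph B _ P (fun x => (g x * \1_K x)%:E)); last 4 first.
- exact: dim_graph_space.
- by rewrite -PE.
- apply/measurable_EFinP; apply: measurable_funM => //; exact: measurable_indic.
- by move=> x; rewrite lee_fin mulr_ge0.
apply: eq_integral => w _; rewrite -PE patchE /= indicE.
have -> : (w \in (fun x => (x *m frame F)%R) @^-1` (K `&` [set` F])) =
          ((w *m frame F)%R \in K).
  apply/idP/idP; rewrite !inE /=; first by case.
  move=> Kw; split => //.
  rewrite PE mulmxA; apply/memv_imgP; exists (w *m P)%R; first exact: memvf.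
  by rewrite lfunE.
by case: ifP; rewrite ?mulr1 ?mulr0.
Qed.

End span_graph.

(** * Sections of a convex body by graphs *)

Section borel_density.
Context {R : realType} {s k : nat}.
Hypotheses (s0 : (0 < s)%N) (k0 : (0 < k)%N).
Local Notation lam n := (@lebesgue_rV R n).
Implicit Types B : 'M[R]_(k, s).
Variables (K : set 'rV[R]_(s + k)) (rho : R).
Hypotheses (mK : measurable K) (cK : convex_comb K) (K0 : K 0).
Hypothesis Krho : forall x i, K x -> `|x ord0 i| <= rho.

(** As [graph_mx B] begins with an identity block, this is the projection to R^s of the section of K
    by the graph. *)
Definition graph_section B : set 'rV[R]_s := [set y | K (y *m graph_mx B)].

Lemma measurable_graph_section B : measurable (graph_section B).
Proof.
have := measurable_mulmxr (graph_mx B) measurableT mK.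
by rewrite setTI.
Qed.

Lemma convex_graph_section B : convex_comb (graph_section B).
Proof.
move=> x y t t0 t1 Kx Ky; rewrite /graph_section /= mulmxDl -!scalemxAl.
exact: cK.
Qed.

Lemma graph_section0 B : graph_section B 0.
Proof. by rewrite /graph_section /= mul0mx. Qed.

Lemma graph_section_bounded B x i : graph_section B x -> `|x ord0 i| <= rho.
Proof.
move=> /Krho => /(_ (lshift k i)).
by rewrite -[in X in X -> _](row_mxKl x (x *m B^T)) /graph_mx mul_mx_row mulmx1 row_mxEl row_mxKl.
Qed.

Definition section_vol B : R := fine (lam s (graph_section B)).

Lemma section_volE B : lam s (graph_section B) = (section_vol B)%:E.
Proof.
rewrite /section_vol fineK// ge0_fin_numE ?measure_ge0//.
have [M _ ME] := @lebesgue_cube R s rho.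
apply: (@le_lt_trans _ _ (lam s (cube rho))); last by rewrite ME ltry.
apply: le_measure; rewrite ?inE; [exact: measurable_graph_section|exact: measurable_cube|].
by move=> x /graph_section_bounded h i; rewrite /= in_itv/= -ler_norml.
Qed.

Lemma section_vol_ge0 B : 0 <= section_vol B.
Proof. by rewrite -lee_fin -section_volE measure_ge0. Qed.

Lemma measurable_section_vol :
  measurable_fun setT (fun v : 'rV[R]_(k * s) => section_vol (mx_of_rV v)).
Proof.
apply/measurable_EFinP.
have -> : EFin \o (fun v : 'rV[R]_(k * s) => section_vol (mx_of_rV v)) =
   fun v => (\int[lam s]_y (\1_K (y *m graph_mx (mx_of_rV v)))%:E)%E.
  apply/funext => v; rewrite /= -section_volE.
  transitivity (\int[lam s]_y (\1_(graph_section (mx_of_rV v)) y)%:E)%E.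
    by rewrite integral_indic ?setIT//; exact: measurable_graph_section.
  apply: eq_integral => y _; rewrite !indicE.
  suff -> : (y \in graph_section (mx_of_rV v)) = (y *m graph_mx (mx_of_rV v) \in K) by [].
  by apply/idP/idP; rewrite !inE.
apply: (@measurable_fun_fubini_tonelli_F _ _ _ _ _ (lam s)
  (fun p : 'rV[R]_(k * s) * 'rV[R]_s =>
    (\1_K (p.2 *m graph_mx (mx_of_rV p.1)))%:E)) => [|p]; last by rewrite lee_fin.
apply/measurable_EFinP; apply: (measurableT_comp (measurable_indic mK)).
apply/measurable_fun_rVP => i.
apply: (measurable_mx_mul (f := fun p : 'rV[R]_(k * s) * 'rV[R]_s => p.2)
  (g := fun p => graph_mx (mx_of_rV p.1))).
  by apply: measurable_mx_rV; exact: measurable_snd.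
by apply: measurable_graph_mx; exact: measurable_mx_fst.
Qed.

Local Open Scope ereal_scope.

Variables (vK : R).
Hypothesis vKE : lam (s + k) K = vK%:E.

(** For each B, [volume_pow_le] bounds the left integrand by s^s times the integral over Y of the
    kernel of the indicator of K; over all B these kernels integrate to |K|^s. *)
Lemma integral_section_vol :
  integral_mx (fun B => (section_vol B ^+ (s + k) * (c1 * Num.sqrt s%:R) ^+ (s * k.+1))%:E)
  <= (s%:R ^+ s * vK ^+ s)%:E.
Proof.
have m1 : measurable_fun setT (fun x : 'rV[R]_(s + k) => (\1_K x)%:E : \bar R).
  exact/measurable_EFinP/measurable_indic.
have h1 (x : 'rV[R]_(s + k)) : 0 <= (\1_K x)%:E :> \bar R by rewrite lee_fin.
have iK : \int[lam (s + k)]_x (\1_K x)%:E = vK%:E by rewrite integral_indic// setIT.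
have := prod_integral_graph m1 h1 s0 k0.
rewrite iK prodEFin prodr_const card_ord => vE.
have mG : measurable_fun setT (fun v : 'rV[R]_(k * s) =>
    integral_mx (fun Y => graph_kernel (fun x => (\1_K x)%:E) Y (mx_of_rV v))).
  apply: measurable_integral_mx; last by move=> v Y; exact: graph_kernel_ge0.
  by apply: (measurable_graph_kernel m1); [exact: measurable_mx_snd|exact: measurable_mx_fst].
have G0 (v : 'rV[R]_(k * s)) :
    0 <= integral_mx (fun Y => graph_kernel (fun x => (\1_K x)%:E) Y (mx_of_rV v)).
  by apply: integral_mx_ge0 => Y; exact: graph_kernel_ge0.
have S0 : 0 <= (s%:R ^+ s)%:E :> \bar R by rewrite lee_fin exprn_ge0.
rewrite EFinM vE [X in _ <= _ * X]/integral_mx.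
rewrite -(ge0_integralZl _ measurableT mG (fun v _ => G0 v) S0).
apply: ge0_le_integral => //.
- move=> v _; rewrite lee_fin mulr_ge0 ?exprn_ge0 ?section_vol_ge0//.
  by rewrite mulr_ge0 ?sqrtr_ge0// ltW// c1_gt0.
- apply/measurable_EFinP; apply: measurable_funM => //; apply: measurable_funX.
  exact: measurable_section_vol.
- exact: emeasurable_funM.
move=> v _; set B := mx_of_rV v.
apply: le_trans (volume_pow_le (measurable_graph_section B) (@convex_graph_section B)
  (graph_section0 B) (section_volE B) s0 (@graph_section_bounded B) k0) _.
apply: lee_wpmul2l; first by rewrite lee_fin exprn_ge0.
rewrite le_eqVlt; apply/orP; left; apply/eqP; apply: eq_integral => w _.
rewrite /graph_kernel prodEFin -EFinM; congr ((_ * _)%:E).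
apply: eq_bigr => i _; rewrite !indicE row_mul.
suff -> : (row i (mx_of_rV w) \in graph_section B) =
  ((row i (mx_of_rV w) *m graph_mx B)%R \in K) by [].
by apply/idP/idP; rewrite !inE.
Qed.

Variables (g : 'rV[R]_(s + k) -> R) (M : R).
Hypotheses (mg : measurable_fun setT g) (g0 : forall x, (0 <= g x)%R).
Hypothesis gM : forall B, mu_section g (graph_space B) K <= M%:E.

Let phi x := (g x * \1_K x)%:E.

Let mphi : measurable_fun setT phi.
Proof. by apply/measurable_EFinP; apply: measurable_funM => //; exact: measurable_indic. Qed.

Let phi0 x : 0 <= phi x. Proof. by rewrite lee_fin mulr_ge0. Qed.

Lemma integral_graph_le B :
  \int[lam s]_y phi (y *m graph_mx B)%R <= (M * (graph_jac B)^-1)%:E.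
Proof.
have J0 := graph_jac_gt0 B.
by have := gM B; rewrite (mu_section_graph B mK mg g0) EFinM lee_pdivlMr// muleC.
Qed.

(* Any s points of a section span, with the origin, a simplex inside it. *)
Lemma graph_kernel_le B :
  integral_mx (fun Y => graph_kernel phi Y B) <=
  ((s%:R ^+ s * section_vol B) ^+ k * (M * (graph_jac B)^-1) ^+ s)%:E.
Proof.
have mrow : measurable_fun setT (fun y : 'rV[R]_s => phi (y *m graph_mx B)%R).
  exact: measurable_fun_comp_mulmx.
have D0 : (0 <= s%:R ^+ s * section_vol B)%R by rewrite mulr_ge0 ?exprn_ge0 ?section_vol_ge0.
have E0 : (0 <= (s%:R ^+ s * section_vol B) ^+ k)%R by rewrite exprn_ge0.
have mprod : measurable_fun_mx (fun Y : 'M[R]_s => \prod_(i < s) phi (row i Y *m graph_mx B)%R).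
  exact: (measurable_fun_mx_prod_row (fun=> mrow)).
have prod0 (Y : 'M[R]_s) : 0 <= \prod_(i < s) phi (row i Y *m graph_mx B)%R.
  by apply: prode_ge0 => i _; exact: phi0.
apply: (@le_trans _ _ (integral_mx (fun Y : 'M[R]_s =>
    ((s%:R ^+ s * section_vol B) ^+ k)%:E * \prod_(i < s) phi (row i Y *m graph_mx B)%R))).
  apply: le_integral_mx => [|||Y].
  - by apply: (measurable_graph_kernel mphi); [exact: measurable_mx_of_rV|exact: measurable_mx_cst].
  - by apply: emeasurable_funM => //; exact: measurable_cst.
  - by move=> Y; exact: graph_kernel_ge0.
  rewrite /graph_kernel muleC; under eq_bigr do rewrite row_mul.
  have [/existsP[i /negP Ki]|] := boolP [exists i, row i Y \notin graph_section B].
    have -> : \prod_(i < s) phi (row i Y *m graph_mx B)%R = 0.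
      rewrite (bigD1 i)//= (_ : phi _ = 0) ?mul0e// /phi indicE memNset ?mulr0//.
      by move=> h; apply: Ki; rewrite inE.
    by rewrite !mule0.
  rewrite negb_exists => /forallP KY; apply: lee_wpmul2r => //.
  rewrite lee_fin lerXn2r// ?nnegrE//.
  apply: (det_le_convex (measurable_graph_section B) (@convex_graph_section B)
    (graph_section0 B) (section_volE B) s0) => i.
  by have := KY i; rewrite negbK inE.
rewrite /integral_mx ge0_integralZl//.
rewrite EFinM; apply: lee_wpmul2l; first by rewrite lee_fin.
rewrite -/(integral_mx (fun Y : 'M[R]_s => \prod_(i < s) phi (row i Y *m graph_mx B)%R)).
rewrite -(prod_integral_row (fun=> mrow) (fun _ _ => phi0 _)).
have := integral_graph_le B; set a := \int[_]_y _ => aM.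
have a0 : 0 <= a by exact: integral_ge0.
have afin : a \is a fin_num.
  by rewrite ge0_fin_numE//; apply: le_lt_trans aM _; rewrite ltry.
move: aM a0; rewrite -(fineK afin) !lee_fin => aM a0.
rewrite prodEFin prodr_const card_ord lee_fin lerXn2r// nnegrE//.
exact: le_trans aM.
Qed.

End borel_density.

(** * The bound for Borel densities *)

Section main_bound.
Context {R : realType} {s k : nat}.
Hypotheses (s0 : (0 < s)%N) (k0 : (0 < k)%N).
Local Notation lam n := (@lebesgue_rV R n).

(** If x J <= T, replacing x by T / J gives the first term. Otherwise replacing 1 / J by x / T gives
    the second. *)
Lemma section_split_pointwise (x J T : R) : 0 <= x -> 0 < J -> 0 < T ->
  x ^+ k * J^-1 ^+ s <= T ^+ k * J^-1 ^+ (s + k) + T^-1 ^+ s * x ^+ (s + k).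
Proof.
move=> x0 J0 T0; have J0' := ltW J0; have T0' := ltW T0.
have [h|h] := leP (x * J) T.
  apply: (@le_trans _ _ (T ^+ k * J^-1 ^+ (s + k))); last first.
    by rewrite lerDl mulr_ge0// exprn_ge0// invr_ge0.
  rewrite addnC exprD mulrA ler_wpM2r ?exprn_ge0 ?invr_ge0// -exprMn.
  by rewrite lerXn2r ?nnegrE ?divr_ge0// ler_pdivlMr.
apply: (@le_trans _ _ (T^-1 ^+ s * x ^+ (s + k))); last first.
  by rewrite lerDr mulr_ge0// exprn_ge0// invr_ge0.
rewrite exprD mulrA mulrC ler_wpM2r ?exprn_ge0// -exprMn.
rewrite lerXn2r ?nnegrE ?mulr_ge0 ?invr_ge0//.
by rewrite ler_pdivlMl// ler_pdivrMr// ltW.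
Qed.

(** 16 / c1^2 is the constant of [integral_graph_jac]. One factor 2 pays for r^k <= 2^(s k), another
    for the sum of the two terms. *)
Definition c5 : R := 64 / c1 ^+ 2.

(** With s = r^2, the second integral is of order r^s / r^(s k) and the first of order 1 / r^(s k).
    T^-s removes the surplus r^s, while T^k adds only r^k to the first. Both terms become kap^(s k)
    / r^(s k) up to constants to the power s k, and s^(s k) in front leaves r^(s k). *)
Lemma main_constant (kap M r T : R) : 0 < kap -> 0 <= M ->
  r = Num.sqrt s%:R -> T = kap ^+ s * r ->
  s%:R ^+ (s * k) * M ^+ s *
    (T ^+ k * ((16 / c1 ^+ 2) ^+ (s * k) / r ^+ (s * k)) +
     T^-1 ^+ s * (s%:R ^+ s * (kap ^+ (s + k)) ^+ s / (c1 * r) ^+ (s * k.+1))) <=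
  ((c5 * r) ^+ k * M * kap ^+ k) ^+ s.
Proof.
move=> kap0 M0 rE TE0.
have r0 : 0 < r by rewrite rE sqrtr_gt0 ltr0n.
have sE : s%:R = r * r by rewrite rE -expr2 sqr_sqrtr.
have cp := @c1_gt0 R.
have r2 : r <= 2 ^+ s.
  apply: (@le_trans _ _ (s%:R)).
    rewrite sE ler_peMl ?(ltW r0)// rE -[X in X <= _]sqrtr1 ler_wsqrtr//.
    by rewrite ler1n.
  by rewrite -natrX ler_nat ltnW// ltn_expl.
pose a : R := c1 ^+ 2; have a0 : 0 < a by rewrite exprn_gt0.
have TE : T ^+ k = kap ^+ (s * k) * r ^+ k by rewrite TE0 exprMn -exprM.
have rne : r != 0 by rewrite gt_eqF.
have kne : kap != 0 by rewrite gt_eqF.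
have cne : c1 != 0 :> R by rewrite gt_eqF.
have A1 : T ^+ k * ((16 / a) ^+ (s * k) / r ^+ (s * k)) <=
    kap ^+ (s * k) * (32 / a) ^+ (s * k) / r ^+ (s * k).
  rewrite TE mulrA ler_pM2r ?invr_gt0 ?exprn_gt0// -mulrA ler_pM2l ?exprn_gt0//.
  rewrite (_ : 32 / a = 2 * (16 / a)); last by field; rewrite gt_eqF.
  rewrite [X in _ <= X]exprMn ler_pM2r ?exprn_gt0 ?divr_gt0// exprM.
  by rewrite lerXn2r// ?nnegrE ?(ltW r0)// exprn_ge0.
have A2 : T^-1 ^+ s * (s%:R ^+ s * (kap ^+ (s + k)) ^+ s / (c1 * r) ^+ (s * k.+1)) <=
    kap ^+ (s * k) * (16 / a) ^+ (s * k) / r ^+ (s * k).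
  have -> : T^-1 ^+ s * (s%:R ^+ s * (kap ^+ (s + k)) ^+ s / (c1 * r) ^+ (s * k.+1)) =
      kap ^+ (s * k) * (c1 ^+ (s * k.+1))^-1 / r ^+ (s * k).
    have e1 : T^-1 ^+ s = (kap ^+ (s * s) * r ^+ s)^-1.
      by rewrite TE0 exprVn (exprMn s (kap ^+ s) r) -exprM.
    have e2 : s%:R ^+ s = r ^+ s * r ^+ s by rewrite sE (exprMn s r r).
    have e3 : (kap ^+ (s + k)) ^+ s = kap ^+ (s * s) * kap ^+ (s * k).
      by rewrite -exprM mulnDl exprD [(k * s)%N]mulnC.
    have e4 : (c1 * r) ^+ (s * k.+1) = c1 ^+ (s * k.+1) * (r ^+ s * r ^+ (s * k)).
      by rewrite (exprMn _ c1 r) -exprD -mulnS.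
    rewrite e1 e2 e3 e4; field.
    by rewrite !expf_neq0.
  rewrite ler_pM2r ?invr_gt0 ?exprn_gt0// ler_pM2l ?exprn_gt0//.
  rewrite [X in _ <= X]expr_div_n -[X in X <= _]mul1r; apply: ler_pM => //.
  - by rewrite invr_ge0 exprn_ge0// ltW.
  - by rewrite exprn_ege1// ler1n.
  rewrite lef_pV2 ?posrE ?exprn_gt0// /a -exprM.
  apply: ler_wiXn2l; [exact: ltW|exact: c1_le1|].
  by rewrite mulnCA leq_mul2l mul2n -addnn -addn1 leq_add2l k0 orbT.
apply: (@le_trans _ _ (s%:R ^+ (s * k) * M ^+ s *
   (kap ^+ (s * k) * (64 / a) ^+ (s * k) / r ^+ (s * k)))).
  apply: ler_wpM2l; first by rewrite mulr_ge0 ?exprn_ge0.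
  apply: (le_trans (lerD A1 A2)).
  rewrite -mulrDl ler_pM2r ?invr_gt0 ?exprn_gt0// -mulrDr ler_pM2l ?exprn_gt0//.
  apply: (@le_trans _ _ (2 * (32 / a) ^+ (s * k))).
    have -> : 2 * (32 / a) ^+ (s * k) = (32 / a) ^+ (s * k) + (32 / a) ^+ (s * k) by ring.
    rewrite lerD2l lerXn2r// ?nnegrE ?divr_ge0 ?(ltW a0)//.
    by rewrite ler_pM2r ?invr_gt0//; rewrite ler_nat.
  rewrite (_ : 64 / a = 2 * (32 / a)); last by field; rewrite gt_eqF.
  rewrite (exprMn (s * k) 2 (32 / a)) ler_pM2r ?exprn_gt0 ?divr_gt0//.
  by rewrite -[X in X <= _]expr1 ler_weXn2l ?ler1n// muln_gt0 s0.
rewrite sE /c5 -/a le_eqVlt; apply/orP; left; apply/eqP.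
have -> : ((64 / a * r) ^+ k * M * kap ^+ k) ^+ s =
    (64 / a) ^+ (s * k) * r ^+ (s * k) * M ^+ s * kap ^+ (s * k).
  rewrite (exprMn s (_ * M)) (exprMn s ((64 / a * r) ^+ k) M) (exprMn k (64 / a) r).
  by rewrite (exprMn s) -!exprM [(k * s)%N]mulnC.
rewrite (exprMn (s * k) r r); field.
by rewrite expf_neq0.
Qed.

Variables (K : set 'rV[R]_(s + k)) (rho kap : R).
Hypotheses (mK : measurable K) (cK : convex_comb K) (K0 : K 0).
Hypothesis Krho : forall x i, K x -> `|x ord0 i| <= rho.
Hypotheses (kap0 : 0 < kap) (vKE : lam (s + k) K = (kap ^+ (s + k))%:E).
Variables (g : 'rV[R]_(s + k) -> R) (M : R).
Hypotheses (mg : measurable_fun setT g) (g0 : forall x, (0 <= g x)%R) (M0 : (0 <= M)%R).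

Local Open Scope ereal_scope.
Hypothesis gM : forall B, mu_section g (graph_space B) K <= M%:E.

(** An s-th root in the extended reals; x = +oo is excluded because its s-fold product is +oo when s
    > 0. *)
Lemma prode_const_le (x : \bar R) (y : R) : 0 <= x -> (0 <= y)%R ->
  \prod_(i < s) x <= (y ^+ s)%:E -> x <= y%:E.
Proof.
move=> x0 y0; case: x x0 => [x| |//] x0.
  rewrite prodEFin prodr_const card_ord !lee_fin => h.
  by rewrite -(@ler_pXn2r _ s)// ?nnegrE// -lee_fin.
have -> : \prod_(i < s) (+oo : \bar R) = +oo; last by rewrite leye_eq.
rewrite -(prednK s0) big_ord_recl.
suff h : forall m, 0 < \prod_(i < m) (+oo : \bar R) by rewrite gt0_mulye.
by elim=> [|m IH]; rewrite ?big_ord0// big_ord_recl mule_gt0.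
Qed.

Lemma mu_density_borel_le :
  mu_density g K <= ((c5 * Num.sqrt s%:R) ^+ k * M * kap ^+ k)%:E.
Proof.
pose phi x := (g x * \1_K x)%:E.
have mphi : measurable_fun setT phi.
  by apply/measurable_EFinP; apply: measurable_funM => //; exact: measurable_indic.
have phi0 x : 0 <= phi x by rewrite lee_fin mulr_ge0.
have -> : mu_density g K = \int[lam (s + k)]_x phi x.
  rewrite /mu_density integral_mkcond; apply: eq_integral => x _.
  by rewrite patchE /phi indicE; case: ifP; rewrite ?mulr1 ?mulr0.
set r := Num.sqrt s%:R; pose T := (kap ^+ s * r)%R.
have r0 : (0 < r)%R by rewrite sqrtr_gt0 ltr0n.
have T0 : (0 < T)%R by rewrite mulr_gt0// exprn_gt0.
have c50 : (0 < c5)%R by rewrite divr_gt0// exprn_gt0// c1_gt0.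
apply: prode_const_le; first exact: integral_ge0.
  rewrite mulr_ge0 ?exprn_ge0 ?(ltW kap0)// mulr_ge0 ?exprn_ge0//.
  by rewrite mulr_ge0 ?(ltW c50) ?(ltW r0).
rewrite (prod_integral_graph mphi phi0 s0 k0).
have mv := measurable_section_vol mK Krho.
have mJ := @measurable_graph_jacV R s k.
have vol0 := section_vol_ge0 mK Krho.
have J0 (B : 'M[R]_(k, s)) : (0 <= (graph_jac B)^-1)%R.
  by rewrite invr_ge0 ltW// graph_jac_gt0.
have mJn m : measurable_fun setT (fun v : 'rV[R]_(k * s) =>
  ((graph_jac (mx_of_rV v))^-1 ^+ m)%R) by exact: measurable_funX.
have mvn m : measurable_fun setT (fun v : 'rV[R]_(k * s) =>
  (section_vol K (mx_of_rV v) ^+ m)%R) by exact: measurable_funX.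
have T0' := ltW T0.
pose cst1 : R := (s%:R ^+ (s * k) * M ^+ s)%R.
have cst10 : (0 <= cst1)%R by rewrite mulr_ge0 ?exprn_ge0.
have Ti0 : (0 <= T^-1 ^+ s)%R by rewrite exprn_ge0// invr_ge0.
apply: (@le_trans _ _ (integral_mx (fun B => (cst1 *
   (T ^+ k * (graph_jac B)^-1 ^+ (s + k) + T^-1 ^+ s * section_vol K B ^+ (s + k)))%:E))).
  apply: ge0_le_integral => // [v _||| v _].
  - by apply: integral_mx_ge0 => Y; exact: graph_kernel_ge0.
  - apply: measurable_integral_mx; last by move=> v Y; exact: graph_kernel_ge0.
    by apply: (measurable_graph_kernel mphi); [exact: measurable_mx_snd|exact: measurable_mx_fst].
  - apply/measurable_EFinP; apply: measurable_funM => //.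
    by apply: measurable_funD; exact: measurable_funM.
    apply: le_trans (graph_kernel_le s0 mK cK K0 Krho mg g0 gM _) _.
  rewrite lee_fin /cst1 (exprMn k) (exprMn s M) -exprM mulrACA ler_wpM2l//.
  by apply: section_split_pointwise => //; exact: graph_jac_gt0.
rewrite /integral_mx ge0_integralZ_EFin//; last 2 first.
- by apply: measurable_funD; exact: measurable_funM.
- by move=> v; rewrite addr_ge0// mulr_ge0// exprn_ge0.
rewrite ge0_integralD_EFin//; last 4 first.
- exact: measurable_funM.
- exact: measurable_funM.
- by move=> v; rewrite mulr_ge0// exprn_ge0.
- by move=> v; rewrite mulr_ge0// exprn_ge0.
rewrite ge0_integralZ_EFin//; last 2 first.
- by move=> v; rewrite exprn_ge0.
- by rewrite exprn_ge0.
rewrite ge0_integralZ_EFin//; last by move=> v; rewrite exprn_ge0.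
pose A : R := ((c1 * r) ^+ (s * k.+1))%R.
have A0 : (0 < A)%R by rewrite exprn_gt0// mulr_gt0// c1_gt0.
have Iv : \int[lam (k * s)]_v (section_vol K (mx_of_rV v) ^+ (s + k))%:E <=
    (s%:R ^+ s * (kap ^+ (s + k)) ^+ s / A)%:E.
  rewrite EFinM lee_pdivlMr//.
  have := integral_section_vol s0 k0 mK cK K0 Krho vKE.
  rewrite /integral_mx; under eq_integral do rewrite mulrC.
  by rewrite ge0_integralZ_EFin// ?(ltW A0)// 1?muleC// => v; rewrite exprn_ge0.
have := @integral_graph_jac R s k s0 k0; rewrite /integral_mx => IJ.
apply: (@le_trans _ _ (cst1%:E * ((T ^+ k)%:E *
    ((16 / c1 ^+ 2) ^+ (s * k) / Num.sqrt s%:R ^+ (s * k))%:E +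
    (T^-1 ^+ s)%:E * (s%:R ^+ s * (kap ^+ (s + k)) ^+ s / A)%:E))).
  apply: lee_wpmul2l; first by rewrite lee_fin.
  by apply: leeD; apply: lee_wpmul2l => //; rewrite lee_fin exprn_ge0.
rewrite lee_fin.
exact: (main_constant kap0 M0 (erefl r) (erefl T)).
Qed.

End main_bound.

(** * Integrals of nonmeasurable functions as suprema *)

Section lower_integral.
Import HBNNSimple.
Context d (T : measurableType d) (R : realType) (mu : {measure set T -> \bar R}).
Local Open Scope ereal_scope.

(* No measurability of [f] and [h]: both integrals are suprema over simple functions. *)
Lemma le_lower_integral_off_null (D N : set T) (f h : T -> \bar R) :
  measurable N -> mu N = 0 -> (forall x, 0 <= f x) -> (forall x, 0 <= h x) ->
  (forall x, D x -> ~ N x -> f x <= h x) ->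
  \int[mu]_(x in D) f x <= \int[mu]_(x in D) h x.
Proof.
move=> mN N0 f0 h0 fh.
rewrite !ge0_integralE//; apply: ge_ereal_sup => _ [p /= pf <-].
have mNc : measurable (~` N) by exact: measurableC.
(* Cut off on N, the simple function p lies below the restriction of h to D and keeps its
   integral. *)
pose q : {nnsfun T >-> R} := mul_nnsfun p (indic_nnsfun R mNc).
apply: le_ereal_sup_tmp; exists (sintegral mu p) => //; exists q => /=.
  move=> x; rewrite [X in X%:E](_ : _ = (p x * \1_(~` N) x)%R)// indicE; have [Nx|Nx] := boolP (x \in ~` N); last first.
    by rewrite mulr0 patchE; case: ifP.
  rewrite mulr1; apply: le_trans (pf x) _; rewrite !patchE.
  case: ifP => // Dx; apply: fh; first exact: set_mem Dx.
  exact: set_mem Nx.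
rewrite -!integralT_nnsfun; apply: ge0_ae_eq_integral => //.
- by apply/measurable_EFinP.
- by apply/measurable_EFinP.
- by move=> x _; rewrite lee_fin.
- by move=> x _; rewrite lee_fin.
exists N; split => // x /= /not_implyP[_].
apply: contra_notP => Nx; congr (_%:E).
by rewrite [RHS](_ : _ = p x * \1_(~` N) x)%R// indicE mem_set ?mulr1.
Qed.

Lemma le_lower_integral (D : set T) (f h : T -> \bar R) :
  (forall x, 0 <= f x) -> (forall x, 0 <= h x) -> (forall x, f x <= h x) ->
  \int[mu]_(x in D) f x <= \int[mu]_(x in D) h x.
Proof.
by move=> f0 h0 fh; apply: (@le_lower_integral_off_null D set0).
Qed.

Lemma lower_integral_null (D : set T) (f : T -> \bar R) :
  measurable D -> mu D = 0 -> (forall x, 0 <= f x) ->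
  \int[mu]_(x in D) f x = 0.
Proof.
move=> mD D0 f0; apply/eqP; rewrite eq_le integral_ge0// andbT.
rewrite -[X in _ <= X](integral0 mu D).
exact: (@le_lower_integral_off_null D D).
Qed.

End lower_integral.

(** * From Borel to Lebesgue measurable densities *)

Section density_bound.
Context {R : realType}.
Local Notation lam n := (@lebesgue_rV R n).
Local Open Scope ereal_scope.

(** The Borel version of g is set to 0 on a Borel null set N that contains all points of
    disagreement. The inequality has to hold at every point: a subspace may lie inside N, and
    sections of h must not exceed those of g. *)
Lemma borel_minorant n (g : 'rV[R]_n -> R) : (forall x, (0 <= g x)%R) ->
  lebesgue_measurable_fun g ->
  exists2 h : 'rV[R]_n -> R, measurable_fun setT h &
    [/\ forall x, (0 <= h x)%R, forall x, (h x <= g x)%R &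
        forall K, mu_density g K <= mu_density h K].
Proof.
move=> g0 [h mh [N [mN N0 gh]]].
have ghN x : ~ N x -> g x = h x by move=> Nx; apply: contrapT => /gh.
have mNc : measurable (~` N) by exact: measurableC.
pose h' x := (h x * \1_(~` N) x)%R.
have h'E x : ~ N x -> h' x = g x.
  by move=> Nx; rewrite /h' indicE mem_set// mulr1 ghN.
have h'N x : N x -> h' x = 0%R by move=> Nx; rewrite /h' indicE memNset ?mulr0//; exact.
have h'0 x : (0 <= h' x)%R.
  by have [Nx|Nx] := pselect (N x); [rewrite h'N|rewrite h'E].
exists h'; first by apply: measurable_funM => //; exact: measurable_indic.
split => // [x|K].
  by have [Nx|Nx] := pselect (N x); [rewrite h'N|rewrite h'E].
apply: (le_lower_integral_off_null mN N0) => [x|x|x _ Nx].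
- by rewrite lee_fin.
- by rewrite lee_fin.
- by rewrite h'E.
Qed.

Lemma compact_coord_bound n (K : set 'rV[R]_n) : compact K ->
  exists rho : R, forall x i, K x -> (`|x ord0 i| <= rho)%R.
Proof.
move=> /compact_bounded[M [_ HM]]; exists (M + 1)%R => x i Kx.
apply: le_trans (HM (M + 1)%R _ x Kx); last by rewrite ltrDl.
rewrite (mx_normrE x : `|x|%R = _).
exact: (le_bigmax _ (fun ij : 'I_1 * 'I_n => `|x ij.1 ij.2|%R) (ord0, i)).
Qed.

Lemma compact_measurable_rV n (K : set 'rV[R]_n) : compact K -> measurable K.
Proof.
move=> /(compact_closed (@norm_hausdorff _ _)) cK.
by rewrite -[K]setCK; apply: measurableC; apply: open_measurable_rV; exact: closed_openC.
Qed.

Lemma lebesgue_rV_compact_fin n (K : set 'rV[R]_n) : compact K ->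
  lam n K \is a fin_num.
Proof.
move=> cK; have [rho Krho] := compact_coord_bound cK.
rewrite ge0_fin_numE ?measure_ge0//; have [M _ ME] := @lebesgue_cube R n rho.
apply: (@le_lt_trans _ _ (lam n (cube rho))); last by rewrite ME ltry.
apply: le_measure; rewrite ?inE; [exact: compact_measurable_rV|exact: measurable_cube|].
by move=> x Kx i; rewrite /= in_itv/= -ler_norml; exact: Krho.
Qed.

(** Membership of 0 is asked only for positive volume so that centered bodies fit as well: their
    centroid is obtained by dividing by the volume, and 0 in K is deduced from it when the volume is
    positive. *)
Lemma mu_density_le_max_section s k (g : 'rV[R]_(s + k) -> R) (K : set 'rV[R]_(s + k)) :
  (0 < s)%N -> (0 < k)%N -> (forall x, (0 <= g x)%R) ->
  lebesgue_measurable_fun g -> convex_set K -> compact K ->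
  (0 < lam (s + k) K -> K 0%R) ->
  mu_density g K <= ((c5 * Num.sqrt s%:R) ^+ k)%:E * max_section g s K
    * lam (s + k) K `^ (k%:R / (s + k)%:R).
Proof.
move=> s0 k0 g0 mg cK kK K0.
have mK := compact_measurable_rV kK.
have [rho Krho] := compact_coord_bound kK.
have M0 : 0 <= max_section g s K.
  apply: le_trans (ereal_sup_ubound _); last first.
    by exists (graph_space (0%R : 'M[R]_(k, s))); rewrite //= dim_graph_space.
  by apply: integral_ge0 => x _; rewrite lee_fin.
have cs0 : (0 < c5 * Num.sqrt (s%:R : R))%R.
  by rewrite mulr_gt0 ?sqrtr_gt0 ?ltr0n// divr_gt0// exprn_gt0// c1_gt0.
have p0 : (0 < ((k%:R : R) / (s + k)%:R))%R by rewrite divr_gt0 ?ltr0n ?addn_gt0 ?s0.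
have := measure_ge0 (lam (s + k)) K.
(* For volume 0 the left side is an integral over a null set, and the right side is nonnegative. *)
rewrite le_eqVlt => /predU1P[/esym v0|].
  rewrite /mu_density lower_integral_null//.
    by rewrite !mule_ge0 ?poweR_ge0// lee_fin exprn_ge0// ltW.
move=> V0; have /fineK vE := lebesgue_rV_compact_fin kK.
have {}K0 := K0 V0.
have {V0} : 0 < lam (s + k) K by exact: V0.
rewrite -vE; move: (fine _) vE => v vE; rewrite lte_fin => v0.
(* An infinite maximum makes the right side +oo, its other two factors being positive. *)
case ME : (max_section g s K) M0 => [M| |//] M0; last first.
  by rewrite gt0_muley ?lte_fin ?exprn_gt0// gt0_mulye ?leey// poweR_EFin lte_fin powR_gt0.
have [h mh [h0 hg gh]] := borel_minorant g0 mg.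
apply: le_trans (gh K) _.
(* The n-th root of the volume turns its fractional powers into natural powers of kap. *)
pose kap := (v `^ ((s + k)%:R^-1))%R.
have kap0 : (0 < kap)%R by exact: powR_gt0.
have n0 : ((s + k)%:R : R) != 0%R by rewrite pnatr_eq0 -lt0n addn_gt0 s0.
have -> : v%:E `^ (k%:R / (s + k)%:R) = (kap ^+ k)%:E.
  by rewrite poweR_EFin mulrC powRrM powR_mulrn// ltW.
rewrite -!EFinM; rewrite lee_fin in M0.
have vE' : lam (s + k) K = (kap ^+ (s + k))%:E.
  by rewrite -powR_mulrn ?ltW// -powRrM mulVf// powRr1 ?ltW.
apply: (mu_density_borel_le s0 k0 mK (convex_set_comb cK) K0 Krho kap0 vE' mh h0 M0).
(* h is below g everywhere, so its section by a graph is at most that of g, a lower integral bounded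
   by the maximum. *)
move=> B; rewrite -ME; apply: le_trans (ereal_sup_ubound _); last first.
  by exists (graph_space B); rewrite //= dim_graph_space.
by apply: le_lower_integral => x; rewrite lee_fin.
Qed.

End density_bound.

(** * Centered bodies contain the origin *)

Section centered_bodies.
Context {R : realType} {n : nat}.
Local Notation lam := (@lebesgue_rV R n).
Local Notation dot x y := (\sum_i x ord0 i * y ord0 i).

Lemma sqn_continuous : continuous (@sqn R n).
Proof.
rewrite (_ : @sqn R n = fun x => \sum_i x ord0 i * x ord0 i); last first.
  by apply/funext => x; rewrite sqnE; apply: eq_bigr => i _; rewrite expr2.
move=> x; apply: (@cvg_big R _ +%R) => [||i _]; first exact: add_continuous.
  exact: nbhs_filter.
by apply: cvgM; [exact: nbhs_filter|exact: coord_continuous..].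
Qed.

(* The nearest point to 0 separates 0 from K. *)
Lemma convex_separate0 (K : set 'rV[R]_n) :
  convex_comb K -> compact K -> K !=set0 -> ~ K 0 ->
  exists (a : 'rV[R]_n) (c : R), 0 < c /\ forall x, K x -> c <= dot a x.
Proof.
move=> cK kK Kne K0.
have [a aK amin] := EVT_min_rV Kne kK (continuous_subspaceT sqn_continuous).
rewrite inE in aK.
have a0 : 0 < sqn a by rewrite sqn_gt0; apply: contra_notN K0 => /eqP <-.
exists a, (sqn a); split => // x Kx; rewrite leNgt; apply/negP => ax.
set e := sqn a - dot a x; have e0 : 0 < e by rewrite subr_gt0.
set b := sqn (x - a); have b0 : 0 <= b by exact: sqn_ge0.
have sqnD t : sqn (t *: x + (1 - t) *: a) = sqn a - 2 * t * e + t ^+ 2 * b.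
  rewrite /e /b !sqnE mulrBr !mulr_sumr -sumrB -sumrB -big_split/=.
  by apply: eq_bigr => i _; rewrite !mxE; ring.
(* The quadratic is minimal at e / b, which may exceed 1 or have b = 0. This smaller t stays in ]0,
   1] and still has t b <= e, so t^2 b < 2 t e. *)
pose t := e / (e + b); have eb0 : 0 < e + b by rewrite ltr_pwDl.
have t0 : 0 < t by rewrite divr_gt0.
have t1 : t <= 1 by rewrite ler_pdivrMr// mul1r lerDl.
have := amin (t *: x + (1 - t) *: a) (mem_set (cK _ _ _ (ltW t0) t1 Kx aK)).
rewrite sqnD leNgt => /negP; apply.
have tb : t * b <= e.
  by rewrite /t mulrAC ler_pdivrMr// ler_pM2l// lerDr ltW.
have := ler_wpM2l (ltW t0) tb; have := mulr_gt0 t0 e0.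
by rewrite expr2; lra.
Qed.

Local Open Scope ereal_scope.

(** Otherwise a linear form is at least c > 0 on K, while its integral over K vanishes because the
    integrals of all coordinates do. *)
Lemma centered_mem0 (K : set 'rV[R]_n) :
  convex_comb K -> compact K -> 0 < lam K -> centered K -> K 0%R.
Proof.
move=> cK kK vK cen; apply: contrapT => K0.
have mK := compact_measurable_rV kK.
have Kne : K !=set0.
  by apply/set0P; apply: contraPneq vK => ->; rewrite measure0 ltxx.
have [a [c [c0 aK]]] := convex_separate0 cK kK Kne K0.
have vfin := lebesgue_rV_compact_fin kK.
have ix i : lam.-integrable K (fun x => (x ord0 i)%:E).
  apply: measurable_bounded_integrable => //.
  - by rewrite -ge0_fin_numE ?measure_ge0.
  - by apply: measurable_funTS; exact: measurable_coord.
  have [rho Krho] := compact_coord_bound kK.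
  exists rho; split; first exact: num_real.
  by move=> M rM x /= Kx; apply: le_trans (Krho x i Kx) (ltW rM).
(* The centroid is this integral divided by the volume; a zero denominator, which would also make it
   0, is excluded by [vK]. *)
have x0 i : \int[lam]_(x in K) (x ord0 i)%:E = 0.
  have := congr1 (fun u : 'rV[R]_n => u ord0 i) cen; rewrite !mxE => /eqP.
  rewrite mulf_eq0 invr_eq0 => /orP[/eqP h|/eqP h]; last first.
    by move: vK; rewrite -(fineK vfin) h ltxx.
  rewrite -[LHS]fineK; first by congr (_%:E).
  exact: integrable_fin_num.
have iax i : lam.-integrable K (fun x => (a ord0 i)%:E * (x ord0 i)%:E).
  exact: integrableZl.
have : c%:E * lam K <= \int[lam]_(x in K) \sum_i ((a ord0 i)%:E * (x ord0 i)%:E).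
  rewrite -integral_cst//; apply: le_integral => //.
  - apply: (@measurable_bounded_integrable _ _ _ _ (cst c)) => //.
      by rewrite -ge0_fin_numE ?measure_ge0.
    by exists `|c|%R; split; [exact: num_real|move=> M cM x _; exact: ltW].
  - exact: integrable_sum.
  move=> x; rewrite inE => Kx; under eq_bigr do rewrite -EFinM.
  by rewrite sumEFin lee_fin; exact: aK.
rewrite integral_sum//; under eq_bigr do rewrite integralZl// x0 mule0.
rewrite big1// leNgt => /negP; apply.
by rewrite mule_gt0 ?lte_fin.
Qed.

End centered_bodies.

Local Open Scope ereal_scope.

Lemma centered_density_le {R : realType} s k (g : 'rV[R]_(s + k) -> R) (K : set 'rV[R]_(s + k)) :
  (0 < s)%N -> (0 < k)%N -> (forall x, (0 <= g x)%R) ->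
  lebesgue_measurable_fun g -> convex_body K -> centered K ->
  mu_density g K <= ((c5 * Num.sqrt s%:R) ^+ k)%:E * max_section g s K
    * lebesgue_rV K `^ (k%:R / (s + k)%:R).
Proof.
move=> s0 k0 g0 mg [cK kK _] cen.
apply: mu_density_le_max_section => // v0.
exact: centered_mem0 (convex_set_comb cK) kK v0 cen.
Qed.

Local Open Scope ereal_scope.

Theorem theorem1p1 (R : realType) :
  exists c5 : R, (0 < c5)%R /\
  forall (n : nat) (g : 'rV[R]_n -> R), (2 <= n)%N ->
  (forall x, (0 <= g x)%R) -> bounded_fun g -> locally_integrable_rV g ->
  forall k : nat, (1 <= k <= n - 1)%N ->
  (forall K : set 'rV[R]_n, convex_body K -> interior K 0%R ->
     mu_density g K <=
       ((c5 * Num.sqrt (n - k)%:R) ^+ k)%:E * max_section g (n - k) K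
         * lebesgue_rV K `^ (k%:R / n%:R)) /\
  alpha g k <= (c5 * Num.sqrt (n - k)%:R)%:E.
Proof.
exists c5; have c50 : (0 < @c5 R)%R by rewrite divr_gt0// exprn_gt0// c1_gt0.
split => // n g n2 g0 _ [mg _] k /andP[k0 kn].
(* Writing n as s + k makes the row vectors split into the two blocks used by [graph_mx]. *)
have [s nE] : exists s, n = (s + k)%N by exists (n - k)%N; lia.
subst n; have s0 : (0 < s)%N by lia.
rewrite /alpha addnK; split => [K [cK kK _] K0|].
  by apply: mu_density_le_max_section => // _; exact: interior_subset K0.
apply: ereal_inf_lbound; exists (c5 * Num.sqrt s%:R)%R => //=; split.
  by rewrite mulr_gt0// sqrtr_gt0 ltr0n.
by move=> K cK cen; exact: centered_density_le.
Qed.
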